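(* Let $K\subset S^3$ be a hyperbolic knot and let $p,q$ be coprime integers. If $\lambda(p,q)>0$, then the group $\pi_1(K(p/q))$ is non-cyclic.
   Context: For a hyperbolic knot $K\subset S^3$ let $M_K=S^3\setminus N_K$, where $N_K$ is an open tubular neighborhood of $K$; $\partial M_K$ is a torus. Fix oriented simple closed curves $\mu$ (meridian) and $\lambda$ (longitude) generating $\pi_1(\partial M_K)=\mathbb{Z}\oplus\mathbb{Z}$. Put $R(M_K)=\mathrm{Hom}(\pi_1(M_K),SL_2(\mathbb{C}))$ and $R(\partial M_K)=\mathrm{Hom}(\pi_1(\partial M_K),SL_2(\mathbb{C}))$, with character varieties $X(M_K)$, $X(\partial M_K)$, canonical surjections $t:R(\cdot)\to X(\cdot)$ sending $\rho$ to its character $\chi_\rho=\mathrm{tr}\,\rho$, and restriction map $r:X(M_K)\to X(\partial M_K)$. $X(\partial M_K)$ is identified with its image in $\mathbb{C}^3$ under $\chi\mapsto(\chi(\mu),\chi(\lambda),\chi(\mu\lambda))$; it is an affine surface. Let $\rho_0\in R(M_K)$ be the discrete faithful representation corresponding to the hyperbolic structure, $R_0$ an irreducible component of $R(M_K)$ containing $\rho_0$, and $X_0=t(R_0)$, an irreducible affine curve. Define $t_D:\mathbb{C}^*\times\mathbb{C}^*\to X(\partial M_K)$ by $t_D(m,l)=(m+m^{-1},\,l+l^{-1},\,ml+m^{-1}l^{-1})$. For coprime integers $p,q$, let $E(p,q)\subset\mathbb{C}^*\times\mathbb{C}^*$ be the curve $m^pl^q=\pm1$ (the union of both signs), let $K(p/q)$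 be the closed $3$-manifold obtained from $M_K$ by Dehn surgery along the simple closed curve in $\partial M_K$ representing $p\mu+q\lambda$, let $S(p,q)=\{\chi\in t_D(E(p,q))\cap r(X_0): \chi(\mu)\neq\pm2\}$ (a finite set), and let $\lambda(p,q)=\sum_{\chi\in S(p,q)}n_\chi$, where $n_\chi\ge 1$ is the (algebraic) intersection multiplicity at $\chi$ of the curves $t_D(E(p,q))$ and $r(X_0)$ in the surface $X(\partial M_K)$. (Thus $\lambda(p,q)>0$ exactly when $S(p,q)\neq\emptyset$.) *)

(* Defs.v *)
From HB Require Import structures.
From mathcomp Require Import all_boot all_order all_algebra.
From mathcomp Require Import generic_quotient.
From mathcomp Require Import all_classical all_reals all_analysis.
From mathcomp Require Import complex.
From mathcomp Require Import lra.
From Stdlib Require Import Relation_Operators.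

Set Implicit Arguments.
Unset Strict Implicit.
Unset Printing Implicit Defensive.

Import Order.TTheory GRing.Theory Num.Theory.
Import numFieldNormedType.Exports.
Local Open Scope classical_set_scope.
Local Open Scope quotient_scope.
Local Open Scope ring_scope.

Section Continuity.
Variable R : realType.

Lemma continuous_compose (X Y Z : topologicalType) (f : X -> Y) (g : Y -> Z) :
  continuous f -> continuous g -> continuous (fun u => g (f u)).
Proof. by move=> cf cg u; apply: continuous_comp; [exact: cf | exact: cg]. Qed.

Lemma continuous_pair (X Y Z : topologicalType) (f : X -> Y) (g : X -> Z) :
  continuous f -> continuous g -> continuous (fun u => (f u, g u)).
Proof. by move=> cf cg u; apply: cvg_pair; [exact: cf | exact: cg]. Qed.

Lemma continuous_fst (X Y : topologicalType) : continuous (@fst X Y).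
Proof. by move=> u; exact: cvg_fst. Qed.

Lemma continuous_snd (X Y : topologicalType) : continuous (@snd X Y).
Proof. by move=> u; exact: cvg_snd. Qed.

Lemma continuous_affine (X : topologicalType) (f : X -> R) (a b : R) :
  continuous f -> continuous (fun u => a * f u + b).
Proof.
move=> cf u; apply: cvgD; last exact: cvg_cst.
by apply: cvgM; [exact: cvg_cst | exact: cf].
Qed.

Lemma continuous_scale (X : topologicalType) (f : X -> R) (a : R) :
  continuous f -> continuous (fun u => a * f u).
Proof. by move=> cf u; apply: cvgM; [exact: cvg_cst | exact: cf]. Qed.

Lemma continuous_csub (X : topologicalType) (f : X -> R) (a : R) :
  continuous f -> continuous (fun u => a - f u).
Proof. by move=> cf u; apply: cvgB; [exact: cvg_cst | exact: cf]. Qed.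

Lemma paste (X Y : topologicalType) (h : X -> R) (f g : X -> Y) :
  continuous h -> continuous f -> continuous g ->
  (forall x, h x = 0 -> f x = g x) ->
  continuous (fun x => if h x <= 0 then f x else g x).
Proof.
move=> ch cf cg fg; set k := (fun x => _).
pose A := h @^-1` [set y | y <= 0]; pose B := h @^-1` [set y | 0 <= y].
have cA : closed A by apply: preimage_closed; [move=> ? _; exact: ch | exact: closed_le].
have cB : closed B by apply: preimage_closed; [move=> ? _; exact: ch | exact: closed_ge].
have kA : {in A, f =1 k} by move=> x; rewrite inE /A /k /= => ->.
have kB : {in B, g =1 k}.
  move=> x; rewrite inE /B /k /= => hx; case: ifPn => // hx'.
  by apply/esym/fg/le_anti; rewrite hx hx'.
apply/continuous_subspace_setT.
have -> : [set: X] = A `|` B.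
  by apply/seteqP; split=> x //= _; case: (leP (h x) 0) => [|/ltW]; [left|right].
apply: withinU_continuous => //.
- by apply: (subspace_eq_continuous kA); apply: continuous_subspaceT.
- by apply: (subspace_eq_continuous kB); apply: continuous_subspaceT.
Qed.

Lemma continuous_maxr (X : topologicalType) (f g : X -> R) :
  continuous f -> continuous g -> continuous (fun x => Num.max (f x) (g x)).
Proof. by move=> cf cg x; apply: (@continuous_max R X f g x); [exact: cf | exact: cg]. Qed.

Lemma continuous_minr (X : topologicalType) (f g : X -> R) :
  continuous f -> continuous g -> continuous (fun x => Num.min (f x) (g x)).
Proof. by move=> cf cg x; apply: (@continuous_min R X f g x); [exact: cf | exact: cg]. Qed.

Definition clamp (t : R) : R := Num.max 0 (Num.min t 1).

Lemma clamp_ge0 t : 0 <= clamp t.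
Proof. by rewrite /clamp le_max lexx. Qed.

Lemma clamp_le1 t : clamp t <= 1.
Proof. by rewrite /clamp ge_max ler01 ge_min lexx orbT. Qed.

Lemma clamp0 t : t <= 0 -> clamp t = 0.
Proof. by move=> t0; rewrite /clamp min_l ?max_l // (le_trans t0). Qed.

Lemma clamp1 t : 1 <= t -> clamp t = 1.
Proof. by move=> t1; rewrite /clamp min_r ?max_r. Qed.

Lemma continuous_clamp : continuous clamp.
Proof.
apply: continuous_maxr; first exact: cst_continuous.
by apply: continuous_minr; [move=> ?; exact: cvg_id | exact: cst_continuous].
Qed.

End Continuity.

Section Loops.
Variables (R : realType) (T : topologicalType) (x : T).

(* A loop on [0, 1] is represented by its extension to R with the constant
   value x outside the interval. *)
Record loop := Loop {
  loop_fun :> R -> T;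
  loop_continuous : continuous loop_fun;
  loop_le0 : forall t, t <= 0 -> loop_fun t = x;
  loop_ge1 : forall t, 1 <= t -> loop_fun t = x }.

HB.instance Definition _ := gen_eqMixin loop.
HB.instance Definition _ := gen_choiceMixin loop.

(* The parameter s of a homotopy ranges over R; a homotopy parametrized by
   [0, 1] extends by being constant in s outside the interval. *)
Definition homotopic (f g : loop) : Prop :=
  exists H : R * R -> T,
    [/\ continuous H,
        forall t, H (0, t) = f t,
        forall t, H (1, t) = g t
      & forall s t, t <= 0 \/ 1 <= t -> H (s, t) = x].

Lemma homotopic_refl f : homotopic f f.
Proof.
exists (fun u => f u.2); split => // [|s t [?|?]].
- by apply: continuous_compose; [exact: continuous_snd | exact: loop_continuous].
- exact: loop_le0.
- exact: loop_ge1.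
Qed.

Lemma homotopic_ext (f g : loop) : f =1 g -> homotopic f g.
Proof.
by move=> fg; have [H [cH H0 H1 Hx]] := homotopic_refl f; exists H; split => // t; rewrite H1.
Qed.

Lemma homotopic_sym f g : homotopic f g -> homotopic g f.
Proof.
move=> [H [cH H0 H1 Hx]]; exists (fun u => H (1 - u.1, u.2)); split => [|t|t|s t ?].
- apply: continuous_compose cH; apply: continuous_pair; last exact: continuous_snd.
  by apply: continuous_csub; exact: continuous_fst.
- by rewrite subr0.
- by rewrite subrr.
- exact: Hx.
Qed.

Lemma homotopic_trans f g h : homotopic f g -> homotopic g h -> homotopic f h.
Proof.
move=> [H [cH H0 H1 Hx]] [K [cK K0 K1 Kx]].
have c1 : continuous (fun u : R * R => 2 * u.1 - 1).
  by apply: continuous_affine; exact: continuous_fst.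
exists (fun u => if 2 * u.1 - 1 <= 0 then H (2 * u.1, u.2) else K (2 * u.1 - 1, u.2)).
split => [|t|t|s t ht].
- apply: paste => //.
  + apply: continuous_compose cH; apply: continuous_pair; last exact: continuous_snd.
    by apply: continuous_scale; exact: continuous_fst.
  + by apply: continuous_compose cK; apply: continuous_pair; last exact: continuous_snd.
  + move=> [s t] /= s0; rewrite s0 K0.
    by have -> : 2 * s = 1 by lra.
- by rewrite /= ifT ?mulr0 ?H0 //; lra.
- by rewrite /= ifF; [have -> : 2 * 1 - 1 = 1 :> R by lra | apply/negbTE; lra].
- by case: ifP; rewrite ?Hx ?Kx.
Qed.

Lemma homotopic_reparam (f g : loop) (phi : R -> R) :
  continuous phi -> (forall t, t <= 0 -> phi t <= 0) ->
  (forall t, 1 <= t -> 1 <= phi t) -> (forall t, g t = f (phi t)) ->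
  homotopic f g.
Proof.
move=> cphi phi0 phi1 gE.
exists (fun u => f ((1 - clamp u.1) * u.2 + clamp u.1 * phi u.2)).
split => [|t|t|s t].
- have cl : continuous (fun v : R * R => clamp v.1).
    by apply: continuous_compose; [exact: continuous_fst | exact: continuous_clamp].
  apply: continuous_compose; last exact: loop_continuous.
  move=> u; apply: cvgD; apply: cvgM.
  + by apply: cvgB; [exact: cvg_cst | exact: cl].
  + exact: cvg_snd.
  + exact: cl.
  + by move: u; apply: continuous_compose; [exact: continuous_snd | exact: cphi].
- by rewrite /= clamp0 // subr0 mul1r mul0r addr0.
- by rewrite /= clamp1 // subrr mul1r mul0r add0r gE.
- have := clamp_ge0 s; have := clamp_le1 s; set c := clamp s => c1 c0 [t0|t1] /=.
  + have := phi0 t t0; set y := phi t => y0.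
    apply: loop_le0; nra.
  + have := phi1 t t1; set y := phi t => y1.
    apply: loop_ge1; nra.
Qed.

Lemma loop_cst_subproof : continuous (fun _ : R => x).
Proof. by move=> ?; exact: cvg_cst. Qed.

Definition loop_cst : loop :=
  Loop loop_cst_subproof (fun _ _ => erefl) (fun _ _ => erefl).

Lemma loop_cat_subproof (f g : loop) :
  let h := fun t => if 2 * t - 1 <= 0 then f (2 * t) else g (2 * t - 1) in
  [/\ continuous h, forall t, t <= 0 -> h t = x & forall t, 1 <= t -> h t = x].
Proof.
move=> h; have c1 : continuous (fun t : R => 2 * t).
  by apply: continuous_scale => ?; exact: cvg_id.
have c2 : continuous (fun t : R => 2 * t - 1).
  by apply: continuous_affine => ?; exact: cvg_id.
split => [|t t0|t t1].
- apply: paste => //.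
  + by apply: continuous_compose; [exact: c1 | exact: loop_continuous].
  + by apply: continuous_compose; [exact: c2 | exact: loop_continuous].
  + by move=> t t0; rewrite loop_ge1 ?loop_le0 //; lra.
- by rewrite /h ifT ?loop_le0 //; lra.
- by rewrite /h ifF ?loop_ge1 //; [lra | apply/negbTE; lra].
Qed.

Definition loop_cat (f g : loop) : loop :=
  let: And3 c h0 h1 := loop_cat_subproof f g in Loop c h0 h1.

Lemma loop_catE f g t :
  loop_cat f g t = if 2 * t - 1 <= 0 then f (2 * t) else g (2 * t - 1).
Proof. by rewrite /loop_cat; case: loop_cat_subproof. Qed.

Lemma loop_rev_subproof (f : loop) :
  let h := fun t => f (1 - t) in
  [/\ continuous h, forall t, t <= 0 -> h t = x & forall t, 1 <= t -> h t = x].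
Proof.
split => [|t t0|t t1].
- apply: continuous_compose; last exact: loop_continuous.
  by apply: continuous_csub => ?; exact: cvg_id.
- by apply: loop_ge1; lra.
- by apply: loop_le0; lra.
Qed.

Definition loop_rev (f : loop) : loop :=
  let: And3 c h0 h1 := loop_rev_subproof f in Loop c h0 h1.

Lemma loop_revE f t : loop_rev f t = f (1 - t).
Proof. by rewrite /loop_rev; case: loop_rev_subproof. Qed.

Lemma homotopic_cat f f' g g' :
  homotopic f f' -> homotopic g g' -> homotopic (loop_cat f g) (loop_cat f' g').
Proof.
move=> [H [cH H0 H1 Hx]] [K [cK K0 K1 Kx]].
have c1 : continuous (fun u : R * R => 2 * u.2).
  by apply: continuous_scale; exact: continuous_snd.
have c2 : continuous (fun u : R * R => 2 * u.2 - 1).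
  by apply: continuous_affine; exact: continuous_snd.
exists (fun u => if 2 * u.2 - 1 <= 0 then H (u.1, 2 * u.2) else K (u.1, 2 * u.2 - 1)).
split => [|t|t|s t ht].
- apply: paste => //.
  + by apply: continuous_compose cH; apply: continuous_pair; [exact: continuous_fst|].
  + by apply: continuous_compose cK; apply: continuous_pair; [exact: continuous_fst|].
  + by move=> [s t] /= t0; rewrite Hx ?Kx //; [left | right]; lra.
- by rewrite loop_catE /= H0 K0.
- by rewrite loop_catE /= H1 K1.
- case: ifPn => /=; case: ht => ht h'; rewrite ?Hx ?Kx //; [left|right|left|right]; lra.
Qed.

Lemma homotopic_rev f g : homotopic f g -> homotopic (loop_rev f) (loop_rev g).
Proof.
move=> [H [cH H0 H1 Hx]]; exists (fun u => H (u.1, 1 - u.2)).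
split => [|t|t|s t ht].
- apply: continuous_compose cH; apply: continuous_pair; first exact: continuous_fst.
  by apply: continuous_csub; exact: continuous_snd.
- by rewrite loop_revE H0.
- by rewrite loop_revE H1.
- by apply: Hx => /=; case: ht => ?; [right|left]; lra.
Qed.

Lemma homotopic_catA f g h :
  homotopic (loop_cat f (loop_cat g h)) (loop_cat (loop_cat f g) h).
Proof.
apply: homotopic_sym.
pose phi (t : R) : R := Num.max (2^-1 * t + 0) (Num.max (1 * t + - 4^-1) (2 * t + -1)).
apply: (@homotopic_reparam _ _ phi) => [t|t t0|t t1|t].
- move: t; apply: continuous_maxr; first by apply: continuous_affine => ?; exact: cvg_id.
  by apply: continuous_maxr; by apply: continuous_affine => ?; exact: cvg_id.
- by rewrite /phi !ge_max; apply/and3P; split; lra.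
- by rewrite /phi !le_max; apply/or3P/Or33; lra.
- have [t2|t2] := leP (2 * t - 1) 0.
    have -> : phi t = 2^-1 * t.
      by rewrite /phi max_l ?addr0 // ge_max; apply/andP; split; lra.
    rewrite loop_catE t2 loop_catE ifT; last lra.
    by rewrite loop_catE ifT; [congr (loop_fun f _); lra | lra].
  have [t3|t3] := leP (4 * t - 3) 0.
    have -> : phi t = t - 4^-1.
      by rewrite /phi [X in Num.max _ X]max_l ?max_r ?mul1r //; lra.
    rewrite loop_catE ifF; last by apply/negbTE; lra.
    rewrite loop_catE ifT; last lra.
    rewrite loop_catE ifT; last lra.
    rewrite loop_catE ifF; last by apply/negbTE; lra.
    by congr (loop_fun g _); lra.
  have -> : phi t = 2 * t - 1.
    by rewrite /phi [X in Num.max _ X]max_r ?max_r //; lra.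
  rewrite loop_catE ifF; last by apply/negbTE; lra.
  rewrite loop_catE ifF; last by apply/negbTE; lra.
  by rewrite loop_catE ifF //; apply/negbTE; lra.
Qed.

Lemma homotopic_cat1l f : homotopic (loop_cat loop_cst f) f.
Proof.
apply: homotopic_sym; apply: (@homotopic_reparam _ _ (fun t => 2 * t + -1)).
- by apply: continuous_affine => ?; exact: cvg_id.
- by move=> t t0; lra.
- by move=> t t0; lra.
- by move=> t; rewrite loop_catE; case: ifP => // t0; rewrite (loop_le0 f).
Qed.

Lemma homotopic_cat1r f : homotopic (loop_cat f loop_cst) f.
Proof.
apply: homotopic_sym; apply: (@homotopic_reparam _ _ (fun t => 2 * t + 0)).
- by apply: continuous_affine => ?; exact: cvg_id.
- by move=> t t0; lra.
- by move=> t t0; lra.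
- move=> t; rewrite loop_catE addr0; case: ifPn => // t0.
  by rewrite (loop_ge1 f) //; lra.
Qed.

Lemma homotopic_cat_revl f : homotopic (loop_cat (loop_rev f) f) loop_cst.
Proof.
exists (fun u => f (Num.max `|2 * u.2 - 1| u.1)); split => [|t|t|s t ht].
- apply: continuous_compose; last exact: loop_continuous.
  apply: continuous_maxr => u; last exact: cvg_fst.
  apply: cvg_norm; move: u; apply: continuous_affine; exact: continuous_snd.
- rewrite /= max_l // loop_catE loop_revE; case: ifPn => t0.
    by rewrite ler0_norm //; congr (f _); lra.
  by rewrite ger0_norm //; lra.
- by apply: loop_ge1; rewrite /= le_max lexx orbT.
- apply: loop_ge1; rewrite /= le_max; apply/orP; left; rewrite ler_normr.
  by case: ht => ?; apply/orP; [right | left]; lra.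
Qed.

Lemma homotopic_cat_revr f : homotopic (loop_cat f (loop_rev f)) loop_cst.
Proof.
apply: homotopic_trans (homotopic_cat_revl (loop_rev f)).
apply: homotopic_cat; last exact: homotopic_refl.
by apply: homotopic_ext => t; rewrite !loop_revE; congr (f _); lra.
Qed.

Let homotopicb f g := `[< homotopic f g >].

Let homotopicb_refl : reflexive homotopicb.
Proof. by move=> f; apply/asboolP; exact: homotopic_refl. Qed.

Let homotopicb_sym : symmetric homotopicb.
Proof. by move=> f g; apply/asbool_equiv_eq; split; exact: homotopic_sym. Qed.

Let homotopicb_trans : transitive homotopicb.
Proof.
by move=> g f h /asboolP fg /asboolP gh; apply/asboolP; exact: homotopic_trans fg gh.
Qed.

Definition homotopy_equiv :=
  EquivRel homotopicb homotopicb_refl homotopicb_sym homotopicb_trans.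

Definition pi1 : Type := {eq_quot homotopy_equiv}.

HB.instance Definition _ := Choice.on pi1.

Definition pi1_class (f : loop) : pi1 := \pi_({eq_quot homotopy_equiv}) f.

Definition pi1_repr (a : pi1) : loop := repr (a : {eq_quot homotopy_equiv}).

Lemma pi1_reprK a : pi1_class (pi1_repr a) = a.
Proof. exact: reprK. Qed.

Lemma pi1_classP f g : pi1_class f = pi1_class g <-> homotopic f g.
Proof.
split=> [/(eqquotP {eq_quot homotopy_equiv})/asboolP //|/asboolP fg].
exact/(eqquotP {eq_quot homotopy_equiv}).
Qed.

Lemma pi1_classK f : homotopic (pi1_repr (pi1_class f)) f.
Proof. by apply/pi1_classP; rewrite pi1_reprK. Qed.

Definition pi1_mul (a b : pi1) : pi1 :=
  pi1_class (loop_cat (pi1_repr a) (pi1_repr b)).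

Definition pi1_inv (a : pi1) : pi1 := pi1_class (loop_rev (pi1_repr a)).

Let mulE f g : pi1_mul (pi1_class f) (pi1_class g) = pi1_class (loop_cat f g).
Proof. by apply/pi1_classP/homotopic_cat; exact: pi1_classK. Qed.

Let pi1_mulA : associative pi1_mul.
Proof.
move=> a b c; rewrite -[a]pi1_reprK -[b]pi1_reprK -[c]pi1_reprK !mulE.
exact/pi1_classP/homotopic_catA.
Qed.

Let pi1_mul1g : left_id (pi1_class loop_cst) pi1_mul.
Proof. by move=> a; rewrite -[a]pi1_reprK mulE; exact/pi1_classP/homotopic_cat1l. Qed.

Let pi1_mulg1 : right_id (pi1_class loop_cst) pi1_mul.
Proof. by move=> a; rewrite -[a]pi1_reprK mulE; exact/pi1_classP/homotopic_cat1r. Qed.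

Let pi1_mulVg : left_inverse (pi1_class loop_cst) pi1_inv pi1_mul.
Proof.
move=> a; rewrite /pi1_inv -{2}[a]pi1_reprK mulE.
exact/pi1_classP/homotopic_cat_revl.
Qed.

Let pi1_mulgV : right_inverse (pi1_class loop_cst) pi1_inv pi1_mul.
Proof.
move=> a; rewrite /pi1_inv -{1}[a]pi1_reprK mulE.
exact/pi1_classP/homotopic_cat_revr.
Qed.

HB.instance Definition _ := isGroup.Build pi1
  pi1_mulA pi1_mul1g pi1_mulg1 pi1_mulVg pi1_mulgV.

Lemma pi1_classM f g :
  (pi1_class f * pi1_class g)%g = pi1_class (loop_cat f g).
Proof. exact: mulE. Qed.

End Loops.

Arguments loop : clear implicits.
Arguments pi1 : clear implicits.

Section InducedMap.
Variables (R : realType) (X Y : topologicalType) (f : continuousType X Y) (x : X).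

Lemma loop_map_subproof (l : loop R X x) :
  [/\ continuous (f \o l), forall t, t <= 0 -> (f \o l) t = f x
    & forall t, 1 <= t -> (f \o l) t = f x].
Proof.
split=> [|t t0|t t1] /=; last by rewrite loop_ge1.
- by apply: continuous_compose; [exact: loop_continuous | exact: cts_fun].
- by rewrite loop_le0.
Qed.

Definition loop_map (l : loop R X x) : loop R Y (f x) :=
  let: And3 c h0 h1 := loop_map_subproof l in Loop c h0 h1.

Lemma loop_mapE l t : loop_map l t = f (l t).
Proof. by rewrite /loop_map; case: loop_map_subproof. Qed.

Lemma homotopic_map l l' : homotopic l l' -> homotopic (loop_map l) (loop_map l').
Proof.
move=> [H [cH H0 H1 Hx]]; exists (f \o H); split => [|t|t|s t ht] /=.
- by apply: continuous_compose; [exact: cH | exact: cts_fun].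
- by rewrite loop_mapE H0.
- by rewrite loop_mapE H1.
- by rewrite Hx.
Qed.

Definition pi1_map (a : pi1 R X x) : pi1 R Y (f x) := pi1_class (loop_map (pi1_repr a)).

Lemma pi1_map_class l : pi1_map (pi1_class l) = pi1_class (loop_map l).
Proof. by apply/pi1_classP/homotopic_map; exact: pi1_classK. Qed.

Let pi1_mapM : {morph pi1_map : a b / (a * b)%g}.
Proof.
move=> a b; rewrite -[a]pi1_reprK -[b]pi1_reprK pi1_classM !pi1_map_class pi1_classM.
apply/pi1_classP/homotopic_ext => t.
by rewrite loop_mapE !loop_catE; case: ifP; rewrite loop_mapE.
Qed.

HB.instance Definition _ := isMultiplicative.Build _ _ pi1_map pi1_mapM.

End InducedMap.

Arguments pi1_map R {X Y} f x.

Section Groups.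
Variable G : groupType.

Definition cyclic_group : Prop :=
  exists g : G, forall x : G, exists n : nat, x = (g ^+ n)%g \/ x = (g ^- n)%g.

(* The products of commutators; the inverse of a commutator is a commutator. *)
Inductive in_derived : G -> Prop :=
| in_derived1 : in_derived 1%g
| in_derivedM x y z : in_derived z -> in_derived ([~ x, y] * z)%g.

End Groups.

Section SL2.
Variable F : fieldType.

Record SL2 := MkSL2 { SL2_mx :> 'M[F]_2; SL2_det : \det SL2_mx == 1 }.

HB.instance Definition _ := [isSub for SL2_mx].
HB.instance Definition _ := [Choice of SL2 by <:].

Let mul_subproof (A B : SL2) : \det (A *m B) == 1.
Proof. by rewrite det_mulmx (eqP (SL2_det A)) (eqP (SL2_det B)) mulr1. Qed.

Let one_subproof : \det (1%:M : 'M[F]_2) == 1.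
Proof. by rewrite det1. Qed.

Let inv_subproof (A : SL2) : \det (invmx A) == 1.
Proof. by rewrite det_inv (eqP (SL2_det A)) invr1. Qed.

Let SL2_unit (A : SL2) : (A : 'M[F]_2) \in unitmx.
Proof. by rewrite unitmxE (eqP (SL2_det A)) unitr1. Qed.

Definition SL2_mul A B := MkSL2 (mul_subproof A B).
Definition SL2_one := MkSL2 one_subproof.
Definition SL2_inv A := MkSL2 (inv_subproof A).

Let SL2_mulA : associative SL2_mul.
Proof. by move=> A B C; apply: val_inj; rewrite /= mulmxA. Qed.
Let SL2_mul1g : left_id SL2_one SL2_mul.
Proof. by move=> A; apply: val_inj; rewrite /= mul1mx. Qed.
Let SL2_mulg1 : right_id SL2_one SL2_mul.
Proof. by move=> A; apply: val_inj; rewrite /= mulmx1. Qed.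
Let SL2_mulVg : left_inverse SL2_one SL2_inv SL2_mul.
Proof. by move=> A; apply: val_inj; rewrite /= mulVmx. Qed.
Let SL2_mulgV : right_inverse SL2_one SL2_inv SL2_mul.
Proof. by move=> A; apply: val_inj; rewrite /= mulmxV. Qed.

HB.instance Definition _ := isGroup.Build SL2
  SL2_mulA SL2_mul1g SL2_mulg1 SL2_mulVg SL2_mulgV.

End SL2.

Section Polynomial.
Variables (F : fieldType) (T I : Type) (x : I -> T -> F).

(* The functions on T that are polynomials in finitely many of the coordinates
   x i, i.e. the coordinate ring of T when the x i are affine coordinates. *)
Inductive polyfun : (T -> F) -> Prop :=
| polyfun_cst c : polyfun (fun _ => c)
| polyfun_coord i : polyfun (x i)
| polyfunD f g : polyfun f -> polyfun g -> polyfun (fun u => f u + g u)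
| polyfunM f g : polyfun f -> polyfun g -> polyfun (fun u => f u * g u).

Definition zariski_closed (Z : set T) : Prop :=
  exists E : set (T -> F), E `<=` polyfun /\ Z = [set u | forall f, E f -> f u = 0].

Definition zariski_irreducible (Z : set T) : Prop :=
  Z !=set0 /\
  forall Z1 Z2, zariski_closed Z1 -> zariski_closed Z2 ->
    Z `<=` Z1 `|` Z2 -> Z `<=` Z1 \/ Z `<=` Z2.

Definition irreducible_component (Z : set T) : Prop :=
  [/\ zariski_closed Z, zariski_irreducible Z
    & forall Z', zariski_closed Z' -> zariski_irreducible Z' -> Z `<=` Z' -> Z' = Z].

Definition vanishing_ideal (Z : set T) : set (T -> F) :=
  [set f | polyfun f /\ forall u, Z u -> f u = 0].

(* The classes of P 0, ..., P (n - 1) are linearly independent in the local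
   ring O_u / (I(Z1) + I(Z2)), where O_u is the localization of the ring of
   polynomial functions at u: a combination vanishes there iff its product with
   some h such that h u != 0 belongs to I(Z1) + I(Z2).  Clearing denominators
   makes it enough to consider polynomials rather than fractions. *)
Definition local_free (Z1 Z2 : set T) (u : T) (n : nat) (P : 'I_n -> T -> F) : Prop :=
  forall c : 'I_n -> F,
    (exists h f1 f2, [/\ polyfun h, h u != 0, vanishing_ideal Z1 f1,
       vanishing_ideal Z2 f2
     & forall v, h v * (\sum_(i < n) c i * P i v) = f1 v + f2 v]) ->
    forall i, c i = 0.

(* The dimension of O_u / (I(Z1) + I(Z2)).  For curves Z1 and Z2 on a surface
   which is smooth at u, this is their intersection multiplicity at u; the
   ideal of the surface is contained in I(Z1) and need not be mentioned. *)
Definition intersection_multiplicity (R : realType) (Z1 Z2 : set T) (u : T) : \bar R :=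
  ereal_sup [set n%:R%:E | n in [set n : nat | exists P : 'I_n -> T -> F,
    (forall i, polyfun (P i)) /\ local_free Z1 Z2 u P]].

End Polynomial.

Section Characters.
Variables (F : fieldType) (G : groupType).

Definition rep := {multiplicative G -> SL2 F}.

Definition rep_coord (k : G * 'I_2 * 'I_2) (rho : rep) : F :=
  (rho k.1.1 : 'M[F]_2) k.1.2 k.2.

Definition rep_char (rho : rep) : G -> F := fun g => \tr (rho g : 'M[F]_2).

End Characters.

Section Knot.
Variable R : realType.
Local Notation plane := (R * R)%type.

Definition sqnorm (u : plane) : R := u.1 ^+ 2 + u.2 ^+ 2.

Definition turn (a : R) : plane := (cos (2 * pi * a), sin (2 * pi * a)).

Lemma sqnorm_turn a : sqnorm (turn a) = 1.
Proof. by rewrite /sqnorm cos2Dsin2. Qed.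

Lemma turn1 : turn 1 = turn 0.
Proof. by rewrite /turn mulr1 mulr0 mulr_natl cos2pi sin2pi cos0 sin0. Qed.

Lemma continuous_turn : continuous turn.
Proof.
have c : continuous (fun a : R => 2 * pi * a) by apply: continuous_scale => ?; exact: cvg_id.
apply: continuous_pair.
- by apply: continuous_compose; [exact: c | exact: continuous_cos].
- by apply: continuous_compose; [exact: c | exact: continuous_sin].
Qed.

Definition sphere3 : set (plane * plane) := [set u | sqnorm u.1 + sqnorm u.2 = 1].

Definition circle_disk (r : R) : set (plane * plane) :=
  [set u | sqnorm u.1 = 1 /\ sqnorm u.2 < r ^+ 2].

(* A tame (i.e. locally flat) knot in S^3 together with a parametrized tubular
   neighborhood: an open embedding in S^3 of S^1 x {w | |w| < 2}.  The knot is
   the image of S^1 x {0} and N_K is the image of S^1 x {w | |w| < 1}. *)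
Record framed_knot := FramedKnot {
  tube : plane * plane -> sphere3;
  tube_continuous : {within circle_disk 2, continuous tube};
  tube_inj : {in circle_disk 2 &, injective tube};
  tube_open : forall U : set (plane * plane), open U -> open (tube @` (U `&` circle_disk 2)) }.

Variable K : framed_knot.

Definition knot : set sphere3 := tube K @` [set u | sqnorm u.1 = 1 /\ u.2 = (0, 0)].

Definition exterior : set sphere3 := ~` (tube K @` circle_disk 1).

Definition boundary : set exterior :=
  [set x | exists2 u, sqnorm u.1 = 1 /\ sqnorm u.2 = 1 & set_val x = tube K u].

Lemma circle_disk_turn a b : circle_disk 2 (turn a, turn b).
Proof. by split; rewrite /= sqnorm_turn // expr2; lra. Qed.

Lemma exterior_turn a b : tube K (turn a, turn b) \in exterior.
Proof.
rewrite inE => -[u [u1 u2] /tube_inj uE].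
have u2' : circle_disk 2 u.
  by split => //; apply: lt_trans u2 _; rewrite !expr2; lra.
move: u2; rewrite uE ?inE //=; first by rewrite sqnorm_turn expr1n ltxx.
exact: circle_disk_turn.
Qed.

Definition exterior_pt a b : exterior :=
  exist (fun x => x \in exterior) _ (exterior_turn a b).

Lemma boundary_turn a b : exterior_pt a b \in boundary.
Proof. by rewrite inE; exists (turn a, turn b); rewrite ?sqnorm_turn //= sqnorm_turn. Qed.

(* The point of the boundary torus at angle 2 pi a along the knot and 2 pi b
   around it. *)
Definition torus_pt a b : boundary :=
  exist (fun x => x \in boundary) _ (boundary_turn a b).

Lemma torus_pt_eq a b a' b' :
  turn a = turn a' -> turn b = turn b' -> torus_pt a b = torus_pt a' b'.
Proof. by move=> ea eb; do 2!apply: val_inj => /=; rewrite ea eb. Qed.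

Lemma continuous_torus_pt (f g : R -> R) :
  continuous f -> continuous g -> continuous (fun t => torus_pt (f t) (g t)).
Proof.
move=> cf cg; do 2!apply: continuous_comp_initial.
pose h t := (turn (f t), turn (g t)).
have ch : continuous h.
  by apply: continuous_pair; apply: continuous_compose; try exact: continuous_turn.
move=> t; have ht : circle_disk 2 (h t) by exact: circle_disk_turn.
have /subspace_continuousP/(_ _ ht) tc := @tube_continuous K.
move=> U /tc tU; have := ch t _ tU; apply: (@filterS _ (nbhs t)) => u /=.
by apply; exact: circle_disk_turn.
Qed.

Definition boundary_incl (x : boundary) : exterior := set_val x.

Lemma boundary_incl_continuous : continuous boundary_incl.
Proof. exact: initial_continuous. Qed.

HB.instance Definition _ :=
  isContinuous.Build boundary exterior boundary_incl boundary_incl_continuous.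

Definition base_pt : boundary := torus_pt 0 0.

Definition pi1_boundary : groupType := pi1 R boundary base_pt.
Definition pi1_exterior : groupType := pi1 R exterior (boundary_incl base_pt).
Definition pi1_incl : {multiplicative pi1_boundary -> pi1_exterior} :=
  pi1_map R boundary_incl base_pt.

Lemma turn_clamp0 (t : R) : t <= 0 -> turn (clamp t) = turn 0.
Proof. by move=> t0; rewrite clamp0. Qed.

Lemma turn_clamp1 (t : R) : 1 <= t -> turn (clamp t) = turn 0.
Proof. by move=> t1; rewrite clamp1 // turn1. Qed.

Definition meridian_loop : loop R boundary base_pt :=
  Loop (continuous_torus_pt (@cst_continuous _ _ 0) (@continuous_clamp R))
    (fun t t0 => torus_pt_eq erefl (turn_clamp0 t0))
    (fun t t1 => torus_pt_eq erefl (turn_clamp1 t1)).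

Definition longitude_loop : loop R boundary base_pt :=
  Loop (continuous_torus_pt (@continuous_clamp R) (@cst_continuous _ _ 0))
    (fun t t0 => torus_pt_eq (turn_clamp0 t0) erefl)
    (fun t t1 => torus_pt_eq (turn_clamp1 t1) erefl).

Definition meridian : pi1_boundary := pi1_class meridian_loop.
Definition longitude : pi1_boundary := pi1_class longitude_loop.

(* The longitude is the preferred one: it is null-homologous in M_K. *)
Definition preferred_framing : Prop := in_derived (pi1_incl longitude).

Section DehnFilling.
Variables p q r s : int.

Definition solid_torus : set (plane * plane) :=
  [set u | sqnorm u.1 = 1 /\ sqnorm u.2 <= 1].

Definition filling_piece (b : bool) : topologicalType :=
  if b then exterior : topologicalType else solid_torus : topologicalType.

Definition in_exterior (x : exterior) : {b & filling_piece b} := existT filling_piece true x.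
Definition in_solid (u : solid_torus) : {b & filling_piece b} := existT filling_piece false u.

(* The identification of the boundary of S^1 x D^2 with that of M_K given by
   the matrix (p, q; r, s): the meridian {1} x S^1 is glued to the simple closed
   curve b |-> torus_pt (q b) (p b), which represents p mu + q lambda. *)
Inductive glue : {b & filling_piece b} -> {b & filling_piece b} -> Prop :=
| Glue (a b : R) (u : solid_torus) : set_val u = (turn a, turn b) ->
    glue (in_solid u)
      (in_exterior (exterior_pt (s%:~R * a + q%:~R * b) (r%:~R * a + p%:~R * b))).

Definition glueb x y := `[< clos_refl_sym_trans _ glue x y >].

Lemma glueb_refl : reflexive glueb.
Proof. by move=> x; apply/asboolP; exact: rst_refl. Qed.

Lemma glueb_sym : symmetric glueb.
Proof. by move=> x y; apply/asbool_equiv_eq; split; exact: rst_sym. Qed.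

Lemma glueb_trans : transitive glueb.
Proof. by move=> y x z /asboolP xy /asboolP yz; apply/asboolP; exact: rst_trans xy yz. Qed.

Definition glue_equiv := EquivRel glueb glueb_refl glueb_sym glueb_trans.

Definition dehn_filling : topologicalType := quotient_topology {eq_quot glue_equiv}.

Definition filling_base : dehn_filling :=
  \pi_({eq_quot glue_equiv}) (in_exterior (boundary_incl base_pt)).

Definition pi1_filling : groupType := pi1 R dehn_filling filling_base.

End DehnFilling.

Section Hyperbolic.
Local Notation C := R[i].
Local Notation space := (R * R * R)%type.

(* Hyperbolic 3-space is the upper half-space {(z, t) | z in C, t > 0}, with z
   given by its real and imaginary parts. *)
Definition H3 : set space := [set u | 0 < u.2].

Definition sqmod (z : C) : R := complex.Re z ^+ 2 + complex.Im z ^+ 2.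

(* The Poincare extension to H3 of the action of SL2(C) on C by homographies. *)
Definition poincare (A : 'M[C]_2) (u : space) : space :=
  let z : C := Complex u.1.1 u.1.2 in
  let t := u.2 in
  let a := A 0 0 in let b := A 0 1 in let c := A 1 0 in let d := A 1 1 in
  let n := sqmod (c * z + d) + sqmod c * t ^+ 2 in
  let w := (a * z + b) * conjc (c * z + d) + a * conjc c * (t ^+ 2)%:C%C in
  (complex.Re w / n, complex.Im w / n, t / n).

Definition hyperbolic_volume (A : set space) : \bar R :=
  \int[((lebesgue_measure \x lebesgue_measure) \x lebesgue_measure)%E]_(u in A)
    ((u.2 ^+ 3)^-1)%:E.

Definition deck (P : space -> sphere3) (A : SL2 C) : Prop :=
  forall u, H3 u -> P (poincare A u) = P u.

(* P is the universal covering of a complete hyperbolic structure of finite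
   volume on S^3 \ K: it identifies S^3 \ K with the quotient of H3 by a group
   of orientation-preserving isometries acting freely and discontinuously. *)
Definition hyperbolic_structure (P : space -> sphere3) : Prop :=
  [/\ P @` H3 = ~` knot /\ {within H3, continuous P},
      forall U, open U -> U `<=` H3 -> open (P @` U),
      forall u, H3 u -> exists2 U, nbhs u U & {in U &, injective P},
      forall u v, H3 u -> H3 v -> P u = P v -> exists2 A, deck P A & v = poincare A u
    & exists F : set space, [/\ measurable F, F `<=` H3, set_bij F (~` knot) P
        & (hyperbolic_volume F < +oo)%E]].

(* rho is a lift to SL2(C) of the holonomy of the hyperbolic structure: the
   lift of a loop l starting at u0 ends at rho [l] u0. *)
Definition discrete_faithful_rep (P : space -> sphere3) (rho : rep C pi1_exterior) : Prop :=
  [/\ injective rho,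
      exists2 e : R, 0 < e & forall g,
        (forall i j, sqmod ((rho g : 'M[C]_2) i j - (1%:M : 'M[C]_2) i j) < e) ->
        rho g = 1%g,
      forall g, deck P (rho g)
    & exists u0, [/\ H3 u0, P u0 = set_val (boundary_incl base_pt)
        & forall l : loop R exterior (boundary_incl base_pt),
          exists L : R -> space, [/\ continuous L, forall t, H3 (L t),
            forall t, P (L t) = set_val (l t), L 0 = u0
          & L 1 = poincare (rho (pi1_class l)) u0]]].

Local Notation C3 := 'rV[C]_3.

Definition coord3 (i : 'I_3) (v : C3) : C := v 0 i.

Definition triple (x y z : C) : C3 := \row_i [:: x; y; z]`_i.

Definition tD (m l : C) : C3 := triple (m + m^-1) (l + l^-1) (m * l + m^-1 * l^-1).

(* The image t_D(E(p, q)). *)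
Definition slope_curve (p q : int) : set C3 :=
  [set tD u.1 u.2 | u in [set u : C * C | [/\ u.1 != 0, u.2 != 0
     & u.1 ^ p * u.2 ^ q = 1 \/ u.1 ^ p * u.2 ^ q = -1]]].

(* X(dM_K) is viewed in C^3 through chi |-> (chi mu, chi lambda, chi (mu lambda)). *)
Definition boundary_coords (chi : pi1_boundary -> C) : C3 :=
  triple (chi meridian) (chi longitude) (chi (meridian * longitude)%g).

Definition restriction (chi : pi1_exterior -> C) : pi1_boundary -> C := chi \o pi1_incl.

(* The image r(X_0), where X_0 = t(R_0). *)
Definition restricted_curve (R0 : set (rep C pi1_exterior)) : set C3 :=
  [set boundary_coords (restriction chi) | chi in [set rep_char rho | rho in R0]].

(* The first coordinate of a point of X(dM_K) is chi(mu). *)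
Definition S_pq (R0 : set (rep C pi1_exterior)) (p q : int) : set C3 :=
  [set v | [/\ slope_curve p q v, restricted_curve R0 v, v 0 0 != 2 & v 0 0 != -2]].

Definition lambda_pq (R0 : set (rep C pi1_exterior)) (p q : int) : \bar R :=
  \esum_(v in S_pq R0 p q)
    intersection_multiplicity coord3 R (slope_curve p q) (restricted_curve R0) v.

End Hyperbolic.

End Knot.

Arguments sphere3 R : clear implicits.
Arguments rep_coord {F G}.

(* Main.v *)
Require Import Defs.
From HB Require Import structures.
From mathcomp Require Import all_boot all_order all_algebra.
From mathcomp Require Import generic_quotient.
From mathcomp Require Import all_classical all_reals all_analysis.
From mathcomp Require Import measurable_realfun.
From mathcomp Require Import complex.
From mathcomp Require Import lra ring.
From Stdlib Require Import Relation_Operators.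

(** Let rho be a representation in R0 whose character gives a point of the slope curve
    with chi(mu) <> 2, -2. Its restriction to the peripheral subgroup can be made
    diagonal, with rho(mu) = diag(x, 1/x), x <> 1/x, and rho(mu^p lambda^q) = 1 or -1.
    Suppose that the group of the filling is cyclic.

    Surgery. The kernel of the map from the knot group to the group of the filling lies in
    every normal subgroup that contains mu^p lambda^q ([surgery_kernel]). So every
    representation of the knot group that sends mu^p lambda^q to a central element has an
    abelian image ([cyclic_filling_abelian]). In particular rho is abelian; hence
    rho(lambda) = 1, because the longitude is a product of commutators, and x^p is 1 or -1.

    Deformation. It remains to see that R0 has no such point ([no_abelian_point]). The
    entries of the brackets [sigma(g), sigma(mu)] are functions of sigma in R0 which vanish
    at rho. They do not all vanish identically: R0 is irreducible and contains the discrete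
    faithful rho0, for which rho0(mu) is not central ([noncentral_holonomy]). Since the
    knot group is finitely generated, the ideal I of the local ring at rho generated by the
    brackets is finitely generated ([bracket_generated]), and Nakayama's lemma provides a
    functional theta on I / m I that does not vanish on all brackets ([nakayama]). By the
    Leibniz rule ([bracketM]), theta of the off-diagonal brackets is a cocycle: the
    off-diagonal entry of a triangular representation with the diagonal of rho. That
    representation sends mu to diag(x, 1/x) and lambda to 1, so by the first part it is
    abelian, and therefore diagonal: the cocycle is zero ([cocycle_trivial]). The diagonal
    brackets are then handled by tr [A, B] = tr ([A, B] B) = 0, a contradiction.

    Geometry. The covering P presents the knot group as a group acting freely on
    hyperbolic space, transitively on the fibres of P ([hact_free], [hact_transitive]); the
    exterior is compact and a deformation retract of the complement of the knot, hence the
    group is finitely generated. It is not abelian because of the finite volume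
    ([exterior_group_nonabelian]): abelian holonomy would preserve a cone or a horosphere,
    and then a box that reaches down to the boundary plane, whose volume is infinite,
    would embed in the quotient. This needs the invariance of hyperbolic volume, which is
    checked for translations and for the inversion.

    Lifting maps to hyperbolic space and the computation of the kernel of surgery both
    come down to one fact about the plane: local solutions that differ by the action of a
    group acting freely can be glued to a global one ([flat_plane]). For surgery the local
    solutions are not lifts themselves, which do not exist near the core of the solid
    torus, but their values in a quotient in which the slope is trivial
    ([filling_kernel]). *)

Set Implicit Arguments.
Unset Strict Implicit.
Unset Printing Implicit Defensive.
Import Order.TTheory GRing.Theory Num.Theory.
Import numFieldNormedType.Exports.
Local Open Scope quotient_scope.
Local Open Scope classical_set_scope.
Local Open Scope ring_scope.

Local Notation ent A i j := (fun_of_matrix (SL2_mx A%g) i j).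

(** * Gluing local solutions over the plane *)

(** Connectedness of [a, b]: the points where Q agrees with Q a form a subset that
    is open and closed in it. Stated for propositions, so that it applies to the
    equality of two lifts as well as to membership in a subgroup. *)
Lemma locally_constant_itv (R : realType) (Q : R -> Prop) (a b : R) :
  a <= b ->
  (forall t, a <= t <= b -> \forall s \near t, a <= s <= b -> (Q s <-> Q t)) ->
  (Q a <-> Q b).
Proof.
move=> ab loc.
have itvE t : `[a, b]%classic t -> a <= t <= b by rewrite /= in_itv.
pose B := [set t | a <= t <= b /\ (Q t <-> Q a)].
have BE : B = `[a, b]%classic.
  apply: (@segment_connected R a b).
  - by exists a; split; rewrite ?lexx.
  - exists [set t | \forall s \near t, a <= s <= b -> (Q s <-> Q a)].
      by rewrite openE => t /= h; apply: (near_join h).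
    rewrite eqEsubset; split => t /=.
      move=> [tab Qt]; split; first by rewrite in_itv.
      by apply: filterS (loc t tab) => s Qs /Qs; rewrite Qt.
    move=> [/itvE tab h]; split => //; exact: (nbhs_singleton h).
  - exists [set t | ~ \forall s \near t, a <= s <= b -> ~ (Q s <-> Q a)].
      rewrite -openC; rewrite setCK openE => t /= h; exact: (near_join h).
    rewrite eqEsubset; split => t /=.
      move=> [tab Qt]; split; first by rewrite in_itv.
      by move=> h; apply: (nbhs_singleton h).
    move=> [/itvE tab h]; split => //; apply: contrapT => nQ; apply: h.
    by apply: filterS (loc t tab) => s Qs /Qs; rewrite -/(iff _ _) => -> .
have : B b by rewrite BE /= in_itv /= lexx ab.
by case=> _; tauto.
Qed.

(** The Heine-Borel argument without coverings: for a fixed a the truth of Q a x is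
    locally constant in x. *)
Lemma interval_induction (R : realType) (Q : R -> R -> Prop) :
  (forall a b a' b', a <= a' -> a' <= b' -> b' <= b -> Q a b -> Q a' b') ->
  (forall a m b, a <= m -> m <= b -> Q a m -> Q m b -> Q a b) ->
  (forall x, exists2 e, 0 < e & forall a b, x - e <= a -> a <= b -> b <= x + e -> Q a b) ->
  forall a b, a <= b -> Q a b.
Proof.
move=> Qsub Qjoin Qloc a b ab.
suff : (Q a a <-> Q a b).
  case=> h _; apply: h; have [e e0 Qe] := Qloc a; apply: Qe; lra.
apply: (@locally_constant_itv R (Q a) a b ab) => t /andP[at_ tb].
have [e e0 Qe] := Qloc t.
have : \forall s \near t, ball t e s by exact: nbhsx_ballx.
apply: filterS => s; rewrite /ball /= ltr_distlC => /andP[s1 s2] /andP[as_ sb].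
have [st|ts] := leP s t; split=> h.
- by apply: (Qjoin a s t) => //; apply: Qe; lra.
- by apply: (Qsub a t a s).
- by apply: (Qsub a s a t) => //; apply: ltW.
- by apply: (Qjoin a t s) => //; [exact: ltW|apply: Qe; lra].
Qed.

Section Flat.
Variable R : realType.
Local Notation plane := (R * R)%type.

Definition rect (a b c d : R) : set plane :=
  [set u | a <= u.1 <= b /\ c <= u.2 <= d].

Definition line_pt (u v : plane) (t : R) : plane :=
  (u.1 + t * (v.1 - u.1), u.2 + t * (v.2 - u.2)).

Lemma line_pt_continuous u v : continuous (line_pt u v).
Proof.
have c a b : continuous (fun t : R => a + t * b).
  by move=> t; apply: cvgD; [exact: cvg_cst | apply: cvgM; [exact: cvg_id | exact: cvg_cst]].
exact: continuous_pair.
Qed.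

Lemma line_pt0 u v : line_pt u v 0 = u.
Proof. by rewrite /line_pt !mul0r !addr0; case: u. Qed.

Lemma line_pt1 u v : line_pt u v 1 = v.
Proof. by rewrite /line_pt !mul1r !subrKC; case: v. Qed.

Definition segment_closed (A : set plane) : Prop :=
  forall u v t, A u -> A v -> 0 <= t <= 1 -> A (line_pt u v t).

Lemma rect_segment_closed a b c d : segment_closed (rect a b c d).
Proof.
move=> [u1 u2] [v1 v2] t; rewrite /rect /=.
move=> [/andP[? ?] /andP[? ?]] [/andP[? ?] /andP[? ?]] /andP[? ?].
by split; rewrite /line_pt /=; apply/andP; split; nra.
Qed.

Lemma locally_constant_plane (A : set plane) (Q : plane -> Prop) u v :
  segment_closed A -> A u -> A v ->
  (forall x, A x -> \forall y \near x, A y -> (Q y <-> Q x)) -> Q u -> Q v.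
Proof.
move=> Aseg Au Av loc Qu.
suff : (Q (line_pt u v 0) <-> Q (line_pt u v 1)) by rewrite line_pt0 line_pt1 => -[h _]; exact: h.
apply: (@locally_constant_itv R (Q \o line_pt u v) 0 1 ler01) => t t01.
have h : \forall s \near t, A (line_pt u v s) -> (Q (line_pt u v s) <-> Q (line_pt u v t)).
  exact: line_pt_continuous (loc _ (Aseg _ _ _ Au Av t01)).
by move: h; apply: filterS => s /= h s01; apply: h; apply: Aseg.
Qed.

Variables (G : groupType) (Y : Type) (act : G -> Y -> Y) (D : G -> Prop) (E : Y -> Prop).
Hypothesis act1 : forall y, E y -> act 1%g y = y.
Hypothesis actM : forall a b y, D a -> D b -> E y -> act (a * b)%g y = act a (act b y).
Hypothesis DM : forall a b, D a -> D b -> D (a * b)%g.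
Hypothesis DV : forall a, D a -> D (a^-1)%g.
Hypothesis act_free : forall a y, D a -> E y -> act a y = y ->
  forall z, E z -> act a z = z.

Variable f : plane -> plane -> Y.
Hypothesis f_loc : forall x, \forall y \near x, E (f x y) /\
  exists2 c, D c & \forall z \near y, f y z = act c (f x z).

(** The functions f x, each defined near x, differ from one another by the action of
    elements of D, so their translates are the sections of a locally constant
    sheaf; a flat F is a section of it. *)
Definition flat_at (A : set plane) (F : plane -> Y) (x : plane) : Prop :=
  exists2 c, D c & \forall y \near x, A y -> F y = act c (f x y).

Definition flat (A : set plane) (F : plane -> Y) : Prop := forall x, A x -> flat_at A F x.

(** What freeness is for: a translation is determined by its value at one point. *)
Lemma act_eq a b y : D a -> D b -> E y -> act a y = act b y ->
  forall z, E z -> act a z = act b z.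
Proof.
move=> Da Db Ey ab z Ez.
have DVb := DV Db.
have : act (b^-1 * a)%g y = y.
  by rewrite actM // ab -actM // mulVg act1.
move/(act_free (DM DVb Da) Ey)/(_ z Ez) => h.
by rewrite -{2}h -actM ?mulVKg //; exact: DM.
Qed.

Lemma f_E x : \forall y \near x, E (f x y).
Proof. by apply: filterS (f_loc x) => y []. Qed.

Lemma flat_sub A B F : A `<=` B -> flat B F -> flat A F.
Proof.
move=> AB FB x /AB/FB[c Dc h]; exists c => //.
by apply: filterS h => y h /AB.
Qed.

Lemma flat_unique A F1 F2 u v : segment_closed A -> flat A F1 -> flat A F2 ->
  A u -> A v -> F1 u = F2 u -> F1 v = F2 v.
Proof.
move=> Aseg flat1 flat2 Au Av.
apply: (@locally_constant_plane A (fun x => F1 x = F2 x)) => // x Ax.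
have [c1 Dc1 h1] := flat1 x Ax; have [c2 Dc2 h2] := flat2 x Ax.
have Ex := nbhs_singleton (f_E x).
have F1x := nbhs_singleton h1 Ax; have F2x := nbhs_singleton h2 Ax.
apply: filterS3 (f_E x) h1 h2 => y Ey e1 e2 Ay.
rewrite (e1 Ay) (e2 Ay) F1x F2x; split => h; exact: (act_eq _ _ _ h).
Qed.

Lemma flat_act A F a : D a -> flat A F -> flat A (fun x => act a (F x)).
Proof.
move=> Da fF x /fF[c Dc h]; exists (a * c)%g; first exact: DM.
by apply: filterS2 (f_E x) h => y Ey h /h ->; rewrite actM.
Qed.

(** After a translation F2 agrees with F1 at x0. As the intersection is connected and
    the action is free, they then agree on all of it. *)
Lemma flat_glue A B C F1 F2 x0 : closed A -> closed B -> C = A `|` B ->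
  segment_closed (A `&` B) -> A x0 -> B x0 ->
  flat A F1 -> flat B F2 -> exists F, flat C F.
Proof.
move=> cA cB -> segAB A0 B0 fA fB.
have [c1 Dc1 /nbhs_singleton/(_ A0) e1] := fA _ A0.
have [c2 Dc2 /nbhs_singleton/(_ B0) e2] := fB _ B0.
have E0 := nbhs_singleton (f_E x0).
pose F2' x := act (c1 * c2^-1)%g (F2 x).
have DV2 := DV Dc2.
have fB' : flat B F2' by apply: flat_act => //; exact: DM.
have eq0 : F1 x0 = F2' x0.
  by rewrite /F2' e1 e2 -actM // ?mulgVK //; exact: DM.
have eqAB x : A x -> B x -> F1 x = F2' x.
  move=> Ax Bx; apply: (@flat_unique (A `&` B) F1 F2' x0 x) => //.
  - by apply: flat_sub fA => ? [].
  - by apply: flat_sub fB' => ? [].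
pose F x := if `[< A x >] then F1 x else F2' x.
have FA x : A x -> F x = F1 x by move=> Ax; rewrite /F asboolT.
have FB x : B x -> F x = F2' x.
  move=> Bx; rewrite /F; case: ifPn => // /asboolP Ax; exact: eqAB.
have out (S : set plane) x : closed S -> ~ S x -> \forall y \near x, ~ S y.
  by move=> cS nS; have := closed_openC cS; rewrite openE => /(_ x nS).
exists F => x ABx.
have [Ax|nAx] := pselect (A x); have [Bx|nBx] := pselect (B x).
- have [a1 Da1 h1] := fA x Ax; have [a2 Da2 h2] := fB' x Bx.
  have Ex := nbhs_singleton (f_E x).
  have e : act a2 (f x x) = act a1 (f x x).
    by rewrite -(nbhs_singleton h1 Ax) -(nbhs_singleton h2 Bx) eqAB.
  exists a1 => //; apply: filterS3 (f_E x) h1 h2 => y Ey h1 h2 [Ay|By].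
    by rewrite FA // h1.
  by rewrite FB // h2 //; apply: (act_eq _ _ Ex e).
- have [a1 Da1 h1] := fA x Ax; exists a1 => //.
  by apply: filterS2 (out _ _ cB nBx) h1 => y nBy h1 [Ay|//]; rewrite FA // h1.
- have [a1 Da1 h1] := fB' x Bx; exists a1 => //.
  by apply: filterS2 (out _ _ cA nAx) h1 => y nAy h1 [//|By]; rewrite FB // h1.
- by case: ABx.
Qed.

Lemma rect_closed a b c d : closed (rect a b c d).
Proof.
have -> : rect a b c d = (fst @^-1` `[a, b]%classic) `&` (snd @^-1` `[c, d]%classic).
  by apply/seteqP; split => u /=; rewrite !in_itv.
apply: closedI; apply: preimage_closed; try exact: interval_closed.
- by move=> x _; exact: cvg_fst.
- by move=> x _; exact: cvg_snd.
Qed.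

(** Small rectangles have the flat function f x. Two rectangles with a common side are
    glued along it, first vertically, to fill a thin column, then horizontally. *)
Lemma flat_rect a b c d : a <= b -> c <= d -> exists F, flat (rect a b c d) F.
Proof.
pose Q a b c d := exists F, flat (rect a b c d) F.
have sub a' b' c' d' a1 b1 c1 d1 : a' <= a1 -> b1 <= b' -> c' <= c1 -> d1 <= d' ->
    Q a' b' c' d' -> Q a1 b1 c1 d1.
  move=> ? ? ? ? [F fF]; exists F; apply: flat_sub fF.
  by move=> u [/andP[? ?] /andP[? ?]]; split; apply/andP; split; lra.
have segI S T : segment_closed S -> segment_closed T -> segment_closed (S `&` T).
  by move=> sS sT u v t [? ?] [? ?] t01; split; [exact: sS | exact: sT].
have hjoin a' m b' c' d' : a' <= m -> m <= b' -> c' <= d' ->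
    Q a' m c' d' -> Q m b' c' d' -> Q a' b' c' d'.
  move=> am mb cd [F1 fF1] [F2 fF2].
  apply: (@flat_glue (rect a' m c' d') (rect m b' c' d') _ F1 F2 (m, c'));
    try exact: rect_closed; rewrite /rect //=; try by rewrite !lexx ?am ?mb ?cd.
    apply/seteqP; split => u /=.
      by case=> /andP[h1 h2] h3; have [h|/ltW h] := leP u.1 m; [left|right]; rewrite ?h1 ?h2 ?h.
    by case=> -[/andP[h1 h2] ->]; split => //; apply/andP; split; lra.
  by apply: segI; exact: rect_segment_closed.
have vjoin a' b' c' m d' : a' <= b' -> c' <= m -> m <= d' ->
    Q a' b' c' m -> Q a' b' m d' -> Q a' b' c' d'.
  move=> ab cm md [F1 fF1] [F2 fF2].
  apply: (@flat_glue (rect a' b' c' m) (rect a' b' m d') _ F1 F2 (a', m));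
    try exact: rect_closed; rewrite /rect //=; try by rewrite !lexx ?ab ?cm ?md.
    apply/seteqP; split => u /=.
      by case=> h3 /andP[h1 h2]; have [h|/ltW h] := leP u.2 m; [left|right]; rewrite ?h1 ?h2 ?h.
    by case=> -[-> /andP[h1 h2]]; split => //; apply/andP; split; lra.
  by apply: segI; exact: rect_segment_closed.
have loc x : exists2 e, 0 < e & forall a' b' c' d', x.1 - e <= a' -> b' <= x.1 + e ->
    x.2 - e <= c' -> d' <= x.2 + e -> Q a' b' c' d'.
  have /nbhs_ballP[e /= e0 he] := f_loc x.
  exists (e / 2) => [|a' b' c' d' ? ? ? ?]; first lra.
  (* On a small rectangle f x itself is flat, with the transition constants inverted. *)
  exists (f x) => y [/andP[? ?] /andP[? ?]].
  have [] := he y.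
    split; rewrite /ball /= ltr_distlC; apply/andP; split; lra.
  move=> Ey [a1 Da1 h1].
  have [Ex _] := nbhs_singleton (f_loc x).
  have DVa := DV Da1.
  exists (a1^-1)%g => //.
  have hy : ball x e y by split; rewrite /ball /= ltr_distlC; apply/andP; split; lra.
  have Exz : \forall z \near y, E (f x z).
    have : open_nbhs y (ball x e)^°.
      by split; [exact: open_interior | rewrite /interior; move: hy => [/= hy1 hy2];
        apply: open_nbhs_nbhs; split => //; exact: ball_open].
    move/open_nbhs_nbhs; apply: filterS => z /interior_subset zb.
    by have [] := he z zb.
  by apply: filterS2 h1 Exz => z -> Ez _; rewrite -actM ?mulVg ?act1.
move=> ab cd.
pose V x c d := exists2 e, 0 < e & forall a b, x - e <= a -> a <= b -> b <= x + e -> Q a b c d.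
have colV x : forall c d, c <= d -> V x c d.
  apply: interval_induction => [c1 d1 c2 d2 h1 h2 h3 [e e0 h]|c1 m d1 h1 h2 [e e0 h] [e' e'0 h']|y].
  - exists e => // a1 b1 h4 h5 h6; apply: sub (h a1 b1 h4 h5 h6) => //.
  - exists (Num.min e e'); first by rewrite lt_min e0.
    move=> a1 b1 h4 h5 h6; have me : Num.min e e' <= e by rewrite ge_min lexx.
    have me' : Num.min e e' <= e' by rewrite ge_min lexx orbT.
    by apply: (vjoin a1 b1 c1 m d1) => //; [apply: h|apply: h']; lra.
  - have [e e0 h] := loc (x, y); exists e => // c1 d1 h1 h2 h3; exists e => // a1 b1 h4 h5 h6.
    exact: h.
apply: (@interval_induction R (fun a b => Q a b c d)) ab => [a1 b1 a2 b2 h1 h2 h3|a1 m b1 h1 h2|x].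
- by apply: sub.
- exact: hjoin.
- exact: colV.
Qed.

(** The plane has no monodromy. Sections over an increasing sequence of squares,
    all normalized at u0, extend one another. *)
Lemma flat_plane u0 c0 : D c0 ->
  exists F, flat setT F /\ F u0 = act c0 (f u0 u0).
Proof.
move=> Dc0; have Eu0 := nbhs_singleton (f_E u0).
pose S (n : nat) := rect (u0.1 - n%:R) (u0.1 + n%:R) (u0.2 - n%:R) (u0.2 + n%:R).
have S0 n : S n u0 by have := ler0n R n; split; apply/andP; split; lra.
have SS m n : (m <= n)%N -> S m `<=` S n.
  move=> mn; have : m%:R <= n%:R :> R by rewrite ler_nat.
  by move=> mn' u [/andP[? ?] /andP[? ?]]; split; apply/andP; split; lra.
have /choice[F hF] n : exists F, flat (S n) F /\ F u0 = act c0 (f u0 u0).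
  have [||F fF] := @flat_rect (u0.1 - n%:R) (u0.1 + n%:R) (u0.2 - n%:R) (u0.2 + n%:R).
  - by have := ler0n R n; lra.
  - by have := ler0n R n; lra.
  have [c Dc /nbhs_singleton/(_ (S0 n)) e] := fF u0 (S0 n).
  have DVc := DV Dc.
  exists (fun x => act (c0 * c^-1)%g (F x)); split; first by apply: flat_act => //; exact: DM.
  by rewrite e -actM // ?mulgVK //; exact: DM.
have /choice[N hN] (x : plane) : exists n : nat, \forall y \near x, S n y.
  have [n hn] : exists n, Num.max `|x.1 - u0.1| `|x.2 - u0.2| + 1 <= n%:R.
    by exists (Num.bound (Num.max `|x.1 - u0.1| `|x.2 - u0.2| + 1));
      apply/ltW/archi_boundP; rewrite addr_ge0 // le_max normr_ge0.
  exists n; apply: filterS (nbhsx_ballx x _ ltr01) => y.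
  have h1 : `|x.1 - u0.1| <= n%:R - 1.
    by rewrite lerBrDr (le_trans _ hn) // lerD2r le_max lexx.
  have h2 : `|x.2 - u0.2| <= n%:R - 1.
    by rewrite lerBrDr (le_trans _ hn) // lerD2r le_max lexx orbT.
  move: h1 h2; rewrite !ler_distlC => /andP[? ?] /andP[? ?].
  move=> [] /=; rewrite /ball /= !ltr_distlC => /andP[? ?] /andP[? ?].
  by split; apply/andP; split; lra.
have FF m n y : S m y -> S n y -> F m y = F n y.
  wlog mn : m n / (m <= n)%N => [h|Sy _].
    by case/orP: (leq_total m n) => mn Sm Sn; [exact: h|apply/esym; exact: h].
  have [fm em] := hF m; have [fn en] := hF n.
  apply: (@flat_unique (S m) (F m) (F n) u0 y) => //.
  - exact: rect_segment_closed.
  - exact: flat_sub (SS _ _ mn) fn.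
  - by rewrite em en.
exists (fun y => F (N y) y); split; last first.
  by case: (hF (N u0)).
move=> x _; have Sx := nbhs_singleton (hN x).
have [c Dc h] := (hF (N x)).1 x Sx; exists c => //.
apply: filterS2 h (hN x) => y h Sy _.
by rewrite -h //; apply: FF => //; exact: nbhs_singleton (hN y).
Qed.

End Flat.

(** * The action of SL2(C) on hyperbolic space *)

Section Poincare.
Variable R : realType.
Local Notation C := R[i].
Local Notation space := (R * R * R)%type.

Lemma det_mx22 (F : fieldType) (A : 'M[F]_2) : \det A = A 0 0 * A 1 1 - A 0 1 * A 1 0.
Proof.
have l0 : lift ord0 ord0 = 1 :> 'I_2 by exact/val_inj.
rewrite (expand_det_row _ 0) big_ord_recl big_ord1 l0 /cofactor !det_mx11 !mxE /=.
have l1 : lift (1 : 'I_2) (0 : 'I_1) = 0 :> 'I_2 by exact/val_inj.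
have l0' : lift (0 : 'I_2) (0 : 'I_1) = 1 :> 'I_2 by exact/val_inj.
by rewrite l0' l1 addn0 expr0 mul1r add0n expr1 mulN1r mulrN.
Qed.

Lemma ord2P (k : 'I_2) : k = 0 \/ k = 1.
Proof. by case: k => -[|[|//]] ?; [left|right]; exact: val_inj. Qed.

Lemma SL2E (F : fieldType) (A : SL2 F) : ent A 0 0 * ent A 1 1
  - ent A 0 1 * ent A 1 0 = 1.
Proof. by have /eqP := SL2_det A; rewrite det_mx22. Qed.

Lemma mulmx22E (F : fieldType) (A B : 'M[F]_2) i j :
  (A *m B) i j = A i 0 * B 0 j + A i 1 * B 1 j.
Proof.
rewrite mxE big_ord_recl big_ord1.
by have -> : lift ord0 ord0 = 1 :> 'I_2 by apply/val_inj.
Qed.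

Definition zcoord (u : space) : C := Complex u.1.1 u.1.2.

Definition pden (A : 'M[C]_2) (u : space) : R :=
  sqmod (A 1 0 * zcoord u + A 1 1) + sqmod (A 1 0) * u.2 ^+ 2.

Definition pnum (A : 'M[C]_2) (u : space) : C :=
  (A 0 0 * zcoord u + A 0 1) * conjc (A 1 0 * zcoord u + A 1 1)
  + A 0 0 * conjc (A 1 0) * (u.2 ^+ 2)%:C%C.

Lemma poincareE A u : poincare A u =
  (complex.Re (pnum A u) / pden A u, complex.Im (pnum A u) / pden A u, u.2 / pden A u).
Proof. by []. Qed.

Lemma sqmod_ge0 (z : C) : 0 <= sqmod z.
Proof. by rewrite addr_ge0 ?sqr_ge0. Qed.

Lemma sqmod_eq0 (z : C) : (sqmod z == 0) = (z == 0).
Proof.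
case: z => x y; rewrite /sqmod /= paddr_eq0 ?sqr_ge0 // !sqrf_eq0.
by apply/andP/eqP => [[/eqP -> /eqP ->]|[-> ->]].
Qed.

Lemma sqmodE (z : C) : (sqmod z)%:C%C = z * conjc z.
Proof. by case: z => x y; rewrite /sqmod; simpc; congr Complex; ring. Qed.

Lemma pden_gt0 (A : SL2 C) u : H3 u -> 0 < pden A u.
Proof.
rewrite /H3 /= /pden => u0; have := SL2E A.
have [->|c0 _] := eqVneq (ent A 1 0) 0.
  rewrite mul0r add0r mulr0 subr0 => ad.
  have -> : sqmod (0 : C) = 0 by apply/eqP; rewrite sqmod_eq0.
  rewrite mul0r addr0 lt0r sqmod_ge0 sqmod_eq0 andbT; apply/eqP => d0.
  by move/eqP: ad; rewrite d0 mulr0 eq_sym oner_eq0.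
rewrite ltr_wpDl ?sqmod_ge0 // mulr_gt0 ?exprn_gt0 //.
by rewrite lt0r sqmod_ge0 sqmod_eq0 c0.
Qed.

Lemma poincare_H3 (A : SL2 C) u : H3 u -> H3 (poincare A u).
Proof. by move=> hu; rewrite /H3 /= divr_gt0 // pden_gt0. Qed.

Lemma realcD (x y : R) : (x + y)%:C%C = x%:C%C + y%:C%C :> C.
Proof. exact: (rmorphD (real_complex R)). Qed.
Lemma realcM (x y : R) : (x * y)%:C%C = x%:C%C * y%:C%C :> C.
Proof. exact: (rmorphM (real_complex R)). Qed.
Lemma realcX (x : R) n : (x ^+ n)%:C%C = x%:C%C ^+ n :> C.
Proof. exact: (rmorphXn (real_complex R)). Qed.
Lemma realcV (x : R) : (x^-1)%:C%C = x%:C%C^-1 :> C.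
Proof. exact: (fmorphV (real_complex R)). Qed.
Lemma conjcM (x y : C) : conjc (x * y) = conjc x * conjc y.
Proof. exact: rmorphM. Qed.
Lemma conjcD (x y : C) : conjc (x + y) = conjc x + conjc y.
Proof. exact: rmorphD. Qed.
Lemma conjcB (x y : C) : conjc (x - y) = conjc x - conjc y.
Proof. exact: rmorphB. Qed.
Lemma conjcX (x : C) n : conjc (x ^+ n) = conjc x ^+ n.
Proof. exact: rmorphXn. Qed.

Lemma pdenE A u : (pden A u)%:C%C = (A 1 0 * zcoord u + A 1 1)
  * conjc (A 1 0 * zcoord u + A 1 1) + A 1 0 * conjc (A 1 0) * (u.2)%:C%C ^+ 2.
Proof. by rewrite /pden realcD realcM !sqmodE realcX. Qed.

Lemma zcoord_poincare A u : zcoord (poincare A u) = pnum A u / (pden A u)%:C%C.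
Proof.
rewrite /zcoord poincareE /=; case: (pnum A u) => x y /=.
rewrite -realcV; set r := (pden A u)^-1.
by rewrite /real_complex_def /=; simpc.
Qed.

Lemma space_eq (u v : space) : zcoord u = zcoord v -> u.2 = v.2 -> u = v.
Proof. by case: u v => [[? ?] ?] [[? ?] ?] [-> ->] /= ->. Qed.

(** A Gram determinant: the Hermitian form row_form introduced below has determinant
    t^2, and the two rows of A have determinant 1. *)
Lemma pnum_norm (A : SL2 C) u : pnum A u * conjc (pnum A u) + (u.2)%:C%C ^+ 2 =
  (pden A u)%:C%C * ((ent A 0 0 * zcoord u + ent A 0 1)
     * conjc (ent A 0 0 * zcoord u + ent A 0 1)
   + ent A 0 0 * conjc (ent A 0 0) * (u.2)%:C%C ^+ 2).
Proof.
have h := SL2E A.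
have h' := congr1 (@conjc R) h.
rewrite pdenE /pnum realcX; move: h'.
rewrite conjcB conjc1 !(conjcD, conjcM, conjcK, conjcX, conjc_real).
set a := ent A 0 0 in h *; set b := ent A 0 1 in h *.
set c := ent A 1 0 in h *; set d := ent A 1 1 in h *.
set t := (u.2)%:C%C; set z := zcoord u.
move: (conjc a) (conjc b) (conjc c) (conjc d) (conjc z) => a' b' c' d' z' h'.
have e : t ^+ 2 = t ^+ 2 * ((a * d - b * c) * (a' * d' - b' * c')) by rewrite h h' !mulr1.
by rewrite [X in _ + X = _]e; ring.
Qed.

Lemma pden_neq0 (A : SL2 C) u : H3 u -> (pden A u)%:C%C != 0 :> C.
Proof. by move=> hu; rewrite fmorph_eq0 gt_eqF // pden_gt0. Qed.

Lemma pnumE A u : pnum A u = (A 0 0 * zcoord u + A 0 1) * conjc (A 1 0 * zcoord u + A 1 1)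
  + A 0 0 * conjc (A 1 0) * (u.2)%:C%C ^+ 2.
Proof. by rewrite /pnum realcX. Qed.

(** The Hermitian form on rows attached to the point u = (z, t). The numerator and the
    denominator of the Poincare extension are its values on the rows of A. *)
Definition row_form (a b a' b' : C) (u : space) : C :=
  (a * zcoord u + b) * conjc (a' * zcoord u + b') + a * conjc a' * (u.2)%:C%C ^+ 2.

(** The form at B u is, up to the factor pden B u, the form at u composed with B.
    Applied to the rows of A this gives both cocycle identities that turn the
    Poincare extension into an action. *)
Lemma row_form_mul (B : SL2 C) u a b a' b' : H3 u ->
  row_form (a * ent B 0 0 + b * ent B 1 0) (a * ent B 0 1 + b * ent B 1 1)
    (a' * ent B 0 0 + b' * ent B 1 0) (a' * ent B 0 1 + b' * ent B 1 1) u =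
  row_form a b a' b' (poincare B u) * (pden B u)%:C%C.
Proof.
move=> hu; have n0 := pden_neq0 B hu; have hn := pnum_norm B u.
have nE := pdenE B u; have wE := pnumE B u.
have nR : conjc (pden B u)%:C%C = (pden B u)%:C%C :> C by rewrite conjc_real.
have wE' := congr1 (@conjc R) wE.
rewrite /row_form zcoord_poincare poincareE /= [(u.2 / _)%:C%C]realcM realcV.
move: (pnum B u) (pden B u)%:C%C n0 nR hn nE wE wE' => w n n0 nR hn nE wE wE'.
move: hn nE wE wE'; rewrite !(conjcD, conjcM, conjcK, conjc_inv, nR, conjcX, conjc_real).
move: (conjc w) => w' hn nE wE wE'.
set t := (u.2)%:C%C in hn nE wE wE' *; set z := zcoord u in hn nE wE wE' *.
set c := ent B 0 0 in hn nE wE wE' *; set d := ent B 0 1 in hn nE wE wE' *.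
set e := ent B 1 0 in hn nE wE wE' *; set f := ent B 1 1 in hn nE wE wE' *.
move: (conjc a') (conjc b') (conjc c) (conjc d) (conjc e) (conjc f) (conjc z)
  hn nE wE wE' => {}a' {}b' c' d' e' f' z' hn nE wE wE'.
apply: (mulIf n0).
transitivity (a * a' * (w * w' + t ^+ 2) + a * b' * w * n + a' * b * w' * n + b * b' * n ^+ 2).
  rewrite hn.
  transitivity (n * (a * a' * ((c * z + d) * (c' * z' + d') + c * c' * t ^+ 2)
     + a * b' * w + a' * b * w' + b * b' * n)); last by ring.
  rewrite mulrC; congr (_ * _); rewrite wE wE' nE; ring.
by field.
Qed.

Lemma pden_mul (A B : SL2 C) u : H3 u ->
  (pden (A * B)%g u)%:C%C = (pden A (poincare B u))%:C%C * (pden B u)%:C%C :> C.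
Proof.
move=> hu; rewrite [LHS]pdenE [X in _ = X * _]pdenE !mulmx22E.
exact: (row_form_mul B (ent A 1 0) (ent A 1 1) (ent A 1 0) (ent A 1 1) hu).
Qed.

Lemma pnum_mul (A B : SL2 C) u : H3 u ->
  pnum (A * B)%g u = pnum A (poincare B u) * (pden B u)%:C%C.
Proof.
move=> hu; rewrite [LHS]pnumE [X in _ = X * _]pnumE !mulmx22E.
exact: (row_form_mul B (ent A 0 0) (ent A 0 1) (ent A 1 0) (ent A 1 1) hu).
Qed.

Lemma poincareM (A B : SL2 C) u : H3 u ->
  poincare (A * B)%g u = poincare A (poincare B u).
Proof.
move=> hu; have hBu := poincare_H3 B hu.
apply: space_eq.
  rewrite !zcoord_poincare pnum_mul // pden_mul // -mulf_div divff ?mulr1 //.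
  exact: pden_neq0.
have : pden (A * B)%g u = pden A (poincare B u) * pden B u.
  by apply: complexI; rewrite pden_mul // realcM.
by rewrite !poincareE /= => ->; rewrite invfM [in RHS]mulrAC mulrA.
Qed.

Lemma poincare1 u : poincare (1%g : SL2 C) u = u.
Proof.
have e00 : ent (1 : SL2 C) 0 0 = 1 by rewrite mxE.
have e01 : ent (1 : SL2 C) 0 1 = 0 by rewrite mxE.
have e10 : ent (1 : SL2 C) 1 0 = 0 by rewrite mxE.
have e11 : ent (1 : SL2 C) 1 1 = 1 by rewrite mxE.
have pd : pden (1%g : SL2 C) u = 1.
  apply: complexI; rewrite pdenE e10 e11 [0 * zcoord u]mul0r add0r conjc1.
  by rewrite mulr1 !mul0r addr0.
apply: space_eq; last by rewrite poincareE /= pd divr1.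
rewrite zcoord_poincare pd divr1 pnumE e00 e01 e10 e11.
by rewrite [0 * zcoord u]mul0r add0r conjc1 conjc0 mulr0 mul0r !addr0 mul1r mulr1.
Qed.

Lemma continuous_poincare (A : SL2 C) u : H3 u -> {for u, continuous (poincare A)}.
Proof.
move=> hu; have n0 := pden_gt0 A hu.
have c1 : continuous (fun u : space => u.1.1).
  by apply: continuous_compose; [exact: continuous_fst|exact: continuous_fst].
have c2 : continuous (fun u : space => u.1.2).
  by apply: continuous_compose; [exact: continuous_fst|exact: continuous_snd].
have c3 : continuous (fun u : space => u.2) by exact: continuous_snd.
have cn : continuous (pden A).
  rewrite /pden /sqmod /zcoord.
  case: (ent A 1 0) => a1 a2; case: (ent A 1 1) => b1 b2 /= v.
  by repeat first [exact: c1|exact: c2|exact: c3|exact: cvg_cst|apply: cvgD|apply: cvgM|apply: cvgN].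
have cRe : continuous (fun u => complex.Re (pnum A u)).
  rewrite /pnum /zcoord.
  case: (ent A 1 0) => a1 a2; case: (ent A 1 1) => b1 b2 /=.
  case: (ent A 0 0) => d1 d2; case: (ent A 0 1) => e1 e2 /= v.
  by repeat first [exact: c1|exact: c2|exact: c3|exact: cvg_cst|apply: cvgD|apply: cvgM|apply: cvgN].
have cIm : continuous (fun u => complex.Im (pnum A u)).
  rewrite /pnum /zcoord.
  case: (ent A 1 0) => a1 a2; case: (ent A 1 1) => b1 b2 /=.
  case: (ent A 0 0) => d1 d2; case: (ent A 0 1) => e1 e2 /= v.
  by repeat first [exact: c1|exact: c2|exact: c3|exact: cvg_cst|apply: cvgD|apply: cvgM|apply: cvgN].
have cV : (pden A x)^-1 @[x --> u] --> (pden A u)^-1.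
  by apply: cvgV; [rewrite gt_eqF|exact: cn].
exact: (cvg_pair (cvg_pair (cvgM (cRe u) cV) (cvgM (cIm u) cV)) (cvgM (c3 u) cV)).
Qed.

End Poincare.

(** * Lifting along the covering of the knot complement *)

Section Covering.
Variable R : realType.
Local Notation C := R[i].
Local Notation plane := (R * R)%type.
Local Notation space := (R * R * R)%type.

Lemma H3_open : open (@H3 R).
Proof.
have -> : @H3 R = snd @^-1` [set y | 0 < y] by [].
by apply: open_comp; [move=> x _; exact: cvg_snd | exact: open_gt].
Qed.

Lemma H3_near (u : space) : H3 u -> \forall v \near u, H3 v.
Proof. by move=> hu; exact: open_nbhs_nbhs (conj H3_open hu). Qed.

Definition hline (u v : space) (t : R) : space :=
  ((u.1.1 + t * (v.1.1 - u.1.1), u.1.2 + t * (v.1.2 - u.1.2)), u.2 + t * (v.2 - u.2)).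

Lemma hline0 u v : hline u v 0 = u.
Proof. by rewrite /hline !mul0r !addr0; case: u => -[]. Qed.

Lemma hline1 u v : hline u v 1 = v.
Proof. by rewrite /hline !mul1r !subrKC; case: v => -[]. Qed.

Lemma hline_H3 u v t : H3 u -> H3 v -> 0 <= t <= 1 -> H3 (hline u v t).
Proof. by rewrite /H3 /= => hy hz /andP[? ?]; nra. Qed.

Lemma hline_continuous (X : topologicalType) (f g : X -> space) (s : X -> R) :
  continuous f -> continuous g -> continuous s -> continuous (fun x => hline (f x) (g x) (s x)).
Proof.
move=> cf cg cs.
have c (a b : X -> R) : continuous a -> continuous b -> continuous (fun x => a x + s x * (b x - a x)).
  move=> ca cb x; apply: cvgD; first exact: ca.
  by apply: cvgM; [exact: cs | apply: cvgB; [exact: cb|exact: ca]].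
have p1 (a : X -> space) : continuous a -> continuous (fun x => (a x).1.1).
  by move=> ca; apply: continuous_compose (continuous_compose ca _) _; exact: continuous_fst.
have p2 (a : X -> space) : continuous a -> continuous (fun x => (a x).1.2).
  by move=> ca; apply: continuous_compose (continuous_compose ca _) _;
    [exact: continuous_fst|exact: continuous_snd].
have p3 (a : X -> space) : continuous a -> continuous (fun x => (a x).2).
  by move=> ca; apply: continuous_compose ca _; exact: continuous_snd.
by apply: continuous_pair; [apply: continuous_pair|]; apply: c; auto.
Qed.

Variables (K : framed_knot R) (P : space -> sphere3 R).
Hypothesis hP : hyperbolic_structure K P.

Lemma near_preimage (X Y : topologicalType) (g : X -> Y) x (S : set Y) :
  {for x, continuous g} -> nbhs (g x) S -> \forall y \near x, S (g y).
Proof. by move=> cg nS; exact: cg nS. Qed.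

Lemma P_near (u : space) (U : set space) : H3 u -> nbhs u U -> nbhs (P u) (P @` (U `&` @H3 R)).
Proof.
move=> hu; rewrite nbhsE => -[V [oV Vu] VU].
have [_ hopen _ _ _] := hP.
have oVH : open (V `&` @H3 R) by apply: openI => //; exact: H3_open.
apply: filterS (open_nbhs_nbhs (conj (hopen _ oVH _) _)).
- by apply: image_subset => v [/VU ? ?].
- by move=> v [].
- by exists u.
Qed.

Lemma P_continuous (u : space) : H3 u -> {for u, continuous P}.
Proof.
move=> hu; have [[_ /subspace_continuousP/(_ u hu) c] _ _ _ _] := hP.
move=> S /c h; have h' : \forall v \near u, H3 v -> S (P v) by exact: h.
by apply: filterS2 h' (H3_near hu) => v; exact.
Qed.

Lemma P_inj_near (u : space) : H3 u -> exists U : set space,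
  [/\ open U, U u, U `<=` @H3 R & forall v w, U v -> U w -> P v = P w -> v = w].
Proof.
move=> hu; have [_ _ hinj _ _] := hP; have [U nU iU] := hinj u hu.
exists (U^° `&` @H3 R); split => //.
- by apply: openI; [exact: open_interior|exact: H3_open].
- by move=> v w [/interior_subset Uv _] [/interior_subset Uw _]; apply: iU; rewrite inE.
Qed.

Lemma P_image (x : sphere3 R) : ~ knot K x <-> exists2 u, H3 u & P u = x.
Proof.
have [[im _] _ _ _ _] := hP.
have -> : (~ knot K x) = (P @` @H3 R) x by rewrite im.
by split => -[u ? ?]; exists u.
Qed.

Lemma deck1 : deck P (1%g : SL2 C).
Proof. by move=> u _; rewrite poincare1. Qed.

Lemma deckM (A B : SL2 C) : deck P A -> deck P B -> deck P (A * B)%g.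
Proof.
by move=> dA dB u hu; rewrite poincareM // dA ?dB //; exact: poincare_H3.
Qed.

Lemma poincareK (A : SL2 C) u : H3 u -> poincare (A^-1)%g (poincare A u) = u.
Proof. by move=> hu; rewrite -poincareM // mulVg poincare1. Qed.

Lemma poincareVK (A : SL2 C) u : H3 u -> poincare A (poincare (A^-1)%g u) = u.
Proof. by move=> hu; rewrite -poincareM // mulgV poincare1. Qed.

Lemma deckV (A : SL2 C) : deck P A -> deck P (A^-1)%g.
Proof.
move=> dA u hu; rewrite -(dA (poincare (A^-1)%g u)); last exact: poincare_H3.
by rewrite poincareVK.
Qed.

Lemma space_hausdorff : hausdorff_space space.
Proof. exact: norm_hausdorff. Qed.

Lemma near_neq (X Y : topologicalType) (f g : X -> Y) x : hausdorff_space Y ->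
  {for x, continuous f} -> {for x, continuous g} -> f x <> g x ->
  \forall y \near x, f y <> g y.
Proof.
move=> hY cf cg /eqP fg; move: hY.
rewrite open_hausdorff => /(_ _ _ fg)[[A B] /= [Af Bg] [oA oB AB]].
have nA : nbhs (f x) A by apply: open_nbhs_nbhs; split => //; rewrite inE in Af.
have nB : nbhs (g x) B by apply: open_nbhs_nbhs; split => //; rewrite inE in Bg.
have h1 : \forall y \near x, A (f y) by exact: cf nA.
have h2 : \forall y \near x, B (g y) by exact: cg nB.
apply: filterS2 h1 h2 => y Ay By e.
suff : (A `&` B) (f y) by rewrite (eqP AB).
by split => //; rewrite e.
Qed.

Lemma near_lift_eq (X : topologicalType) (f g : X -> space) x :
  {for x, continuous f} -> {for x, continuous g} -> H3 (f x) -> f x = g x ->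
  (\forall y \near x, P (f y) = P (g y)) -> \forall y \near x, f y = g y.
Proof.
move=> cf cg hx e Pfg; have [U [oU Uf UH iU]] := P_inj_near hx.
have nU : nbhs (f x) U by exact: open_nbhs_nbhs.
have h1 : \forall y \near x, U (f y) by exact: cf nU.
have h2 : \forall y \near x, U (g y) by apply: cg; rewrite -e.
by apply: filterS3 h1 h2 Pfg => y; exact: iU.
Qed.

(** The fixed points of a deck transformation form an open and closed subset of every
    segment: open because P is injective near each point. *)
Lemma deck_free (A : SL2 C) y : deck P A -> H3 y -> poincare A y = y ->
  forall z, H3 z -> poincare A z = z.
Proof.
move=> dA hy Ay z hz.
pose L := hline y z.
have cL : continuous L.
  by apply: hline_continuous; [exact: cst_continuous|exact: cst_continuous|move=> ?; exact: cvg_id].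
have L0 : L 0 = y by exact: hline0.
have L1 : L 1 = z by exact: hline1.
have HL t : 0 <= t <= 1 -> H3 (L t) by exact: hline_H3.
suff : (poincare A (L 0) = L 0 <-> poincare A (L 1) = L 1).
  by rewrite L0 L1 => -[h _]; exact: h.
apply: (@locally_constant_itv R (fun t => poincare A (L t) = L t) 0 1 ler01) => t t01.
have HLt := HL t t01.
have cAL : {for t, continuous (fun s => poincare A (L s))}.
  by apply: continuous_comp; [exact: cL | exact: continuous_poincare].
have [e|ne] := pselect (poincare A (L t) = L t).
  have : \forall s \near t, poincare A (L s) = L s.
    apply: near_lift_eq => //; [exact: cL|exact: poincare_H3|].
    have : \forall s \near t, H3 (L s) by exact: cL (H3_near HLt).
    by apply: filterS => s /dA.
  by apply: filterS => s es _; split.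
have := near_neq space_hausdorff cAL (cL t) ne.
by apply: filterS => s es _; split.
Qed.

Lemma lift_unique (L1 L2 : plane -> space) x y :
  continuous L1 -> continuous L2 -> (forall x, H3 (L1 x)) ->
  (forall x, P (L1 x) = P (L2 x)) -> L1 x = L2 x -> L1 y = L2 y.
Proof.
move=> c1 c2 h1 PL; apply: (@locally_constant_plane R setT (fun x => L1 x = L2 x)) => // z _.
have [e|ne] := pselect (L1 z = L2 z).
  have : \forall s \near z, L1 s = L2 s.
    apply: near_lift_eq => //; [exact: c1|exact: c2|].
    by apply: (@filterS _ (nbhs z) _ setT) => [s _|]; [exact: PL|exact: filterT].
  by apply: filterS => s es _; split.
by have := near_neq space_hausdorff (c1 z) (c2 z) ne; apply: filterS => s es _; split.
Qed.

Lemma path_lift_unique (L1 L2 : R -> space) s t :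
  continuous L1 -> continuous L2 -> (forall t, H3 (L1 t)) ->
  (forall t, P (L1 t) = P (L2 t)) -> L1 s = L2 s -> L1 t = L2 t.
Proof.
move=> c1 c2 h1 PL.
have := @lift_unique (fun u => L1 u.1) (fun u => L2 u.1) (s, 0) (t, 0).
apply => //; apply: continuous_compose => //; exact: continuous_fst.
Qed.

(** The inverse of P near v0, where P is injective, is continuous because P is open. *)
Lemma local_lift (X : topologicalType) (k : X -> sphere3 R) x v0 :
  (\forall y \near x, {for y, continuous k}) -> H3 v0 -> P v0 = k x ->
  exists L : X -> space, L x = v0 /\
    \forall y \near x, [/\ H3 (L y), P (L y) = k y & {for y, continuous L}].
Proof.
move=> ck hv0 Pv0; have [U [oU Uv UH iU]] := P_inj_near hv0.
pose L y := xget v0 [set w | U w /\ P w = k y].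
have LP y w : U w -> P w = k y -> L y = w.
  move=> Uw Pw; have [Uf Pf] : [set w | U w /\ P w = k y] (L y) by apply: xgetPex; exists w.
  by apply: iU => //; rewrite Pf.
have L_cont y : {for y, continuous k} -> U (L y) -> P (L y) = k y -> {for y, continuous L}.
  move=> cky Uf Pf W nW; have nU : nbhs (L y) U by exact: open_nbhs_nbhs.
  have h : nbhs (k y) (P @` ((W `&` U) `&` @H3 R)).
    by rewrite -Pf; apply: (P_near (UH _ Uf)); exact: filterI.
  have := near_preimage cky h.
  by apply: filterS => z [w [[Ww Uw] Hw] Pw]; rewrite /= (LP z w).
exists L; split; first exact: LP.
have := P_near hv0 (open_nbhs_nbhs (conj oU Uv)); rewrite Pv0.
move=> /(near_preimage (nbhs_singleton ck)); apply: filterS2 ck => y cky [w [Uw Hw] Pw].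
have Lw := LP y w Uw Pw.
by split; rewrite ?Lw //; apply: L_cont; rewrite ?Lw.
Qed.

(** The local lifts differ by deck transformations, which act freely, so flat_plane
    glues them. *)
Lemma lift_exists (k : plane -> sphere3 R) u0 v0 : continuous k ->
  (forall x, ~ knot K (k x)) -> H3 v0 -> P v0 = k u0 ->
  exists L : plane -> space, [/\ continuous L, forall x, H3 (L x),
    forall x, P (L x) = k x & L u0 = v0].
Proof.
move=> ck kX hv0 Pv0.
have [f hf] : {f : plane -> plane -> space & forall x, (H3 (f x x) /\ P (f x x) = k x) /\
    \forall y \near x, [/\ H3 (f x y), P (f x y) = k y & {for y, continuous (f x)}]}.
  apply: (choice (P := fun x f => (H3 (f x) /\ P (f x) = k x) /\
    \forall y \near x, [/\ H3 (f y), P (f y) = k y & {for y, continuous f}])) => x.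
  have /P_image[u hu Pu] := kX x.
  have [|L [Lx hL]] := @local_lift _ k x u _ hu Pu; last by exists L; rewrite Lx.
  by apply: (@filterS _ (nbhs x) _ setT) => [y _|]; [exact: ck|exact: filterT].
pose act (A : SL2 C) := poincare A.
have hdeck : forall u v, H3 u -> H3 v -> P u = P v -> exists2 A, deck P A & v = poincare A u.
  by case: hP.
have f_loc x : \forall y \near x, H3 (f x y) /\
    exists2 c, deck P c & \forall z \near y, f y z = act c (f x z).
  have := near_join (hf x).2; apply: filterS => y hy.
  have [Hxy Pxy cxy] := nbhs_singleton hy; have [Hyy Pyy] := (hf y).1.
  split => //; have [c dc yE] := hdeck _ _ Hxy Hyy (etrans Pxy (esym Pyy)).
  have [_ _ cyy] := nbhs_singleton (hf y).2.
  exists c => //; apply: near_lift_eq => //.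
    by apply: continuous_comp => //; exact: continuous_poincare.
  by apply: filterS2 hy (hf y).2 => z [Hz Pz _] [_ Pz' _]; rewrite Pz' dc.
have a1 y : H3 y -> act 1%g y = y by move=> _; exact: poincare1.
have aM a b y : deck P a -> deck P b -> H3 y -> act (a * b)%g y = act a (act b y).
  by move=> _ _; exact: poincareM.
have [F [fF _]] := flat_plane a1 aM deckM deckV deck_free f_loc u0 deck1.
have Floc x : exists2 c, deck P c & \forall y \near x, F y = poincare c (f x y).
  have [c dc h] := fF x Logic.I; exists c => //; by apply: filterS h => y; exact.
have HF x : H3 (F x) /\ P (F x) = k x.
  have [c dc /nbhs_singleton ->] := Floc x; have [Hv Pv] := (hf x).1.
  by split; [exact: poincare_H3|rewrite dc].
have cF : continuous F.
  move=> x; have [c dc h] := Floc x; have [Hx _ cx] := nbhs_singleton (hf x).2.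
  have cc : {for x, continuous (fun z => poincare c (f x z))}.
    by apply: continuous_comp => //; exact: continuous_poincare.
  move=> W; rewrite (nbhs_singleton h) => /(near_preimage cc) hW.
  by apply: filterS2 h hW => y /= ->.
have [c dc v0E] := hdeck _ _ (HF u0).1 hv0 (etrans (HF u0).2 (esym Pv0)).
exists (fun x => poincare c (F x)); split => // x.
- by apply: continuous_comp; [exact: cF | apply: continuous_poincare; exact: (HF x).1].
- exact: poincare_H3 (HF x).1.
- by rewrite dc ?(HF x).2 //; exact: (HF x).1.
Qed.

End Covering.

(** * The exterior as a deformation retract of the complement *)

Section Deformation.
Variable R : realType.
Local Notation plane := (R * R)%type.

Lemma subtype_hausdorff (X : topologicalType) (A : set X) :
  hausdorff_space X -> hausdorff_space A.
Proof.
rewrite !open_hausdorff => hX x y xy.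
have xy' : set_val x != set_val y by apply: contra_neq xy => /val_inj.
have [[U V] /= [Ux Vy] [oU oV UV]] := hX _ _ xy'.
exists (set_val @^-1` U, set_val @^-1` V) => /=.
  by rewrite !inE /= in Ux Vy *.
split; try by apply: open_comp => // z _; exact: initial_continuous.
apply/eqP; rewrite -subset0 => z [Uz Vz].
by have : (U `&` V) (set_val z) by []; rewrite (eqP UV).
Qed.

Lemma sphere3_hausdorff : hausdorff_space (sphere3 R).
Proof. by apply: subtype_hausdorff; exact: (@norm_hausdorff R (plane * plane)%type). Qed.

Lemma subtype_compact (X : topologicalType) (A : set X) :
  compact A -> compact [set: A].
Proof.
move=> cA F PF _.
have FA : (set_val @ F) A by apply: (@filterS _ F _ setT) => [x _|]; [exact: set_valP|exact: filterT].
have [p [Ap clp]] := cA (set_val @ F) _ FA.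
exists (exist (fun x => x \in A) p (mem_set Ap)); split => // B C FB [_ [[C' oC <-] C'p] sC].
have [|q [[x Bx <-] Cq]] := clp (set_val @` B) C' _ (open_nbhs_nbhs (conj oC C'p)).
  by apply: (@filterS _ F _ B) => // x Bx; exists x.
by exists x; split => //; exact: sC.
Qed.

Lemma sqnorm_continuous : continuous (@sqnorm R).
Proof.
by move=> u; apply: cvgD; apply: cvgM; try exact: cvg_fst; exact: cvg_snd.
Qed.

Lemma sqnorm_bound (u : plane) (r : R) : 0 <= r -> sqnorm u <= r ^+ 2 ->
  -r <= u.1 <= r /\ -r <= u.2 <= r.
Proof.
rewrite /sqnorm => r0 h; have := sqr_ge0 u.1; have := sqr_ge0 u.2 => h2 h1.
by split; rewrite -ler_norml; rewrite -ler_sqr ?nnegrE // real_normK ?num_real //; lra.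
Qed.

Lemma box_compact (r : R) :
  compact [set u : plane * plane | sqnorm u.1 <= r ^+ 2 /\ sqnorm u.2 <= r ^+ 2].
Proof.
have cI := @segment_compact R (- `|r|) `|r|.
apply: (@subclosed_compact _ _ ((`[- `|r|, `|r|] `*` `[- `|r|, `|r|]) `*`
   (`[- `|r|, `|r|] `*` `[- `|r|, `|r|]))%classic).
- have -> : [set u : plane * plane | sqnorm u.1 <= r ^+ 2 /\ sqnorm u.2 <= r ^+ 2] =
      ((fun u => sqnorm u.1) @^-1` [set y | y <= r ^+ 2]) `&`
      ((fun u => sqnorm u.2) @^-1` [set y | y <= r ^+ 2]) by [].
  apply: closedI; apply: preimage_closed; try exact: closed_le; move=> u _.
  + by apply: continuous_comp; [exact: cvg_fst | exact: sqnorm_continuous].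
  + by apply: continuous_comp; [exact: cvg_snd | exact: sqnorm_continuous].
- by apply: compact_setX; exact: compact_setX.
- move=> u [/= h1 h2]; rewrite -[r ^+ 2]real_normK ?num_real // in h1 h2.
  have [? ?] := sqnorm_bound (normr_ge0 r) h1; have [? ?] := sqnorm_bound (normr_ge0 r) h2.
  by split; split => /=; rewrite in_itv.
Qed.

Lemma sphere3_compact : compact [set: sphere3 R].
Proof.
apply: subtype_compact.
apply: subclosed_compact (box_compact (r := 1)) _.
  have -> : sphere3 R = (fun u => sqnorm u.1 + sqnorm u.2) @^-1` [set 1] by [].
  apply: preimage_closed; last exact: closed_eq.
  move=> u _; apply: cvgD.
  - by apply: continuous_comp; [exact: cvg_fst | exact: sqnorm_continuous].
  - by apply: continuous_comp; [exact: cvg_snd | exact: sqnorm_continuous].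
move=> u; rewrite /sphere3 /= => h; rewrite expr1n.
have : 0 <= sqnorm u.1 by rewrite addr_ge0 ?sqr_ge0.
have : 0 <= sqnorm u.2 by rewrite addr_ge0 ?sqr_ge0.
by move=> ? ?; split; lra.
Qed.

Variable K : framed_knot R.

Let D2 := circle_disk (2 : R).
Let T2 : set (sphere3 R) := tube K @` D2.

Lemma tube_image_open (U : set (plane * plane)) : open U -> open (tube K @` (U `&` D2)).
Proof. exact: tube_open. Qed.

Lemma T2_open : open T2.
Proof. by have := tube_image_open openT; rewrite setTI. Qed.

Lemma exterior_closed : closed (exterior K).
Proof.
rewrite /exterior; apply: open_closedC.
have -> : circle_disk 1 = [set u : plane * plane | sqnorm u.2 < 1] `&` D2.
  apply/seteqP; split => u; rewrite /D2 /circle_disk /= expr1n.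
    by move=> [-> h]; split => //; split => //; lra.
  by move=> [h [-> _]].
apply: tube_image_open.
have -> : [set u : plane * plane | sqnorm u.2 < 1] = (fun u => sqnorm u.2) @^-1` [set y | y < 1] by [].
apply: open_comp; last exact: open_lt.
by move=> u _; apply: continuous_comp; [exact: cvg_snd | exact: sqnorm_continuous].
Qed.

Lemma exterior_compact : compact (exterior K).
Proof. exact: subclosed_compact exterior_closed sphere3_compact _. Qed.

Lemma tube_compact_disk : closed (tube K @` [set u | sqnorm u.1 = 1 /\ sqnorm u.2 <= 1]).
Proof.
apply: compact_closed; first exact: sphere3_hausdorff.
have sD : [set u : plane * plane | sqnorm u.1 = 1 /\ sqnorm u.2 <= 1] `<=` D2.
  by move=> u [h1 h2]; split => //; rewrite expr2; lra.
apply: continuous_compact.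
  exact: continuous_subspaceW sD (@tube_continuous _ K).
apply: subclosed_compact (box_compact (r := 1)) _.
  have -> : [set u : plane * plane | sqnorm u.1 = 1 /\ sqnorm u.2 <= 1] =
      ((fun u => sqnorm u.1) @^-1` [set 1]) `&` ((fun u => sqnorm u.2) @^-1` [set y | y <= 1]) by [].
  apply: closedI; apply: preimage_closed; try exact: closed_le; try exact: closed_eq; move=> u _.
  + by apply: continuous_comp; [exact: cvg_fst | exact: sqnorm_continuous].
  + by apply: continuous_comp; [exact: cvg_snd | exact: sqnorm_continuous].
by move=> u [h1 h2]; rewrite /= expr1n h1.
Qed.

Definition tube_inv (x : sphere3 R) : plane * plane :=
  xget ((1, 0), (0, 0)) [set u | D2 u /\ tube K u = x].

Lemma tube_invP x : T2 x -> D2 (tube_inv x) /\ tube K (tube_inv x) = x.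
Proof.
move=> [u Du ux]; rewrite /tube_inv.
by case: xgetP => [v -> [? ?] //|/(_ u)]; case.
Qed.

Lemma tube_invK u : D2 u -> tube_inv (tube K u) = u.
Proof.
move=> Du; have [D e] := @tube_invP (tube K u) (ex_intro2 _ _ u Du erefl).
by apply: (@tube_inj _ K); rewrite ?inE.
Qed.

Lemma tube_inv_continuous x : T2 x -> {for x, continuous tube_inv}.
Proof.
move=> T2x U; rewrite nbhsE => -[V [oV Vx] VU].
have [Dx ex] := tube_invP T2x.
apply: (@filterS _ _ _ (tube K @` (V `&` D2))).
  by move=> y [u [Vu Du] <-] /=; rewrite tube_invK //; exact: VU.
apply: open_nbhs_nbhs; split; first exact: tube_image_open.
by exists (tube_inv x).
Qed.

Lemma tube_comp_continuous (X : topologicalType) (g : X -> plane * plane) x :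
  {for x, continuous g} -> (\forall y \near x, D2 (g y)) ->
  {for x, continuous (fun y => tube K (g y))}.
Proof.
move=> cg Dg S.
have /subspace_continuousP/(_ _ (nbhs_singleton Dg)) c := @tube_continuous _ K.
move=> /c h; have h' : \forall u \near g x, D2 u -> S (tube K u) by exact: h.
by apply: filterS2 (near_preimage cg h') Dg => y /= hy; exact: hy.
Qed.

Definition norm2 (w : plane) : R := Num.sqrt (sqnorm w).

Lemma sqnorm_ge0 (w : plane) : 0 <= sqnorm w.
Proof. by rewrite addr_ge0 ?sqr_ge0. Qed.

Lemma sqnorm_eq0 (w : plane) : (sqnorm w == 0) = (w == (0, 0)).
Proof.
case: w => x y; rewrite /sqnorm /= paddr_eq0 ?sqr_ge0 // !sqrf_eq0.
by apply/andP/eqP => [[/eqP -> /eqP ->]|[-> ->]].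
Qed.

Lemma sqnorm0 : sqnorm (0 : R, 0 : R) = 0.
Proof. by apply/eqP; rewrite sqnorm_eq0. Qed.

Lemma norm2_gt0 (w : plane) : w != (0, 0) -> 0 < norm2 w.
Proof. by move=> w0; rewrite sqrtr_gt0 lt0r sqnorm_eq0 w0 sqnorm_ge0. Qed.

Lemma norm2_sqr w : norm2 w ^+ 2 = sqnorm w.
Proof. by rewrite sqr_sqrtr // sqnorm_ge0. Qed.

(** The factor is 1 for s = 0, and for s = 1 it moves a vector w <> 0 to the length
    max (1, |w|): only points of the tube of radius 1 are moved. *)
Definition push_factor (s : R) (w : plane) : R :=
  1 - clamp s + clamp s * Num.max 1 (norm2 w)^-1.

Definition push_disk (s : R) (u : plane * plane) : plane * plane :=
  (u.1, (push_factor s u.2 * u.2.1, push_factor s u.2 * u.2.2)).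

Definition push (s : R) (x : sphere3 R) : sphere3 R :=
  if `[< T2 x >] then tube K (push_disk s (tube_inv x)) else x.

Lemma sqnormZ (c : R) (w : plane) : sqnorm (c * w.1, c * w.2) = c ^+ 2 * sqnorm w.
Proof. by rewrite /sqnorm /=; ring. Qed.

Lemma push_factor_ge1 s w : 1 <= push_factor s w.
Proof.
rewrite /push_factor; have := clamp_ge0 s; have := clamp_le1 s.
have : 1 <= Num.max 1 (norm2 w)^-1 by rewrite le_max lexx.
set m := Num.max _ _; set c := clamp s; nra.
Qed.

Lemma push_factor_id s w : 1 <= sqnorm w -> push_factor s w = 1.
Proof.
move=> w1; rewrite /push_factor max_l ?mulr1 ?subrK //.
have n1 : 1 <= norm2 w by rewrite -sqrtr1 ler_sqrt // sqnorm_ge0.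
by rewrite invf_le1 // (lt_le_trans ltr01).
Qed.

Lemma push_factor_norm s w : w != (0, 0) -> push_factor s w * norm2 w <= Num.max 1 (norm2 w).
Proof.
move=> /norm2_gt0 n0; rewrite /push_factor.
have mE : Num.max 1 (norm2 w)^-1 * norm2 w = Num.max 1 (norm2 w).
  rewrite maxr_pMl ?ltW // mul1r mulVf ?gt_eqF // maxC //.
have : norm2 w <= Num.max 1 (norm2 w) by rewrite le_max lexx orbT.
rewrite mulrDl -mulrA mE; have := clamp_ge0 s; have := clamp_le1 s.
set m := Num.max _ _; set c := clamp s; nra.
Qed.

Lemma push_factor1 w : w != (0, 0) -> push_factor 1 w * norm2 w = Num.max 1 (norm2 w).
Proof.
move=> /norm2_gt0 n0; rewrite /push_factor clamp1 // subrr add0r mul1r.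
by rewrite maxr_pMl ?ltW // mul1r mulVf ?gt_eqF // maxC.
Qed.

Lemma push_disk_D2 s u : D2 u -> u.2 != (0, 0) -> D2 (push_disk s u).
Proof.
move=> [u1 u2] w0; split => //=; rewrite sqnormZ -norm2_sqr -exprMn.
rewrite ltr_pXn2r ?nnegrE ?mulr_ge0 ?sqrtr_ge0 ?(le_trans ler01 (push_factor_ge1 _ _)) //.
apply: le_lt_trans (push_factor_norm s w0) _; rewrite gt_max; apply/andP; split; first lra.
have : norm2 u.2 < Num.sqrt (2 ^+ 2) by rewrite ltr_sqrt // exprn_gt0.
by rewrite sqrtr_sqr ger0_norm.
Qed.

Lemma push0 x : push 0 x = x.
Proof.
rewrite /push; case: asboolP => // /tube_invP[_ e].
rewrite -[RHS]e; congr (tube K _); rewrite /push_disk /push_factor clamp0 //.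
by rewrite mul0r subr0 addr0 !mul1r; case: (tube_inv x) => ? [].
Qed.

Lemma exterior_tube u : D2 u -> exterior K (tube K u) <-> 1 <= sqnorm u.2.
Proof.
move=> Du; split => [h|h [v [v1 v2] e]].
  rewrite leNgt; apply/negP => u2; apply: h; exists u => //.
  by split; [case: Du|rewrite expr1n].
have Dv : D2 v by split => //; apply: lt_trans v2 _; rewrite expr1n expr2; lra.
have vu : v = u by apply: (@tube_inj _ K); rewrite ?inE.
by move: v2; rewrite expr1n vu ltNge h.
Qed.

Lemma knot_tube u : D2 u -> knot K (tube K u) <-> u.2 = (0, 0).
Proof.
move=> Du; split => [[v [v1 v2] e]|u2]; last by exists u => //; split => //; case: Du.
have Dv : D2 v by split => //; rewrite v2 sqnorm0 expr2; lra.
have <- : v = u by apply: (@tube_inj _ K); rewrite ?inE.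
by [].
Qed.

Lemma push_exterior s x : exterior K x -> push s x = x.
Proof.
rewrite /push; case: asboolP => // /tube_invP[Dx e].
rewrite -{1}e => /(exterior_tube Dx) h; rewrite -[RHS]e; congr (tube K _).
by rewrite /push_disk push_factor_id // !mul1r; case: (tube_inv x) => ? [].
Qed.

Lemma push_off_knot s x : ~ knot K x -> ~ knot K (push s x).
Proof.
rewrite /push; case: asboolP => // /tube_invP[Dx e].
rewrite -{1}e => nk; have w0 : (tube_inv x).2 != (0, 0).
  by apply/eqP => w0; apply: nk; apply/(knot_tube Dx).
move/(knot_tube (push_disk_D2 s Dx w0)) => /eqP; rewrite -sqnorm_eq0 /= sqnormZ.
rewrite mulf_eq0 sqrf_eq0 sqnorm_eq0 (negbTE w0) orbF.
by rewrite gt_eqF // (lt_le_trans ltr01 (push_factor_ge1 _ _)).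
Qed.

Lemma push1_exterior x : ~ knot K x -> exterior K (push 1 x).
Proof.
rewrite /push; case: asboolP => [/tube_invP[Dx e] nk|nT _]; last first.
  by move=> [u [u1 u2] ux]; apply: nT; exists u => //; split => //; apply: lt_trans u2 _; rewrite expr1n expr2; lra.
have w0 : (tube_inv x).2 != (0, 0).
  by apply/eqP => w0; apply: nk; rewrite -e; apply/(knot_tube Dx).
apply/(exterior_tube (push_disk_D2 1 Dx w0)) => /=.
rewrite sqnormZ -norm2_sqr -exprMn push_factor1 // exprn_ege1 // le_max lexx //.
Qed.

(** Two open sets cover the complement of the knot: the tube of radius 2, where push is
    read in the coordinates of the tube, and the complement of the closed tube of
    radius 1, where it is the identity. *)
Lemma push_continuous (p : R * sphere3 R) : ~ knot K p.2 ->
  {for p, continuous (fun p => push p.1 p.2)}.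
Proof.
case: p => s x /= nk.
have c2 : {for (s, x), continuous (fun p : R * sphere3 R => p.2)} by exact: cvg_snd.
have [Tx|nTx] := pselect (T2 x); last first.
  have nx : \forall y \near x, ~ (tube K @` [set u | sqnorm u.1 = 1 /\ sqnorm u.2 <= 1]) y.
    apply: open_nbhs_nbhs; split; first by apply: closed_openC; exact: tube_compact_disk.
    move=> [u [u1 u2] ux]; apply: nTx; exists u => //; split => //.
    by rewrite expr2; lra.
  have idn : \forall p \near (s, x), push p.1 p.2 = p.2.
    have : \forall p \near (s, x), ~ (tube K @` [set u | sqnorm u.1 = 1 /\ sqnorm u.2 <= 1]) p.2.
      exact: (near_preimage c2 nx).
    apply: filterS => -[s' y] /= ny; apply: push_exterior => -[u [u1 u2] uy].
    by apply: ny; exists u => //; split => //; move: u2; rewrite expr1n => /ltW.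
  move=> S; rewrite /= (nbhs_singleton idn) /= => nS.
  have h : \forall p \near (s, x), S p.2 by exact: (near_preimage c2 nS).
  by apply: filterS2 idn h => p /= ->.
have [Dx ex] := tube_invP Tx.
have w0 : (tube_inv x).2 != (0, 0).
  by apply/eqP => w0; apply: nk; rewrite -ex; apply/(knot_tube Dx).
have ci : {for (s, x), continuous (fun p : R * sphere3 R => tube_inv p.2)}.
  by apply: continuous_comp; [exact: c2 | exact: tube_inv_continuous].
have ciw : {for (s, x), continuous (fun p : R * sphere3 R => (tube_inv p.2).2)}.
  by apply: continuous_comp; [exact: ci | exact: cvg_snd].
have cN : {for (s, x), continuous (fun p : R * sphere3 R => norm2 (tube_inv p.2).2)}.
  apply: (continuous_comp (f := fun p => (tube_inv p.2).2)) => //.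
  apply: continuous_comp; [exact: sqnorm_continuous | exact: sqrt_continuous].
have cF : {for (s, x), continuous (fun p : R * sphere3 R => push_factor p.1 (tube_inv p.2).2)}.
  have cl : {for (s, x), continuous (fun p : R * sphere3 R => clamp p.1)}.
    by apply: continuous_comp; [exact: cvg_fst | exact: continuous_clamp].
  apply: cvgD; first by apply: cvgB; [exact: cvg_cst | exact: cl].
  apply: cvgM; first exact: cl.
  apply: (@continuous_max R _ (cst 1) (fun p : R * sphere3 R => (norm2 (tube_inv p.2).2)^-1)).
    exact: cvg_cst.
  by apply: cvgV; [rewrite gt_eqF // norm2_gt0 | exact: cN].
have cd : {for (s, x), continuous (fun p : R * sphere3 R => push_disk p.1 (tube_inv p.2))}.
  have h1 : {for (s, x), continuous (fun p : R * sphere3 R => (tube_inv p.2).1)}.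
    by apply: continuous_comp; [exact: ci | exact: cvg_fst].
  have h2 : {for (s, x), continuous (fun p : R * sphere3 R => (tube_inv p.2).2.1)}.
    by apply: continuous_comp; [exact: ciw | exact: cvg_fst].
  have h3 : {for (s, x), continuous (fun p : R * sphere3 R => (tube_inv p.2).2.2)}.
    by apply: continuous_comp; [exact: ciw | exact: cvg_snd].
  exact: (cvg_pair h1 (cvg_pair (cvgM cF h2) (cvgM cF h3))).
have nT2 : \forall p \near (s, x), T2 p.2.
  by apply: (near_preimage c2); apply: open_nbhs_nbhs; split; [exact: T2_open | ].
have nD : \forall p \near (s, x), D2 (push_disk p.1 (tube_inv p.2)).
  have nw : \forall p \near (s, x), (tube_inv p.2).2 != (0, 0).
    have := @norm_hausdorff R plane.
    have op : open (~` [set (0 : R, 0 : R)]).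
      by apply: closed_openC; apply: accessible_closed_set1; apply: hausdorff_accessible; exact: norm_hausdorff.
    have : nbhs (tube_inv x).2 (~` [set (0 : R, 0 : R)]) by apply: open_nbhs_nbhs; split => //; exact/eqP.
    by move=> /(near_preimage ciw); move=> h _; apply: filterS h => p /eqP.
  by apply: filterS2 nT2 nw => p /tube_invP[Dp _] wp; exact: push_disk_D2.
have ct := tube_comp_continuous cd nD.
move=> S; rewrite /= /push asboolT // => /(near_preimage ct) h.
by apply: filterS2 nT2 h => p Tp /=; rewrite asboolT.
Qed.

End Deformation.

(** * Multiplicative maps *)

Section Homomorphisms.
Variables (G H : groupType) (f : {multiplicative G -> H}).

Lemma hom1 : f 1%g = 1%g.
Proof. by apply: (mulgI (f 1%g)); rewrite -gmulfM !mulg1. Qed.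

Lemma homV g : f g^-1%g = (f g)^-1%g.
Proof. by apply: (mulgI (f g)); rewrite -gmulfM !mulgV hom1. Qed.

Lemma homX g n : f (g ^+ n)%g = (f g ^+ n)%g.
Proof. by elim: n => [|n IH]; rewrite ?expg0 ?hom1 // !expgS gmulfM IH. Qed.

End Homomorphisms.

Lemma repM (F : fieldType) (G : groupType) (rho : rep F G) g h : rho (g * h)%g = (rho g * rho h)%g.
Proof. exact: gmulfM. Qed.

(** * The knot group as the group of deck transformations *)

Section Holonomy.
Variable R : realType.
Local Notation C := R[i].
Local Notation plane := (R * R)%type.
Local Notation space := (R * R * R)%type.
Variable K : framed_knot R.
Local Notation bp := (boundary_incl (base_pt K)).

Lemma exterior_off_knot x : exterior K x -> ~ knot K x.
Proof.
move=> ex [u [u1 u2] ux]; apply: ex; exists u => //; split => //.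
by rewrite u2 sqnorm0 expr1n.
Qed.

Lemma exterior_base : exterior K (set_val bp).
Proof. exact: set_valP. Qed.

Lemma exterior_map_continuous (X : topologicalType) (g : X -> exterior K) :
  continuous (fun x => set_val (g x)) -> continuous g.
Proof. exact: continuous_comp_initial. Qed.

Definition in_ext y (h : exterior K y) : exterior K := exist (fun x => x \in exterior K) y (mem_set h).

Lemma exterior_loop (y : exterior K) (g : R -> sphere3 R) : continuous g ->
  (forall t, exterior K (g t)) ->
  (forall t, t <= 0 -> g t = set_val y) -> (forall t, 1 <= t -> g t = set_val y) ->
  exists l : loop R (exterior K) y, forall t, set_val (l t) = g t.
Proof.
move=> cg eg g0 g1.
have c : continuous (fun t => in_ext (eg t)) by exact: exterior_map_continuous.
have h0 t : t <= 0 -> in_ext (eg t) = y by move=> t0; apply: val_inj; exact: g0.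
have h1 t : 1 <= t -> in_ext (eg t) = y by move=> t1; apply: val_inj; exact: g1.
by exists (Loop c h0 h1).
Qed.

Lemma push_comp_continuous (X : topologicalType) (s : X -> R) (k : X -> sphere3 R) :
  continuous s -> continuous k -> (forall x, ~ knot K (k x)) ->
  continuous (fun x => push K (s x) (k x)).
Proof.
move=> cs ck nk x.
apply: (@continuous_comp _ _ _ (fun x => (s x, k x)) (fun p => push K p.1 p.2)).
  exact: continuous_pair.
by apply: push_continuous; exact: nk.
Qed.

(** The geometric content of a discrete faithful representation, with the lift u0 of
    the base point fixed once and for all. *)
Definition based_holonomy (P : space -> sphere3 R) (rho0 : rep C (pi1_exterior K))
    (u0 : space) : Prop :=
  [/\ hyperbolic_structure K P, forall g, deck P (rho0 g), H3 u0, P u0 = set_val bp &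
    forall l : loop R (exterior K) bp,
      exists L : R -> space, [/\ continuous L, forall t, H3 (L t),
        forall t, P (L t) = set_val (l t), L 0 = u0 & L 1 = poincare (rho0 (pi1_class l)) u0]].

Lemma discrete_faithful_based P rho0 : hyperbolic_structure K P ->
  discrete_faithful_rep P rho0 -> exists u0, based_holonomy P rho0 u0.
Proof. by move=> hP [_ _ dk [u0 [? ? ?]]]; exists u0. Qed.

Variables (P : space -> sphere3 R) (rho0 : rep C (pi1_exterior K)) (u0 : space).
Hypothesis hol : based_holonomy P rho0 u0.

Let hP : hyperbolic_structure K P. Proof. by case: hol. Qed.
Let rho0_deck g : deck P (rho0 g). Proof. by case: hol. Qed.
Let hu0 : H3 u0. Proof. by case: hol. Qed.
Let Pu0 : P u0 = set_val bp. Proof. by case: hol. Qed.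
Let hlift (l : loop R (exterior K) bp) : exists L : R -> space,
  [/\ continuous L, forall t, H3 (L t), forall t, P (L t) = set_val (l t), L 0 = u0
    & L 1 = poincare (rho0 (pi1_class l)) u0].
Proof. by case: hol. Qed.

Definition hact (g : pi1_exterior K) (u : space) : space := poincare (rho0 g) u.

Lemma hact_H3 g u : H3 u -> H3 (hact g u).
Proof. exact: poincare_H3. Qed.

Lemma P_hact g u : H3 u -> P (hact g u) = P u.
Proof. exact: rho0_deck. Qed.

Lemma hact1 u : hact 1%g u = u.
Proof. by rewrite /hact hom1 poincare1. Qed.

Lemma hactM g h u : H3 u -> hact (g * h)%g u = hact g (hact h u).
Proof. by move=> hu; rewrite /hact repM poincareM. Qed.

Lemma hactK g u : H3 u -> hact (g^-1)%g (hact g u) = u.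
Proof. by move=> hu; rewrite -hactM // mulVg hact1. Qed.

Lemma hactVK g u : H3 u -> hact g (hact (g^-1)%g u) = u.
Proof. by move=> hu; rewrite -hactM // mulgV hact1. Qed.

Lemma hact_continuous g u : H3 u -> {for u, continuous (hact g)}.
Proof. exact: continuous_poincare. Qed.

Lemma clamp01 (t : R) : 0 <= clamp t <= 1.
Proof. by rewrite clamp_ge0 clamp_le1. Qed.

Lemma P_comp_continuous (X : topologicalType) (L : X -> space) :
  continuous L -> (forall x, H3 (L x)) -> continuous (fun x => P (L x)).
Proof.
move=> cL hL x; apply: continuous_comp; [exact: cL | exact: (P_continuous hP)].
Qed.

(** The segment from u0 to A u0 projects to a loop in the complement of the knot; pushed
    into the exterior it becomes a loop whose class is the required g. The lift of the
    push is constant along the two edges that stay over the base point. *)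
Lemma deck_orbit (A : SL2 C) : deck P A -> exists g, poincare A u0 = hact g u0.
Proof.
move=> dA; pose v := poincare A u0; have hv : H3 v by exact: poincare_H3.
have Pv : P v = set_val bp by rewrite dA.
pose D (t : R) := hline u0 v (clamp t).
have cD : continuous D.
  by apply: hline_continuous; [exact: cst_continuous|exact: cst_continuous|exact: continuous_clamp].
have hD t : H3 (D t) by apply: hline_H3 => //; exact: clamp01.
have PDoff t : ~ knot K (P (D t)) by apply/(P_image hP); exists (D t).
have PD0 t : t <= 0 -> P (D t) = set_val bp by move=> t0; rewrite /D clamp0 // hline0.
have PD1 t : 1 <= t -> P (D t) = set_val bp by move=> t1; rewrite /D clamp1 // hline1.
have cPD : continuous (fun t => P (D t)) by exact: P_comp_continuous.
have pb : forall s, push K s (set_val bp) = set_val bp.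
  by move=> s; apply: push_exterior; exact: exterior_base.
have [||||l lE] := @exterior_loop bp (fun t => push K 1 (P (D t))).
- by apply: push_comp_continuous => //; exact: cst_continuous.
- by move=> t; exact: push1_exterior.
- by move=> t t0; rewrite PD0.
- by move=> t t1; rewrite PD1.
pose k (p : plane) := push K p.1 (P (D p.2)).
have ck : continuous k.
  apply: push_comp_continuous => //; first exact: continuous_fst.
  by apply: continuous_compose cPD; exact: continuous_snd.
have k_off p : ~ knot K (k p) by exact: push_off_knot.
have [M [cM hM PM M0]] : exists M : plane -> space, [/\ continuous M, forall x, H3 (M x),
    forall x, P (M x) = k x & M (0, 0) = u0].
  by apply: (lift_exists hP) => //; rewrite /k /= push0 PD0.
have cs (X : topologicalType) (f : X -> plane) : continuous f -> continuous (fun x => M (f x)).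
  by move=> cf; apply: continuous_compose cM.
have pl (a : R) : continuous (fun t : R => (a, t)).
  by apply: continuous_pair; [exact: cst_continuous|move=> ?; exact: cvg_id].
have pr (a : R) : continuous (fun t : R => (t, a)).
  by apply: continuous_pair; [move=> ?; exact: cvg_id|exact: cst_continuous].
have left_edge t : M (0, t) = D t.
  apply: (@path_lift_unique _ _ _ hP (fun t => M (0, t)) D 0 t) => //; first exact: cs.
    by move=> s; rewrite PM /k /= push0.
  by rewrite M0 /D clamp0 // hline0.
have bot_edge s : M (s, 0) = u0.
  apply: (@path_lift_unique _ _ _ hP (fun s => M (s, 0)) (cst u0) 0 s) => //; first exact: cs.
    exact: cst_continuous.
  by move=> r; rewrite PM /k /= PD0 // pb Pu0.
have top_edge s : M (s, 1) = v.
  apply: (@path_lift_unique _ _ _ hP (fun s => M (s, 1)) (cst v) 0 s) => //; first exact: cs.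
  - exact: cst_continuous.
  - by move=> r; rewrite PM /k /= PD1 // pb Pv.
  - by rewrite left_edge /D clamp1 // hline1.
have [L [cL hL PL L0 L1]] := hlift l.
exists (pi1_class l); rewrite /hact -L1 -[LHS](top_edge 1).
apply: (@path_lift_unique _ _ _ hP (fun t => M (1, t)) L 0 1) => //; first exact: cs.
- by move=> t; rewrite PM PL lE.
- by rewrite bot_edge L0.
Qed.

(** A deck transformation that agrees with one of the holonomy group at u0 agrees with
    it everywhere, by freeness. *)
Lemma hact_transitive u v : H3 u -> H3 v -> P u = P v -> exists g, v = hact g u.
Proof.
move=> hu hv Puv; have [_ _ _ hdeck _] := hP.
have [A dA ->] := hdeck u v hu hv Puv.
have [g gE] := deck_orbit dA; exists g.
have dB : deck P ((rho0 g)^-1 * A)%g.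
  by apply: deckM => //; apply: deckV.
have fixB : poincare ((rho0 g)^-1 * A)%g u0 = u0.
  by rewrite poincareM // gE poincareK.
have := deck_free hP dB hu0 fixB hu; rewrite poincareM // => e.
by rewrite /hact -[in RHS]e poincareVK //; exact: poincare_H3.
Qed.

Lemma lift_clamp (l : loop R (exterior K) bp) (L : R -> space) t : continuous L ->
  (forall t, H3 (L t)) -> (forall t, P (L t) = set_val (l t)) -> L t = L (clamp t).
Proof.
move=> cL hL PL.
apply: (@path_lift_unique _ _ _ hP L (fun t => L (clamp t)) 0 t) => //.
- by apply: continuous_compose cL; exact: continuous_clamp.
- move=> s; rewrite !PL; have [s0|s0] := leP s 0.
    by rewrite clamp0 // !loop_le0.
  have [s1|s1] := leP 1 s; first by rewrite clamp1 // !loop_ge1.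
  by rewrite /clamp min_l ?max_r // ltW.
- by rewrite clamp0.
Qed.

(** A closed lift contracts to u0 along straight segments of half-space; the projection
    of this contraction, pushed into the exterior, is a homotopy there. *)
Lemma closed_lift_trivial (l : loop R (exterior K) bp) (L : R -> space) : continuous L ->
  (forall t, H3 (L t)) -> (forall t, P (L t) = set_val (l t)) -> L 0 = u0 -> L 1 = u0 ->
  pi1_class l = 1%g.
Proof.
move=> cL hL PL L0 L1; apply/pi1_classP.
pose h (p : plane) := hline (L p.2) u0 (clamp p.1).
have ch : continuous h.
  apply: hline_continuous; [|exact: cst_continuous|].
  - by apply: continuous_compose cL; exact: continuous_snd.
  - by apply: continuous_compose (@continuous_clamp R); exact: continuous_fst.
have hh p : H3 (h p) by apply: hline_H3 => //; exact: clamp01.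
have hoff p : ~ knot K (P (h p)) by apply/(P_image hP); exists (h p).
have cPh : continuous (fun p => push K 1 (P (h p))).
  by apply: push_comp_continuous => //; [exact: cst_continuous|exact: P_comp_continuous].
have eh p : exterior K (push K 1 (P (h p))) by exact: push1_exterior.
have pid (y : exterior K) : push K 1 (set_val y) = set_val y.
  by apply: push_exterior; exact: set_valP.
exists (fun p => in_ext (eh p)); split => [|t|t|s t ht].
- exact: exterior_map_continuous.
- by apply: val_inj; rewrite /= /h /= clamp0 // hline0 PL pid.
- by apply: val_inj; rewrite /= /h /= clamp1 // hline1 Pu0 pid.
- apply: val_inj => /=; rewrite /h /=.
  have -> : L t = u0.
    by rewrite (lift_clamp t cL hL PL); case: ht => ht; [rewrite clamp0 | rewrite clamp1].
  have -> : hline u0 u0 (clamp s) = u0.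
    by rewrite /hline !subrr !mulr0 !addr0; case: (u0) => -[].
  by rewrite Pu0 pid.
Qed.

(** An element with a fixed point fixes u0, so the lifts of its loops are closed. *)
Lemma hact_free g u : H3 u -> hact g u = u -> g = 1%g.
Proof.
move=> hu gu; have gu0 := deck_free hP (rho0_deck g) hu gu hu0.
rewrite -[g]pi1_reprK; have [L [cL hL PL L0 L1]] := hlift (pi1_repr g).
apply: (@closed_lift_trivial _ L) => //.
by rewrite L1 pi1_reprK.
Qed.

Lemma hact_inj g h u : H3 u -> hact g u = hact h u -> g = h.
Proof.
move=> hu e; suff : (h^-1 * g)%g = 1%g by move/(congr1 (fun z => (h * z)%g)); rewrite mulVKg mulg1.
by apply: (@hact_free _ u) => //; rewrite hactM // e hactK.
Qed.

Lemma loop_lift_end (l : loop R (exterior K) bp) (L : R -> space) : continuous L ->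
  (forall t, H3 (L t)) -> (forall t, P (L t) = set_val (l t)) -> L 0 = u0 ->
  L 1 = hact (pi1_class l) u0.
Proof.
move=> cL hL PL L0; have [M [cM hM PM M0 M1]] := hlift l.
rewrite /hact -M1.
apply: (@path_lift_unique _ _ _ hP L M 0 1) => //; last by rewrite L0.
by move=> t; rewrite PL PM.
Qed.

End Holonomy.

(** * The peripheral subgroup *)

Section Peripheral.
Variable R : realType.
Local Notation C := R[i].
Local Notation plane := (R * R)%type.
Local Notation space := (R * R * R)%type.

Lemma turnDn (a : R) (n : nat) : turn (a + n%:R) = turn a.
Proof.
elim: n => [|n IH]; first by rewrite addr0.
rewrite -IH -natr1 addrA /turn.
have -> : 2 * pi * (a + n%:R + 1) = 2 * pi * (a + n%:R) + pi *+ 2 :> R by rewrite -mulr_natl; ring.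
by rewrite cosD2pi sinD2pi.
Qed.

Lemma turnDz (a : R) (n : int) : turn (a + n%:~R) = turn a.
Proof.
case: n => n; first exact: turnDn.
by rewrite NegzE mulrNz -[in RHS](subrK (n.+1%:R) a) turnDn.
Qed.

Variable K : framed_knot R.
Local Notation bp := (boundary_incl (base_pt K)).
Variables (P : space -> sphere3 R) (rho0 : rep C (pi1_exterior K)) (u0 : space).
Hypothesis hol : based_holonomy P rho0 u0.

(** A lift T of the boundary torus to the plane of angles. The first coordinate is the
    angle along the knot, so that c n m is the class of lambda^n mu^m, with the
    longitude before the meridian. *)
Definition peripheral_lift (T : plane -> space) (c : int -> int -> pi1_exterior K) : Prop :=
  [/\ continuous T, forall p, H3 (T p), forall p, P (T p) = tube K (turn p.1, turn p.2),
    T (0, 0) = u0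
    & forall n m a b, T (a + n%:~R, b + m%:~R) = hact rho0 (c n m) (T (a, b))].

Lemma torus_map_continuous : continuous (fun p : plane => tube K (turn p.1, turn p.2)).
Proof.
move=> p; apply: tube_comp_continuous.
  by apply: continuous_pair; apply: continuous_compose (@continuous_turn R);
    [exact: continuous_fst|exact: continuous_snd].
by apply: (@filterS _ (nbhs p) _ setT) => [? _|]; [exact: circle_disk_turn|exact: filterT].
Qed.

Lemma torus_off_knot a b : ~ knot K (tube K (turn a, turn b)).
Proof. by apply: exterior_off_knot; have := exterior_turn K a b; rewrite inE. Qed.

Lemma peripheral_lift_exists : exists T c, peripheral_lift T c.
Proof.
have [hP dk hu0 Pu0 hl] := hol.
have [T [cT hT PT T0]] : exists T : plane -> space, [/\ continuous T, forall x, H3 (T x),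
    forall p, P (T p) = tube K (turn p.1, turn p.2) & T (0, 0) = u0].
  apply: (lift_exists hP) => //; first exact: torus_map_continuous.
  by move=> p; exact: torus_off_knot.
have [c hc] : {c : int * int -> pi1_exterior K &
    forall nm, T (nm.1%:~R, nm.2%:~R) = hact rho0 (c nm) u0}.
  apply: (choice (P := fun nm c => T (nm.1%:~R, nm.2%:~R) = hact rho0 c u0)) => -[n m] /=.
  apply: (hact_transitive hol) => //; rewrite PT Pu0 /=.
  by rewrite -[n%:~R]add0r -[m%:~R]add0r !turnDz.
exists T, (fun n m => c (n, m)); split => // n m a b.
apply: (@lift_unique _ _ _ hP (fun p => T (p.1 + n%:~R, p.2 + m%:~R))
  (fun p => hact rho0 (c (n, m)) (T p)) (0, 0) (a, b)).
- apply: continuous_compose cT; apply: continuous_pair => x; apply: cvgD; try exact: cvg_cst.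
    exact: cvg_fst.
  exact: cvg_snd.
- by move=> x; apply: continuous_comp; [exact: cT|exact: hact_continuous].
- by move=> x; exact: hT.
- by move=> x; rewrite PT (P_hact hol) // PT /= !turnDz.
- by rewrite /= !add0r T0; exact: (hc (n, m)).
Qed.

Variables (T : plane -> space) (c : int -> int -> pi1_exterior K).
Hypothesis hT : peripheral_lift T c.

Lemma peripheralM n m n' m' : c (n + n') (m + m') = (c n m * c n' m')%g.
Proof.
have [cT HT PT T0 Tc] := hT; have [_ _ hu0 _ _] := hol.
have e1 : T (0 + (n + n')%:~R, 0 + (m + m')%:~R) = hact rho0 (c (n + n') (m + m')) u0.
  by rewrite Tc T0.
have e2 : T (0 + n'%:~R + n%:~R, 0 + m'%:~R + m%:~R) =
    hact rho0 (c n m) (hact rho0 (c n' m') u0) by rewrite !Tc T0.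
apply: (hact_inj hol hu0); rewrite hactM // -e1 -e2.
have -> : 0 + (n + n')%:~R = 0 + n'%:~R + n%:~R :> R by rewrite intrD [n%:~R + _]addrC addrA.
by have -> : 0 + (m + m')%:~R = 0 + m'%:~R + m%:~R :> R by rewrite intrD [m%:~R + _]addrC addrA.
Qed.

Lemma peripheral_loop (l : loop R (exterior K) bp) (n m : int) (f g : R -> R) :
  continuous f -> continuous g -> f 0 = 0 -> g 0 = 0 -> f 1 = n%:~R -> g 1 = m%:~R ->
  (forall t, set_val (l t) = tube K (turn (f t), turn (g t))) ->
  pi1_class l = c n m.
Proof.
move=> cf cg f0 g0 f1 g1 lE.
have [cT HT PT T0 Tc] := hT; have [_ _ hu0 _ _] := hol.
apply: (hact_inj hol hu0); rewrite -(loop_lift_end hol (L := fun t => T (f t, g t))).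
- by rewrite f1 g1 -[n%:~R]add0r -[m%:~R]add0r Tc T0.
- by apply: continuous_compose cT; exact: continuous_pair.
- by move=> t; exact: HT.
- by move=> t; rewrite PT lE.
- by rewrite f0 g0.
Qed.

Lemma peripheral_meridian : pi1_incl K (meridian K) = c 0 1.
Proof.
rewrite /meridian /pi1_incl /= pi1_map_class.
apply: (@peripheral_loop _ 0 1 (cst 0) (@clamp R)) => //.
- exact: cst_continuous.
- exact: continuous_clamp.
- by rewrite clamp0.
- by rewrite clamp1.
- by move=> t; rewrite loop_mapE.
Qed.

Lemma peripheral_longitude : pi1_incl K (longitude K) = c 1 0.
Proof.
rewrite /longitude /pi1_incl /= pi1_map_class.
apply: (@peripheral_loop _ 1 0 (@clamp R) (cst 0)) => //.
- exact: continuous_clamp.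
- exact: cst_continuous.
- by rewrite clamp0.
- by rewrite clamp1.
- by move=> t; rewrite loop_mapE.
Qed.

End Peripheral.

(** * Finite generation of the knot group *)

Lemma compact_seq_cover (X : topologicalType) (I : eqType) (A : set X) (O : I -> set X) :
  compact A -> (forall x, A x -> exists i, nbhs x (O i)) ->
  exists s : seq I, forall x, A x -> exists2 i, i \in s & O i x.
Proof.
move=> /compact_near_coveringP cA cov.
pose F : set_system (seq I) := [set B : set (seq I) | exists s0 : seq I, forall s : seq I, {subset s0 <= s} -> B s].
have FF : Filter F.
  split; first by exists [::].
  - move=> B1 B2 [s1 h1] [s2 h2]; exists (s1 ++ s2) => s ss.
    by split; [apply: h1|apply: h2] => i i1; apply: ss; rewrite mem_cat i1 ?orbT.
  - by move=> B1 B2 B12 [s1 h1]; exists s1 => s /h1/B12.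
have := cA _ F (fun s x => exists2 i, i \in s & O i x) FF.
case=> [x Ax|s0 h]; last by exists s0; apply: h.
have [i nO] := cov x Ax.
exists (O i, [set s : seq I | i \in s]) => /=.
  by split => //; exists [:: i] => s; apply; rewrite inE.
by move=> [y s] /= [Oy si]; exists i.
Qed.

Section FiniteGeneration.
Variable R : realType.
Local Notation C := R[i].
Local Notation space := (R * R * R)%type.
Variable K : framed_knot R.
Local Notation bp := (boundary_incl (base_pt K)).
Variables (P : space -> sphere3 R) (rho0 : rep C (pi1_exterior K)) (u0 : space).
Hypothesis hol : based_holonomy P rho0 u0.
Local Notation "g # u" := (hact rho0 g u) (at level 30, right associativity).

Let hP : hyperbolic_structure K P. Proof. by case: hol. Qed.
Let hu0 : H3 u0. Proof. by case: hol. Qed.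

Definition closed_box (u : space) : set space :=
  (`[u.1.1 - 1, u.1.1 + 1] `*` `[u.1.2 - 1, u.1.2 + 1]) `*` `[u.2 / 2, u.2 + 1].

Lemma closed_box_compact u : compact (closed_box u).
Proof.
by apply: compact_setX; [apply: compact_setX|]; exact: segment_compact.
Qed.

Lemma closed_box_H3 u : H3 u -> closed_box u `<=` @H3 R.
Proof.
rewrite /H3 /= => hu v [_]; rewrite /= in_itv /= => /andP[h _].
by apply: lt_le_trans h; rewrite divr_gt0.
Qed.

Lemma closed_box_nbhs u : H3 u -> nbhs u (closed_box u).
Proof.
rewrite /H3 /= => hu.
have c1 : continuous (fun u : space => u.1.1).
  by apply: continuous_compose; [exact: continuous_fst|exact: continuous_fst].
have c2 : continuous (fun u : space => u.1.2).
  by apply: continuous_compose; [exact: continuous_fst|exact: continuous_snd].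
have c3 : continuous (fun u : space => u.2) by exact: continuous_snd.
have n (x a b : R) : a < x -> x < b -> nbhs x `[a, b]%classic.
  move=> ax xb; apply: (@filterS _ _ _ `]a, b[%classic).
    by move=> y /=; rewrite !in_itv /= => /andP[/ltW -> /ltW ->].
  by apply: open_nbhs_nbhs; split; [exact: interval_open|rewrite /= in_itv /= ax].
have h1 : \forall v \near u, `[u.1.1 - 1, u.1.1 + 1]%classic v.1.1.
  by apply: (near_preimage (c1 u)); apply: n; lra.
have h2 : \forall v \near u, `[u.1.2 - 1, u.1.2 + 1]%classic v.1.2.
  by apply: (near_preimage (c2 u)); apply: n; lra.
have h3 : \forall v \near u, `[u.2 / 2, u.2 + 1]%classic v.2.
  by apply: (near_preimage (c3 u)); apply: n; lra.
by apply: filterS3 h1 h2 h3 => v ? ? ?; split => //; split.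
Qed.

(** Proper discontinuity, in local form. If P x and P y differ, no g carries a point near
    x to a point near y; otherwise the injectivity of P near y leaves at most one g. *)
Lemma return_element_near x y : H3 x -> H3 y -> exists W : set (space * space),
  nbhs (x, y) W /\ forall g h p q, W p -> W q -> p.2 = g # p.1 -> q.2 = h # q.1 -> g = h.
Proof.
move=> hx hy.
have c1 : {for (x, y), continuous (fun p : space * space => p.1)} by exact: cvg_fst.
have c2 : {for (x, y), continuous (fun p : space * space => p.2)} by exact: cvg_snd.
have n1 : \forall p \near (x, y), H3 p.1 by apply: (near_preimage c1); exact: H3_near.
have [e|ne] := pselect (P x = P y); last first.
  have c1' : {for (x, y), continuous (fun p : space * space => P p.1)}.
    by apply: continuous_comp; [exact: c1|exact: (P_continuous hP)].
  have c2' : {for (x, y), continuous (fun p : space * space => P p.2)}.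
    by apply: continuous_comp; [exact: c2|exact: (P_continuous hP)].
  exists [set p | H3 p.1 /\ P p.1 <> P p.2]; split.
    exact: filterI n1 (near_neq (@sphere3_hausdorff R) c1' c2' ne).
  by move=> g h p q [hp np] _ e; case: np; rewrite e (P_hact hol).
have [g0 yE] := hact_transitive hol hx hy e.
have [U [oU Uy UH iU]] := P_inj_near hP hy.
have nU : nbhs y U by exact: open_nbhs_nbhs.
have n2 : \forall p \near (x, y), U p.2 by exact: (near_preimage c2).
have n3 : \forall p \near (x, y), U (g0 # p.1).
  apply: (near_preimage (g := fun p : space * space => g0 # p.1)); last by rewrite /= -yE.
  by apply: continuous_comp; [exact: c1|exact: hact_continuous].
exists [set p | [/\ H3 p.1, U p.2 & U (g0 # p.1)]]; split.
  by apply: filterS3 n1 n2 n3.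
suff key g p : H3 p.1 -> U p.2 -> U (g0 # p.1) -> p.2 = g # p.1 -> g = g0.
  by move=> g h p q [? ? ?] [? ? ?] eg eh; rewrite (key g p) // (key h q).
move=> hp Up2 Up1 e2; apply: (hact_inj hol hp); rewrite -e2.
by apply: iU => //; rewrite e2 !(P_hact hol).
Qed.

Lemma finite_returns (A : set space) : compact A -> A `<=` @H3 R ->
  exists S : seq (pi1_exterior K), forall g x, A x -> A (g # x) -> g \in S.
Proof.
move=> cA AH.
have [W hW] : {W : space * space -> set (space * space) & forall p, H3 p.1 -> H3 p.2 ->
    nbhs p (W p) /\ forall g h a b, W p a -> W p b -> a.2 = g # a.1 -> b.2 = h # b.1 -> g = h}.
  apply: (choice (P := fun p W => H3 p.1 -> H3 p.2 ->
    nbhs p W /\ forall g h a b, W a -> W b -> a.2 = g # a.1 -> b.2 = h # b.1 -> g = h)).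
  move=> [x y] /=; have [hx|nx] := pselect (H3 x); last by exists setT => /nx.
  have [hy|ny] := pselect (H3 y); last by exists setT => _ /ny.
  by have [W hW] := return_element_near hx hy; exists W.
have [s hs] : exists s : seq (space * space), forall p, (A `*` A) p ->
    exists2 i, i \in s & (W i `&` [set q | H3 i.1 /\ H3 i.2]) p.
  apply: (@compact_seq_cover _ _ (A `*` A)
    (fun i => W i `&` [set q | H3 i.1 /\ H3 i.2]) (compact_setX cA cA)).
  move=> p [/= /AH h1 /AH h2]; exists p.
  by have [nW _] := hW p h1 h2; apply: filterS nW => q Wq; split.
pose G p := xget 1%g [set g | exists2 a, W p a & a.2 = g # a.1].
exists (map G s) => g x Ax Agx.
have [i si [Wi [h1 h2]]] := hs (x, g # x) (conj Ax Agx).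
apply/mapP; exists i => //; have [_ uW] := hW i h1 h2.
have [b Wb bE] : [set g | exists2 a, W i a & a.2 = g # a.1] (G i).
  by apply: xgetPex; exists g, (x, g # x).
exact: uW Wi Wb _ bE.
Qed.

(** A finite union A of boxes in half-space maps onto the compact exterior, and the
    finitely many g for which g A meets A generate. Indeed the lift of a loop runs
    through translates of A; consecutive ones differ by a generator, so whether their
    translating elements lie in the generated subgroup is a locally constant
    property of the parameter. *)
Theorem pi1_exterior_finitely_generated : exists S : seq (pi1_exterior K),
  forall Q : pi1_exterior K -> Prop, Q 1%g ->
    (forall g h, Q g -> Q h -> Q (g * h)%g) -> (forall g, Q g -> Q (g^-1)%g) ->
    (forall g, g \in S -> Q g) -> forall g, Q g.
Proof.
pose O (u : space) : set space := (closed_box u)^°.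
have [s' hs'] : exists s : seq space, forall x, exterior K x ->
    exists2 u, u \in s & [set y | H3 u /\ exists2 v, O u v & P v = y] x.
  apply: (@compact_seq_cover _ _ (exterior K)
    (fun u => [set y | H3 u /\ exists2 v, O u v & P v = y]) (@exterior_compact _ K)).
  move=> x ex; have /(P_image hP)[u hu <-] := exterior_off_knot ex.
  exists u; have nO : nbhs u (O u).
    by apply: open_nbhs_nbhs; split; [exact: open_interior | exact: closed_box_nbhs].
  by apply: filterS (P_near hP hu nO) => y [v [Ov _] <-]; split => //; exists v.
pose s := u0 :: [seq u <- s' | `[< H3 u >]].
have sH u : u \in s -> H3 u.
  by rewrite inE mem_filter => /orP[/eqP -> //|/andP[/asboolP]].
pose A := [set v | exists2 u, u \in s & closed_box u v].
have cA : compact A.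
  rewrite /A; elim: (s) => [|u t IH].
    have -> : [set v : space | exists2 u, u \in [::] & closed_box u v] = set0.
      by apply/seteqP; split => // v [].
    exact: compact0.
  have -> : [set v : space | exists2 w, w \in u :: t & closed_box w v] =
      closed_box u `|` [set v | exists2 u, u \in t & closed_box u v].
    apply/seteqP; split => v /=.
      by move=> [w]; rewrite inE => /orP[/eqP -> ?|wt ?]; [left|right; exists w].
    by case=> [?|[w wt ?]]; [exists u => //; exact: mem_head|exists w => //; rewrite inE wt orbT].
  by apply: compactU => //; exact: closed_box_compact.
have AH : A `<=` @H3 R by move=> v [u /sH hu]; exact: closed_box_H3.
have [S hS] := finite_returns cA AH; exists S => Q Q1 QM QV QS g.
have gen g' x : A x -> A (g' # x) -> Q g' by move=> Ax Ag; apply: QS; exact: hS Ax Ag.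
have QVM h g' : Q h -> Q (g'^-1 * h)%g -> Q g'.
  by move=> Qh Qgh; have := QM _ _ Qh (QV _ Qgh); rewrite invgM invgK mulVKg.
have QVM' h g' : Q g' -> Q (g'^-1 * h)%g -> Q h.
  by move=> Qg Qgh; have := QM _ _ Qg Qgh; rewrite mulVKg.
rewrite -[g]pi1_reprK; have [_ _ _ _ /(_ (pi1_repr g))[L [cL hL PL L0 L1]]] := hol.
move: L1; rewrite -/(hact rho0 _ u0); set g' := pi1_class _ => L1.
pose B := [set v | exists2 u, u \in s & O u v].
have BA : B `<=` A by move=> v [u us Ov]; exists u => //; exact: nbhs_singleton Ov.
have B0 : B u0 by exists u0; [exact: mem_head|exact: closed_box_nbhs].
have B_near v : B v -> nbhs v B.
  move=> [u us Ov]; apply: (@filterS _ _ _ (O u)); first by move=> w Ow; exists u.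
  by apply: open_nbhs_nbhs; split => //; exact: open_interior.
(* T t: L t lies in a translate of B by an element of the generated subgroup. *)
pose T t := exists2 h, Q h & exists2 c, B c & L t = h # c.
have T0 : T 0 by exists 1%g => //; exists u0 => //; rewrite hact1.
suff [h Qh [c Bc e]] : T 1.
  apply: (QVM' _ h) => //; apply: (gen _ u0); first exact: BA.
  rewrite hactM // -L1 e hactK; last exact: AH (BA _ Bc).
  exact: BA.
suff : T 0 <-> T 1 by case=> h _; exact: h.
apply: (@locally_constant_itv R T 0 1 ler01) => t _.
have [c Bc [k Lt]] : exists2 c, B c & exists k, L t = k # c.
  have [|u us' [hu [v Ov Pv]]] := hs' (P (L t)); first by rewrite PL; exact: set_valP.
  have us : u \in s by rewrite inE mem_filter us' andbT; apply/orP; right; apply/asboolP.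
  have Bv : B v by exists u.
  exists v => //.
  by apply: (hact_transitive hol) => //; exact: AH (BA _ Bv).
have cgL : {for t, continuous (fun r => (k^-1)%g # L r)}.
  by apply: continuous_comp; [exact: cL|exact: hact_continuous].
have : \forall r \near t, B ((k^-1)%g # L r).
  by apply: (near_preimage cgL); rewrite Lt hactK; [exact: B_near|exact: AH (BA _ Bc)].
apply: filterS => r Br _; set c' := (k^-1)%g # L r in Br.
have Lr : L r = k # c' by rewrite /c' hactVK.
have hB v : B v -> H3 v by move=> /BA/AH.
have swap h c1 d r' : B c1 -> B d -> L r' = h # c1 -> L r' = k # d -> Q (k^-1 * h)%g.
  move=> Bc1 Bd e1 e2; apply: (gen _ c1); first exact: BA.
  by rewrite hactM; [rewrite -e1 e2 hactK; [exact: BA|exact: hB]|exact: hB].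
split=> -[h Qh [d Bd e]]; exists k.
- exact: QVM Qh (swap _ _ _ _ Bd Br e Lr).
- by exists c.
- exact: QVM Qh (swap _ _ _ _ Bd Bc e Lt).
- by exists c'.
Qed.

End FiniteGeneration.

(** * Measures with a density *)

Section Density.
Local Open Scope ereal_scope.
Context d (T : measurableType d) (R : realType).
Variables (mu : {measure set T -> \bar R}) (h : T -> R).
Hypotheses (mh : measurable_fun setT h) (h0 : forall x, (0 <= h x)%R).

Definition density_measure of measurable_fun setT h & (forall x, (0 <= h x)%R) :
  set T -> \bar R := fun A => \int[mu]_(x in A) (h x)%:E.

Local Notation nu := (density_measure mh h0).

Let density0 : nu set0 = 0.
Proof. exact: integral_set0. Qed.

Let density_ge0 A : 0 <= nu A.
Proof. by apply: integral_ge0 => x _; rewrite lee_fin. Qed.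

Let density_sigma_additive : semi_sigma_additive nu.
Proof.
move=> /= A mA tA mUA; rewrite /density_measure ge0_integral_bigcup//=.
- apply: is_cvg_ereal_nneg_natsum_cond => n _ _.
  by apply: integral_ge0 => x _; rewrite lee_fin.
- by apply/measurable_EFinP; exact: measurable_funTS.
- by move=> x _; rewrite lee_fin.
Qed.

HB.instance Definition _ := isMeasure.Build _ _ _ nu
  density0 density_ge0 density_sigma_additive.

Import HBNNSimple.

(** Monotone convergence reduces the identity to indicators of measurable sets, where
    it is the definition of the density. *)
Lemma ge0_integral_density (f : T -> \bar R) : measurable_fun setT f ->
  (forall x, 0 <= f x) -> \int[nu]_x f x = \int[mu]_x (f x * (h x)%:E).
Proof.
move=> mf f0; pose f_ := nnsfun_approx measurableT mf.
have mEh : measurable_fun setT (EFin \o h) by exact/measurable_EFinP.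
transitivity (limn (fun n => \int[nu]_x (f_ n x)%:E)).
  rewrite -monotone_convergence//.
  - by apply: eq_integral => x _; apply/esym/cvg_lim => //; apply: cvg_nnsfun_approx.
  - by move=> n; exact/measurable_EFinP/measurable_funP.
  - by move=> n x _; rewrite lee_fin.
  - by move=> x _ m n mn; rewrite lee_fin; exact/lefP/nd_nnsfun_approx.
transitivity (limn (fun n => \int[mu]_x ((f_ n x)%:E * (h x)%:E))); last first.
  rewrite -monotone_convergence//.
  - apply: eq_integral => x _; apply/cvg_lim => //; apply: cvgeZr => //.
    by apply: cvg_nnsfun_approx.
  - by move=> n; apply: emeasurable_funM => //; exact/measurable_EFinP/measurable_funP.
  - by move=> n x _; rewrite -EFinM lee_fin mulr_ge0.
  - move=> x _ m n mn; rewrite -!EFinM lee_fin ler_wpM2r //.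
    exact/lefP/nd_nnsfun_approx.
congr (limn _); apply/funext => n.
have mI k : measurable (f_ n @^-1` [set k]) by [].
transitivity (\sum_(k \in range (f_ n)) \int[nu]_x (k * \1_(f_ n @^-1` [set k]) x)%:E).
  rewrite -ge0_integral_fsum//.
  - by apply: eq_integral => x _; rewrite fsumEFin// -fimfunE.
  - by move=> r; exact/measurable_EFinP/measurable_funM.
  - by move=> r x _; rewrite nnfun_muleindic_ge0.
transitivity (\sum_(k \in range (f_ n))
    \int[mu]_x ((k * \1_(f_ n @^-1` [set k]) x)%:E * (h x)%:E)); last first.
  rewrite -ge0_integral_fsum//.
  - apply: eq_integral => x _; rewrite [in RHS]fimfunE -fsumEFin//.
    by rewrite ge0_mule_fsuml// => r; rewrite nnfun_muleindic_ge0.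
  - by move=> r; apply: emeasurable_funM => //; exact/measurable_EFinP/measurable_funM.
  - by move=> r x _; rewrite mule_ge0 ?lee_fin // -lee_fin nnfun_muleindic_ge0.
apply: eq_fsbigr => r /set_mem[x _ rx].
have r0 : (0 <= r)%R by rewrite -rx.
rewrite integralZl_indic_nnsfun// integral_indic//= setIT.
transitivity (\int[mu]_x (r%:E * ((\1_(f_ n @^-1` [set r]) x)%:E * (h x)%:E))); last first.
  by apply: eq_integral => y _; rewrite EFinM muleA.
rewrite ge0_integralZl_EFin //.
- congr (_ * _); rewrite /density_measure [LHS]integral_mkcond; apply: eq_integral => y _.
  by rewrite patchE indicE; case: ifPn => _; rewrite ?mul1e ?mul0e.
- by move=> y _; rewrite mule_ge0 ?lee_fin.
- by apply: emeasurable_funM => //; exact/measurable_EFinP.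
Qed.

End Density.

(** * Substitutions in one variable *)

Section Substitution.
Variable R : realType.
Local Notation leb := (@lebesgue_measure R).
Local Notation RR := (measurableTypeR R).

(** Substitutions are identities between measures. These need only be checked on
    half-open intervals, since Stieltjes measures are determined by their values there. *)
Lemma density_pushforward (phi : RR -> RR) (h : RR -> R) (f : RR -> \bar R) (m : {measure set RR -> \bar R}) :
  measurable_fun setT phi -> measurable_fun setT h -> (forall x, 0 <= h x) ->
  measurable_fun setT f -> (forall x, (0 <= f x)%E) ->
  (forall A, measurable A -> (m A = \int[leb]_(x in phi @^-1` A) (h x)%:E)%E) ->
  (\int[m]_x f x = \int[leb]_x (f (phi x) * (h x)%:E))%E.
Proof.
move=> mphi mh h0 mf f0 mE.
pose nu := density_measure leb mh h0.
transitivity (\int[pushforward nu phi]_x f x)%E.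
  by apply: eq_measure_integral => A mA _; rewrite mE.
rewrite ge0_integral_pushforward//.
rewrite preimage_setT ge0_integral_density//; first exact: measurableT_comp.
by move=> x; exact: f0.
Qed.

Lemma affine_substitution_pos (f : RR -> \bar R) (c b : R) : 0 < c ->
  measurable_fun setT f -> (forall x, (0 <= f x)%E) ->
  (\int[leb]_x f x = \int[leb]_x (f (c * x + b)%R * c%:E))%E.
Proof.
move=> c0 mf f0.
have mphi : measurable_fun setT ((fun x => c * x + b) : RR -> RR).
  by apply: measurable_funD => //; exact: measurable_funM.
have h0 (x : RR) : 0 <= (fun _ => c) x by exact: ltW.
have mh : measurable_fun setT ((fun _ => c) : RR -> R) by [].
apply: (@density_pushforward (fun x => c * x + b) (fun _ => c)) => // A mA.
pose nu := density_measure leb mh h0.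
transitivity (pushforward nu ((fun x => c * x + b) : RR -> RR) A); last by [].
apply: (@lebesgue_measure_unique R (pushforward nu ((fun x => c * x + b) : RR -> RR))) => // _ [[p q] _ <-].
rewrite /= /pushforward /nu /density_measure /=.
have -> : ((fun x => c * x + b) @^-1` `]p, q]%classic) = `](p - b) / c, (q - b) / c]%classic.
  apply/seteqP; split => x /=; rewrite !in_itv /=.
    by rewrite ltr_pdivrMr // ler_pdivlMr // ltrBlDr lerBrDr mulrC.
  by rewrite ltr_pdivrMr // ler_pdivlMr // ltrBlDr lerBrDr mulrC.
rewrite integral_cst //= !lebesgue_measure_itv /= !lte_fin ltr_pM2r ?invr_gt0 // ltrD2r.
case: ifPn => _; last by rewrite mule0.
by rewrite -EFinB -EFinB -EFinM; congr (_%:E); field; rewrite gt_eqF.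
Qed.

Lemma opp_substitution (f : RR -> \bar R) :
  measurable_fun setT f -> (forall x, (0 <= f x)%E) ->
  (\int[leb]_x f x = \int[leb]_x f (- x)%R)%E.
Proof.
move=> mf f0.
transitivity (\int[pushforward leb (-%R : RR -> RR)]_x f x)%E.
  by apply: eq_measure_integral => A mA _; exact/esym/lebesgue_measureN.
by rewrite ge0_integral_pushforward.
Qed.

Lemma affine_substitution (f : RR -> \bar R) (c b : R) : c != 0 ->
  measurable_fun setT f -> (forall x, (0 <= f x)%E) ->
  (\int[leb]_x f x = \int[leb]_x (f (c * x + b)%R * (`|c|)%:E))%E.
Proof.
move=> c0 mf f0; have [cp|cn] := ltP 0 c.
  by rewrite gtr0_norm //; exact: affine_substitution_pos.
have cp : 0 < - c by rewrite oppr_gt0 lt_neqAle c0.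
rewrite ltr0_norm; last by rewrite -oppr_gt0.
rewrite (@affine_substitution_pos f (- c) b) // opp_substitution.
- by apply: eq_integral => x _; rewrite mulrNN.
- apply: emeasurable_funM => //; apply: measurableT_comp => //.
  by apply: measurable_funD => //; exact: measurable_funM.
- by move=> x; rewrite mule_ge0 // lee_fin ltW.
Qed.

Let expR_nd : {homo (@expR R) : x y / x <= y}.
Proof. by move=> x y; rewrite ler_expR. Qed.

Let expR_rc : right_continuous (@expR R).
Proof. by move=> x; apply: cvg_within_filter; exact: continuous_expR. Qed.

HB.instance Definition _ := isCumulative.Build R _ R (@expR R) expR_nd expR_rc.

Lemma integral_expR_itv (a b : R) : a <= b ->
  (\int[leb]_(x in `]a, b]) (expR x)%:E = (expR b - expR a)%:E)%E.
Proof.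
rewrite le_eqVlt => /predU1P[->|ab].
  by rewrite subrr set_itv_ge ?integral_set0 // bnd_simp ltxx.
rewrite integral_itv_obnd_cbnd; last by apply/measurable_EFinP; apply: measurable_funTS.
rewrite (continuous_FTC2 (F := @expR R)) //.
- by apply: continuous_subspaceT; exact: continuous_expR.
- split.
  + by move=> x _; exact: derivable_expR.
  + by apply: cvg_at_right_filter; exact: continuous_expR.
  + by apply: cvg_at_left_filter; exact: continuous_expR.
- by move=> x _; rewrite derive1E; exact: (congr1 (@^~ x) (@derive_expR R)).
Qed.

(** Both sides are the integral of f o exp for the Stieltjes measure of exp: this measure
    has the density exp, and it is also the image under ln of the Lebesgue measure of
    the positive half-line. *)
Lemma exp_substitution (f : RR -> \bar R) :
  measurable_fun setT f -> (forall x, (0 <= f x)%E) ->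
  (\int[leb]_(x in `]0%R, +oo[) f x = \int[leb]_x (f (expR x) * (expR x)%:E))%E.
Proof.
move=> mf f0; pose m := lebesgue_stieltjes_measure (@expR R).
pose g : RR -> \bar R := fun x => f (expR x).
have mg : measurable_fun setT g by exact: measurableT_comp.
have g0 x : (0 <= g x)%E by exact: f0.
have mid : measurable_fun setT (idfun : RR -> RR) by exact: measurable_id.
have mexp : measurable_fun setT (@expR R) by [].
have exp0 (x : RR) : 0 <= expR x by exact: expR_ge0.
have mind : measurable_fun setT (\1_(`]0%R, +oo[%classic : set RR) : RR -> R).
  exact: measurable_indic.
have ind0 (x : RR) : 0 <= (\1_(`]0%R, +oo[%classic : set RR) : RR -> R) x by rewrite indicE.
transitivity (\int[m]_x g x)%E; last first.
  rewrite (@density_pushforward idfun (@expR R)) // => A mA.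
  pose nu := density_measure leb mexp exp0.
  transitivity (nu A); last by [].
  apply: (@lebesgue_stieltjes_measure_unique R _ nu) => // _ [[p q] _ <-].
  rewrite /= /nu /density_measure /lebesgue_stieltjes_measure /measure_extension/= measurable_mu_extE/=; last exact: is_ocitv.
  have [pq|qp] := leP p q; first by rewrite wlength_itv_bnd // integral_expR_itv.
  by rewrite set_itv_ge ?wlength0 ?integral_set0 // bnd_simp -leNgt ltW.
rewrite (@density_pushforward (@ln R : RR -> RR) (\1_(`]0%R, +oo[%classic : set RR)) g) //.
- rewrite [LHS]integral_mkcond; apply: eq_integral => x _; rewrite patchE indicE.
  case: ifPn => xp; last by rewrite mule0.
  by rewrite mule1 /g lnK //; move: xp; rewrite inE /= in_itv /= andbT posrE.
- move=> A mA; pose nu := density_measure leb mind ind0.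
  have mln : measurable_fun setT (@ln R : RR -> RR) by exact: measurable_ln.
  transitivity (pushforward nu (@ln R : RR -> RR) A); last by [].
  apply: (@lebesgue_stieltjes_measure_unique R _ (pushforward nu (@ln R : RR -> RR))) => // _ [[p q] _ <-].
  rewrite /= /pushforward /nu /density_measure /lebesgue_stieltjes_measure /measure_extension/= measurable_mu_extE/=; last exact: is_ocitv.
  rewrite integral_indic //=.
  have -> : `]0%R, +oo[ `&` (@ln R) @^-1` `]p, q] = `]expR p, expR q]%classic.
    apply/seteqP; split => x /=; rewrite !in_itv /= andbT.
      by move=> [x0 /andP[h1 h2]]; rewrite -[x]lnK // ltr_expR ler_expR h1.
    move=> /andP[h1 h2]; have x0 : 0 < x by apply: le_lt_trans h1; exact: expR_ge0.
    by rewrite x0 -ltr_expR lnK ?posrE // h1 -ler_expR lnK ?posrE.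
  rewrite lebesgue_measure_itv /= lte_fin ltr_expR.
  have [pq|qp] := ltP p q; first by rewrite wlength_itv_bnd // ltW.
  by rewrite set_itv_ge ?wlength0 // bnd_simp -leNgt.
Unshelve. all: by rewrite -[X in measurable X]setTI; exact: mln.
Qed.

End Substitution.

(** * Hyperbolic volume and the inversion *)

Section Inversion.
Variable R : realType.
Local Notation leb := (@lebesgue_measure R).
Local Notation RR := (measurableTypeR R).

Lemma measurable_invr (d : measure_display) (T : measurableType d) (f : T -> R) :
  measurable_fun setT f -> (forall x, 0 <= f x) -> measurable_fun setT (fun x => (f x)^-1).
Proof.
move=> mf f0; have -> : (fun x => (f x)^-1) = (fun x => f x `^ (-1)).
  by apply/funext => x; rewrite powR_inv1.
by apply: (@measurableT_comp _ _ _ _ _ _ (fun x : RR => x `^ (-1))).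
Qed.

(** Through exp, squaring is the doubling of the real line. *)
Lemma square_substitution (f : RR -> \bar R) :
  measurable_fun setT f -> (forall x, (0 <= f x)%E) ->
  (\int[leb]_(x in `]0%R, +oo[) f x = \int[leb]_(x in `]0%R, +oo[) (f (x ^+ 2)%R * (2 * `|x|)%:E))%E.
Proof.
move=> mf f0.
have mg : measurable_fun setT (fun x : RR => f (x ^+ 2)%R * (2 * `|x|)%:E)%E.
  apply: emeasurable_funM; first exact: measurableT_comp.
  by apply/measurable_EFinP; apply: measurable_funM => //.
rewrite exp_substitution // exp_substitution //; last first.
  by move=> x; rewrite mule_ge0 // lee_fin mulr_ge0.
rewrite (@affine_substitution _ _ 2 0) //.
- apply: eq_integral => x _; rewrite addr0 ger0_norm // ger0_norm ?expR_ge0 //.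
  have -> : expR (2 * x) = expR x ^+ 2 by rewrite expr2 -expRD mulr2n mulrDl !mul1r.
  by rewrite -!muleA -!EFinM; congr (_ * _%:E)%E; ring.
- apply: emeasurable_funM; first exact: measurableT_comp.
  exact/measurable_EFinP.
- by move=> x; rewrite mule_ge0 // lee_fin expR_ge0.
Qed.

(** Through exp, x |-> 1 / x is the reflection of the real line. *)
Lemma inverse_substitution (f : RR -> \bar R) :
  measurable_fun setT f -> (forall x, (0 <= f x)%E) ->
  (\int[leb]_(x in `]0%R, +oo[) f x =
   \int[leb]_(x in `]0%R, +oo[) (f (`|x|^-1)%R * ((`|x| ^+ 2)^-1)%:E))%E.
Proof.
move=> mf f0.
have mi : measurable_fun setT (fun x : RR => `|x|^-1) by exact: measurable_invr.
have mg : measurable_fun setT (fun x : RR => f (`|x|^-1)%R * ((`|x| ^+ 2)^-1)%:E)%E.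
  apply: emeasurable_funM; first exact: measurableT_comp.
  apply/measurable_EFinP; apply: measurable_invr => //.
  by apply: measurable_funX.
rewrite exp_substitution // exp_substitution //; last first.
  by move=> x; rewrite mule_ge0 // lee_fin invr_ge0.
rewrite (@affine_substitution _ _ (-1) 0) ?oppr_eq0 //.
- apply: eq_integral => x _; rewrite addr0 mulN1r expRN normrN1 mule1 ger0_norm ?expR_ge0 //.
  rewrite -muleA -EFinM; congr (_ * _%:E)%E.
  by field; rewrite gt_eqF // expR_gt0.
- apply: emeasurable_funM; first exact: measurableT_comp.
  exact/measurable_EFinP.
- by move=> x; rewrite mule_ge0 // lee_fin expR_ge0.
Qed.

Lemma plane_affine_substitution (g : RR * RR -> \bar R) (a b c d : R) : a != 0 -> b != 0 ->
  measurable_fun setT g -> (forall z, (0 <= g z)%E) ->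
  (\int[leb \x leb]_z g z =
   \int[leb \x leb]_z (g (a * z.1 + c, b * z.2 + d)%R * (`|a| * `|b|)%:E))%E.
Proof.
move=> a0 b0 mg g0.
have maff (k e : R) : measurable_fun setT ((fun x => k * x + e) : RR -> RR).
  by apply: measurable_funD => //; exact: measurable_funM.
have mz : measurable_fun setT ((fun z => (a * z.1 + c, b * z.2 + d)) : RR * RR -> RR * RR).
  apply: measurable_fun_pair.
  - exact: (measurableT_comp (maff a c) (@measurable_fst _ _ RR RR)).
  - exact: (measurableT_comp (maff b d) (@measurable_snd _ _ RR RR)).
have mg' : measurable_fun setT (fun z : RR * RR => g (a * z.1 + c, b * z.2 + d)%R * (`|a| * `|b|)%:E)%E.
  by apply: emeasurable_funM => //; exact: measurableT_comp.
rewrite fubini_tonelli1 // fubini_tonelli1 //; last first.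
  by move=> z; rewrite mule_ge0 // lee_fin mulr_ge0.
rewrite /fubini_F.
have mF : measurable_fun setT (fun x : RR => \int[leb]_y g (x, y))%E.
  exact: measurable_fun_fubini_tonelli_F.
rewrite (@affine_substitution _ _ a c) //; last by move=> x; exact: integral_ge0.
apply: eq_integral => x _.
rewrite (@affine_substitution _ _ b d) //; last by apply: measurable_fun_pair2.
rewrite -ge0_integralZr //=.
- by apply: eq_integral => y _; rewrite -muleA -EFinM [(`|b| * _)%R]mulrC.
- apply: emeasurable_funM => //.
  apply: (@measurableT_comp _ _ _ _ _ _ (fun y : RR => g (a * x + c, y))).
    exact: measurable_fun_pair2.
  exact: maff.
- by move=> y _; rewrite mule_ge0 // lee_fin.
Qed.

Local Notation space := (RR * RR * RR)%type.
(* Stands for the Lebesgue measure of the plane, of which only the behaviour under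
   affine substitutions matters. *)
Variable mu2 : {sigma_finite_measure set (RR * RR)%type -> \bar R}.
Hypothesis mu2_affine : forall (g : RR * RR -> \bar R) (a b c d : R), a != 0 -> b != 0 ->
  measurable_fun setT g -> (forall z, (0 <= g z)%E) ->
  (\int[mu2]_z g z =
   \int[mu2]_z (g (a * z.1 + c, b * z.2 + d)%R * (`|a| * `|b|)%:E))%E.
Local Notation m3 := (mu2 \x leb)%E.

Definition normsq (u : R * R * R) : R := u.1.1 ^+ 2 + u.1.2 ^+ 2 + u.2 ^+ 2.

(** The Poincare extension of z |-> - 1 / z. *)
Definition inversion (u : R * R * R) : R * R * R :=
  (- (u.1.1 / normsq u), u.1.2 / normsq u, u.2 / normsq u).

(** The density of hyperbolic volume; the absolute value makes it nonnegative off H3. *)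
Definition hweight (u : R * R * R) : R := (`|u.2| ^+ 3)^-1.

Let m11 : measurable_fun setT (fun u : space => u.1.1).
Proof. exact: (measurableT_comp (@measurable_fst _ _ RR RR) (@measurable_fst _ _ (RR * RR)%type RR)). Qed.

Let m12 : measurable_fun setT (fun u : space => u.1.2).
Proof. exact: (measurableT_comp (@measurable_snd _ _ RR RR) (@measurable_fst _ _ (RR * RR)%type RR)). Qed.

Let m2 : measurable_fun setT (fun u : space => u.2).
Proof. exact: measurable_snd. Qed.

Lemma measurable_hweight : measurable_fun setT (hweight : space -> R).
Proof.
apply: measurable_invr => [|u]; last by rewrite exprn_ge0.
by apply: measurable_funX; apply: measurableT_comp.
Qed.

Lemma measurable_inversion : measurable_fun setT (inversion : space -> space).
Proof.
have mN : measurable_fun setT (fun u : space => (normsq u)^-1).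
  apply: measurable_invr => [|u]; last by rewrite !addr_ge0 ?sqr_ge0.
  by apply: measurable_funD; [apply: measurable_funD|]; apply: measurable_funX.
apply: measurable_fun_pair; first apply: measurable_fun_pair.
- by apply: measurableT_comp => //; exact: measurable_funM.
- exact: measurable_funM.
- exact: measurable_funM.
Qed.

Lemma measurable_H3 : measurable (@H3 R : set space).
Proof.
rewrite -[X in measurable X]setTI.
have -> : @H3 R = (fun u : space => u.2) @^-1` `]0, +oo[%classic.
  by apply/seteqP; split => u /=; rewrite in_itv /= andbT.
exact: m2.
Qed.

Definition hdensity (F : space -> \bar R) (u : space) : \bar R :=
  if 0 < u.2 then (F u * (hweight u)%:E)%E else 0%E.

Lemma hdensity_ge0 F : (forall u, (0 <= F u)%E) -> forall u, (0 <= hdensity F u)%E.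
Proof.
move=> F0 u; rewrite /hdensity; case: ifP => // _.
by rewrite mule_ge0 // lee_fin invr_ge0 exprn_ge0.
Qed.

Lemma measurable_hdensity F : measurable_fun setT F -> measurable_fun setT (hdensity F).
Proof.
move=> mF; apply: measurable_fun_ifT.
- apply: measurable_fun_ltr; [exact: measurable_cst|exact: m2].
- apply: emeasurable_funM; first exact: mF.
  apply/measurable_EFinP; exact: measurable_hweight.
- exact: measurable_cst.
Qed.

Lemma integral_hdensity F :
  (\int[m3]_(u in @H3 R) (F u * (hweight u)%:E) = \int[m3]_u hdensity F u)%E.
Proof.
rewrite [LHS]integral_mkcond; apply: eq_integral => u _; rewrite patchE /hdensity.
by have -> : (u \in @H3 R) = (0 < u.2) by apply/idP/idP; rewrite inE.
Qed.

(** The integrand F (z, t) / t^3 in the coordinates (z, n) with n = |z|^2 + t^2, in which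
    dt = dn / (2 t). They suit the inversion, which maps the sphere of level n to that
    of level 1 / n and is a similarity in z there. *)
Definition level_fun (F : space -> \bar R) (z : RR * RR) (n : RR) : \bar R :=
  (F (z, Num.sqrt (n - (z.1 ^+ 2 + z.2 ^+ 2)))%R
   * ((2 * (n - (z.1 ^+ 2 + z.2 ^+ 2)) ^+ 2)^-1
      * (z.1 ^+ 2 + z.2 ^+ 2 < n)%R%:R)%R%:E)%E.

Lemma level_fun_ge0 F z n : (forall u, (0 <= F u)%E) -> (0 <= level_fun F z n)%E.
Proof. by move=> F0; rewrite mule_ge0 // lee_fin mulr_ge0 // invr_ge0 mulr_ge0 // sqr_ge0. Qed.

Lemma measurable_level_fun F : measurable_fun setT F ->
  measurable_fun setT (fun u : space => level_fun F u.1 u.2).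
Proof.
move=> mF.
have mc : measurable_fun setT (fun u : space => u.1.1 ^+ 2 + u.1.2 ^+ 2).
  by apply: measurable_funD; apply: measurable_funX.
have md : measurable_fun setT (fun u : space => u.2 - (u.1.1 ^+ 2 + u.1.2 ^+ 2)).
  exact: measurable_funB.
have msqrt : measurable_fun setT (@Num.sqrt R : RR -> RR).
  by apply: continuous_measurable_fun; exact: sqrt_continuous.
apply: emeasurable_funM.
  apply: measurableT_comp => //; apply: measurable_fun_pair; first exact: measurable_fst.
  exact: (measurableT_comp msqrt md).
apply/measurable_EFinP; apply: measurable_funM.
  apply: measurable_invr => [|u]; last by rewrite mulr_ge0 // sqr_ge0.
  by apply: measurable_funM => //; exact: measurable_funX.
have -> : (fun u : space => (u.1.1 ^+ 2 + u.1.2 ^+ 2 < u.2)%R%:R : R) =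
    (fun u => if u.1.1 ^+ 2 + u.1.2 ^+ 2 < u.2 then 1 else 0).
  by apply/funext => u; case: ifP.
by apply: measurable_fun_ifT => //; exact: measurable_fun_ltr.
Qed.

Lemma level_integral F : measurable_fun setT F -> (forall u, (0 <= F u)%E) ->
  (\int[m3]_(u in @H3 R) (F u * (hweight u)%:E) =
   \int[leb]_(n in `]0%R, +oo[) \int[mu2]_z level_fun F z n)%E.
Proof.
move=> mF F0.
have mL := measurable_level_fun mF.
rewrite integral_hdensity.
transitivity (\int[mu2]_z \int[leb]_t hdensity F (z, t))%E.
  by rewrite (fubini_tonelli1 _ (measurable_hdensity mF) (hdensity_ge0 F0)).
transitivity (\int[mu2]_z \int[leb]_n level_fun F z n)%E; last first.
  have L0 (u : space) : (0 <= level_fun F u.1 u.2)%E by exact: level_fun_ge0.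
  transitivity (\int[leb]_n \int[mu2]_z level_fun F z n)%E.
    exact: (fubini_tonelli (m1 := mu2) (m2 := leb) _ mL L0).
  rewrite [RHS]integral_mkcond; apply: eq_integral => n _.
  rewrite patchE; case: ifPn => // n0; apply: integral0_eq => z _.
  rewrite /level_fun; have -> : (z.1 ^+ 2 + z.2 ^+ 2 < n) = false.
    apply/negbTE; rewrite -leNgt; move: n0; rewrite notin_setE /= in_itv /= andbT => /negP.
    by rewrite -leNgt => n0; apply: le_trans n0 _; rewrite addr_ge0 ?sqr_ge0.
  by rewrite mulr0 mule0.
apply: eq_integral => z _.
pose g (m : RR) : \bar R := (F (z, Num.sqrt m) * ((2 * m ^+ 2)^-1)%:E)%E.
have msqrt : measurable_fun setT (@Num.sqrt R : RR -> RR).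
  by apply: continuous_measurable_fun; exact: sqrt_continuous.
have mg : measurable_fun setT g.
  apply: emeasurable_funM.
    apply: (@measurableT_comp _ _ _ _ _ _ (fun t : RR => F (z, t))) => //.
    exact: measurable_fun_pair2.
  apply/measurable_EFinP; apply: measurable_invr => [|u]; last by rewrite mulr_ge0 // sqr_ge0.
  by apply: measurable_funM => //; exact: measurable_funX.
have g0 m : (0 <= g m)%E by rewrite mule_ge0 // lee_fin invr_ge0 mulr_ge0 // sqr_ge0.
have mgp : measurable_fun setT (g \_ (`]0, +oo[%classic : set RR)).
  by apply: (measurable_restrictT g _).1; [exact: measurable_itv|exact: measurable_funTS].
have gp0 m : (0 <= (g \_ (`]0%R, +oo[%classic : set RR)) m)%E.
  by rewrite patchE; case: ifPn.
transitivity (\int[leb]_(t in `]0%R, +oo[) (g (t ^+ 2)%R * (2 * `|t|)%:E))%E.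
  rewrite [RHS]integral_mkcond; apply: eq_integral => t _.
  rewrite patchE /hdensity /=.
  have -> : (t \in `]0, +oo[%classic) = (0 < t).
    by apply/idP/idP; rewrite inE /= in_itv /= andbT.
  case: ifPn => // t0.
  rewrite /g sqrtr_sqr gtr0_norm // -muleA -EFinM; congr (_ * _%:E)%E.
  by rewrite /hweight /= gtr0_norm //; field; rewrite gt_eqF.
rewrite -square_substitution // [LHS]integral_mkcond.
rewrite [LHS](@affine_substitution _ _ 1 (- (z.1 ^+ 2 + z.2 ^+ 2))) // ?oner_eq0 //.
apply: eq_integral => n _; rewrite mul1r normr1 mule1 patchE /level_fun.
have posE (x : RR) : (x \in (`]0, +oo[%classic : set RR)) = (0 < x).
  by apply/idP/idP; rewrite inE /= in_itv /= andbT.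
rewrite posE subr_gt0.
by case: ifPn => _; rewrite ?mulr1 // mulr0 mule0.
Qed.

Lemma level_fun_inversion F (z : RR * RR) (n : RR) : 0 < n ->
  level_fun (F \o inversion) (- n * z.1 + 0, n * z.2 + 0) n =
  (level_fun F z (n^-1)%R * ((n ^+ 4)^-1)%:E)%E.
Proof.
move=> n0; rewrite /level_fun /= !addr0.
have -> : (- n * z.1) ^+ 2 + (n * z.2) ^+ 2 = n ^+ 2 * (z.1 ^+ 2 + z.2 ^+ 2) by ring.
set c := z.1 ^+ 2 + z.2 ^+ 2.
have -> : (n ^+ 2 * c < n) = (c < n^-1).
  by rewrite -[in RHS](ltr_pM2l (exprn_gt0 2 n0)); congr (_ < _); field; rewrite gt_eqF.
have [cn|_] := ltP c n^-1; last by rewrite !mulr0 !mule0 mul0e.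
have d0 : 0 < n^-1 - c by rewrite subr_gt0.
have dE : n - n ^+ 2 * c = n ^+ 2 * (n^-1 - c) by field; rewrite gt_eqF.
rewrite !mulr1 -muleA -EFinM; congr (_ * _%:E)%E; last first.
  by rewrite dE; set e := n^-1 - c in d0 *; field; rewrite !gt_eqF.
congr F; rewrite /inversion /normsq /=.
have -> : (- n * z.1) ^+ 2 + (n * z.2) ^+ 2 + Num.sqrt (n - n ^+ 2 * c) ^+ 2 = n.
  rewrite sqr_sqrtr; last by rewrite dE mulr_ge0 ?sqr_ge0 ?ltW.
  by rewrite /c; ring.
have -> : Num.sqrt (n - n ^+ 2 * c) = n * Num.sqrt (n^-1 - c).
  by rewrite dE sqrtrM ?sqr_ge0 // sqrtr_sqr gtr0_norm.
by case: (z) => z1 z2 /=; congr (_, _, _); field; rewrite gt_eqF.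
Qed.

(** On each level the planar substitution (x, y) |-> (- n x, n y) reduces the inversion to
    n |-> 1 / n; its factor n^2 and the n^-4 of level_fun_inversion combine to the n^-2
    of that substitution. *)
Lemma inversion_invariance F : measurable_fun setT F -> (forall u, (0 <= F u)%E) ->
  (\int[m3]_(u in @H3 R) (F (inversion u) * (hweight u)%:E) =
   \int[m3]_(u in @H3 R) (F u * (hweight u)%:E))%E.
Proof.
move=> mF F0.
have mFJ : measurable_fun setT (F \o inversion) by apply: measurableT_comp => //; exact: measurable_inversion.
rewrite (level_integral mFJ) //; last by move=> u; exact: F0.
rewrite [RHS](level_integral mF F0).
have mL : measurable_fun setT (fun n : RR => \int[mu2]_z level_fun F z n)%E.
  have L0 (u : space) : (0 <= level_fun F u.1 u.2)%E by exact: level_fun_ge0.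
  exact: (measurable_fun_fubini_tonelli_G (m1 := mu2) _ (measurable_level_fun mF) L0).
rewrite [RHS]inverse_substitution //; last first.
  by move=> n; apply: integral_ge0 => z _; exact: level_fun_ge0.
apply: eq_integral => n; rewrite inE /= in_itv /= andbT => n0; rewrite gtr0_norm //.
have mlz G k : measurable_fun setT G -> measurable_fun setT (fun z : RR * RR => level_fun G z k).
  move=> mG; exact: (measurable_fun_pair1 (f := fun u => level_fun G u.1 u.2) k (measurable_level_fun mG)).
rewrite (@mu2_affine _ (- n) n 0 0) ?oppr_eq0 ?gt_eqF //.
- rewrite -ge0_integralZr //=.
  + apply: eq_integral => z _; rewrite level_fun_inversion // -muleA -EFinM.
    by congr (_ * _%:E)%E; rewrite normrN gtr0_norm //; field; rewrite gt_eqF.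
  + exact: mlz.
  + by move=> z _; exact: level_fun_ge0.
  + by rewrite lee_fin invr_ge0 sqr_ge0.
- exact: mlz.
- by move=> z; apply: level_fun_ge0 => u; exact: F0.
Qed.

Lemma translation_invariance F (a b : R) : measurable_fun setT F -> (forall u, (0 <= F u)%E) ->
  (\int[m3]_(u in @H3 R) (F (u.1.1 + a, u.1.2 + b, u.2)%R * (hweight u)%:E) =
   \int[m3]_(u in @H3 R) (F u * (hweight u)%:E))%E.
Proof.
move=> mF F0.
have mT : measurable_fun setT (fun u : space => (u.1.1 + a, u.1.2 + b, u.2) : space).
  apply: measurable_fun_pair => //; apply: measurable_fun_pair; exact: measurable_funD.
have mFT : measurable_fun setT (fun u : space => F (u.1.1 + a, u.1.2 + b, u.2)).
  exact: (measurableT_comp mF mT).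
have FT0 u : (0 <= F (u.1.1 + a, u.1.2 + b, u.2)%R)%E by exact: F0.
rewrite (integral_hdensity (fun u => F (u.1.1 + a, u.1.2 + b, u.2))) integral_hdensity.
have mD := measurable_hdensity mF; have D0 := hdensity_ge0 F0.
transitivity (\int[leb]_t \int[mu2]_z
    hdensity (fun u => F (u.1.1 + a, u.1.2 + b, u.2)%R) (z, t))%E.
  by rewrite (fubini_tonelli2 _ (measurable_hdensity mFT) (hdensity_ge0 FT0)).
transitivity (\int[leb]_t \int[mu2]_z hdensity F (z, t))%E; last first.
  by rewrite (fubini_tonelli2 _ mD D0).
apply: eq_integral => t _.
rewrite [RHS](@mu2_affine (fun z => hdensity F (z, t)) 1 1 a b) ?oner_eq0 //.
- by apply: eq_integral => z _; rewrite !normr1 !mul1r mule1.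
- exact: (measurable_fun_pair1 t mD).
Qed.

End Inversion.

(** * Hyperbolic volume and SL2(C) *)

Section SpecialLinear.
Variable F : fieldType.

Definition mx22 (a b c d : F) : 'M[F]_2 :=
  \matrix_(i < 2, j < 2) if i == 0 then if j == 0 then a else b else if j == 0 then c else d.

Lemma mx22P (A B : 'M[F]_2) : A 0 0 = B 0 0 -> A 0 1 = B 0 1 -> A 1 0 = B 1 0 -> A 1 1 = B 1 1 ->
  A = B.
Proof.
move=> e00 e01 e10 e11; apply/matrixP => i j.
by case: (ord2P i) => ->; case: (ord2P j) => ->.
Qed.

Lemma mx22E a b c d : (mx22 a b c d 0 0 = a) * (mx22 a b c d 0 1 = b)
  * (mx22 a b c d 1 0 = c) * (mx22 a b c d 1 1 = d).
Proof. by rewrite !mxE. Qed.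

Lemma SL2_of_subproof a b c d : a * d - b * c = 1 -> \det (mx22 a b c d) == 1.
Proof. by move=> h; rewrite det_mx22 !mx22E h. Qed.

Definition SL2_of a b c d (h : a * d - b * c = 1) : SL2 F := MkSL2 (SL2_of_subproof h).

Lemma upper_subproof (b : F) : 1 * 1 - b * 0 = 1. Proof. by rewrite mulr0 subr0 mul1r. Qed.
Lemma lower_subproof (c : F) : 1 * 1 - 0 * c = 1. Proof. by rewrite mul0r subr0 mul1r. Qed.
Lemma weyl_subproof : 0 * 0 - (-1) * 1 = 1 :> F. Proof. by rewrite mul0r mulr1 opprK add0r. Qed.

Definition upper b : SL2 F := SL2_of (upper_subproof b).
Definition lower c : SL2 F := SL2_of (lower_subproof c).
Definition weyl : SL2 F := SL2_of weyl_subproof.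

Lemma SL2P (A B : SL2 F) : ent A 0 0 = ent B 0 0 -> ent A 0 1 = ent B 0 1 ->
  ent A 1 0 = ent B 1 0 -> ent A 1 1 = ent B 1 1 -> A = B.
Proof. by move=> *; apply/val_inj/mx22P. Qed.

Lemma SL2_mulE (A B : SL2 F) i j : ent (A * B) i j =
  ent A i 0 * ent B 0 j + ent A i 1 * ent B 1 j.
Proof. exact: mulmx22E. Qed.

(** Elimination with the lower left entry as a pivot; when it is 0, a lower unipotent
    factor makes it nonzero. Lower unipotents are conjugates of upper ones by the Weyl
    element, up to sign. *)
Lemma SL2_generated (Q : SL2 F -> Prop) : (forall A B, Q A -> Q B -> Q (A * B)%g) ->
  (forall b, Q (upper b)) -> Q weyl -> forall A, Q A.
Proof.
move=> QM Qu Qw; have Ql c : Q (lower c).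
  have -> : lower c = (weyl * (upper (- c) * (weyl * (weyl * weyl))))%g.
    by apply: SL2P; rewrite !(SL2_mulE, mx22E); ring.
  by apply: (QM _ _ Qw (QM _ _ (Qu _) (QM _ _ Qw (QM _ _ Qw Qw)))).
have Qc (A : SL2 F) : ent A 1 0 != 0 -> Q A.
  set a := ent A 0 0; set b := ent A 0 1.
  set c := ent A 1 0; set d := ent A 1 1 => c0.
  have h : a * d - b * c = 1 by exact: SL2E.
  have -> : A = (upper ((a - 1) / c) * (lower c * upper ((d - 1) / c)))%g; last first.
    by apply: (QM _ _ (Qu _) (QM _ _ (Ql _) (Qu _))).
  have bE : b = (a * d - 1) / c by rewrite -h; field.
  by apply: SL2P; rewrite !(SL2_mulE, mx22E) -/a -/b -/c -/d ?bE; field.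
move=> A; have [c0|/Qc//] := eqVneq (ent A 1 0) 0.
have -> : A = ((A * lower 1) * lower (-1))%g.
  by apply: SL2P; rewrite !(SL2_mulE, mx22E); ring.
apply: (QM _ _ _ (Ql _)); apply: Qc; rewrite !(SL2_mulE, mx22E) c0 mul0r add0r mulr1.
apply/eqP => d0; have /eqP := SL2E A; rewrite c0 d0 !mulr0 subr0.
by rewrite eq_sym oner_eq0.
Qed.

End SpecialLinear.

Section Volume.
Variable R : realType.
Local Notation C := R[i].
Local Notation leb := (@lebesgue_measure R).
Local Notation RR := (measurableTypeR R).
Local Notation space := (RR * RR * RR)%type.
Variable mu2 : {sigma_finite_measure set (RR * RR)%type -> \bar R}.
Hypothesis mu2_affine : forall (g : RR * RR -> \bar R) (a b c d : R), a != 0 -> b != 0 ->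
  measurable_fun setT g -> (forall z, (0 <= g z)%E) ->
  (\int[mu2]_z g z =
   \int[mu2]_z (g (a * z.1 + c, b * z.2 + d)%R * (`|a| * `|b|)%:E))%E.
Hypothesis mu2_box : forall a b c d : R, a < b -> c < d ->
  (0 < mu2 ((`]a, b[%classic : set RR) `*` (`]c, d[%classic : set RR)))%E.
Local Notation m3 := (mu2 \x leb)%E.

Lemma hweight_ge0 (u : space) : 0 <= hweight u.
Proof. by rewrite invr_ge0 exprn_ge0. Qed.

Let nu : {measure set space -> \bar R} :=
  density_measure m3 (@measurable_hweight R) hweight_ge0.

Lemma nuE (E : set space) : measurable E -> E `<=` @H3 R ->
  nu E = (\int[m3]_(u in @H3 R) ((\1_E u)%:E * (hweight u)%:E))%E.
Proof.
move=> mE EH; rewrite /nu /= /density_measure [LHS]integral_mkcond [RHS]integral_mkcond.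
apply: eq_integral => u _; rewrite !patchE indicE.
case: ifPn => uE; last by rewrite mul0e; case: ifP.
by rewrite mul1e ifT //; move: uE; rewrite !inE => /EH.
Qed.

Definition vol_invariant (A : SL2 C) := forall E : set space, measurable E -> E `<=` @H3 R ->
  measurable (@H3 R `&` (poincare A) @^-1` E : set space) /\
  nu (@H3 R `&` (poincare A) @^-1` E) = nu E.

Lemma vol_invariantM A B : vol_invariant A -> vol_invariant B -> vol_invariant (A * B)%g.
Proof.
move=> iA iB E mE EH; have [mA vA] := iA E mE EH.
have [mB vB] := iB _ mA (@subIsetl _ _ _).
suff -> : @H3 R `&` (poincare (A * B)%g) @^-1` E =
    @H3 R `&` (poincare B) @^-1` (@H3 R `&` (poincare A) @^-1` E) by rewrite vB.
apply/seteqP; split => u /= [hu hE]; split => //.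
  by split; [exact: poincare_H3 | rewrite -poincareM].
by rewrite poincareM //; case: hE.
Qed.

Lemma vol_invariant_fun (A : SL2 C) (f : space -> space) : measurable_fun setT f ->
  (forall u, @H3 R u -> poincare A u = f u) ->
  (forall F : space -> \bar R, measurable_fun setT F -> (forall u, (0 <= F u)%E) ->
    (\int[m3]_(u in @H3 R) (F (f u) * (hweight u)%:E) =
     \int[m3]_(u in @H3 R) (F u * (hweight u)%:E))%E) ->
  vol_invariant A.
Proof.
move=> mf Af If E mE EH.
have EE : @H3 R `&` (poincare A) @^-1` E = @H3 R `&` f @^-1` E.
  by apply/seteqP; split => u /= [hu hE]; split => //; move: hE; rewrite Af.
have mfE : measurable (@H3 R `&` f @^-1` E : set space).
  apply: measurableI; first exact: measurable_H3.
  by rewrite -[X in measurable X]setTI; exact: mf.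
rewrite EE; split => //; rewrite nuE // nuE // -(If (EFin \o \1_E)) //.
- apply: eq_integral => u; rewrite inE => hu; congr (_%:E * _)%E.
  by rewrite !indicE; congr (nat_of_bool _)%:R; apply/idP/idP; rewrite !inE; [case|].
- exact/measurable_EFinP.
- by move=> u; rewrite lee_fin.
Qed.

Lemma poincare_upper b (u : space) :
  poincare (upper b) u = (u.1.1 + complex.Re b, u.1.2 + complex.Im b, u.2).
Proof.
have d1 : pden (upper b) u = 1.
  by rewrite /pden !mx22E mul0r add0r /sqmod /= !expr0n /= expr1n !addr0 mul0r addr0.
rewrite poincareE d1 !divr1 /pnum !mx22E /zcoord mul0r add0r conjc1 mulr1 mul1r conjc0 mulr0 mul0r addr0.
by case: b d1.
Qed.

Lemma poincare_weyl (u : space) : poincare (weyl C) u = inversion u.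
Proof.
have d1 : pden (weyl C) u = normsq u.
  by rewrite /pden !mx22E addr0 mul1r /sqmod /= expr0n /= expr1n addr0 mul1r.
rewrite poincareE d1 /pnum !mx22E /zcoord mul0r add0r mul1r addr0 !mul0r addr0 mulN1r.
by rewrite /inversion /= mulNr opprK.
Qed.

(** Only the generators have to be considered: horizontal translations and the inversion. *)
Lemma vol_invariant_poincare A : vol_invariant A.
Proof.
apply: SL2_generated A => [A B|b|]; first exact: vol_invariantM.
- apply: (@vol_invariant_fun _ (fun u : space => (u.1.1 + complex.Re b, u.1.2 + complex.Im b, u.2) : space)).
  + apply: measurable_fun_pair => //; apply: measurable_fun_pair; apply: measurable_funD => //.
      exact: (measurableT_comp (@measurable_fst _ _ RR RR) (@measurable_fst _ _ (RR * RR)%type RR)).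
    exact: (measurableT_comp (@measurable_snd _ _ RR RR) (@measurable_fst _ _ (RR * RR)%type RR)).
  + by move=> u _; exact: poincare_upper.
  + by move=> F mF F0; exact: translation_invariance.
- apply: (@vol_invariant_fun _ (@inversion R)).
  + exact: measurable_inversion.
  + by move=> u _; exact: poincare_weyl.
  + by move=> F mF F0; exact: inversion_invariance.
Qed.

(** Boxes that reach down to the boundary plane t = 0. *)
Definition low_box (a b c d : R) : set space :=
  [set u | [/\ a < u.1.1 < b, c < u.1.2 < d & 0 < u.2 < 1]].

(** The part t < 1 / k of the box has a Euclidean volume proportional to 1 / k, while the
    density is at least k^3 there. *)
Lemma low_box_volume a b c d : a < b -> c < d ->
  measurable (low_box a b c d) /\ nu (low_box a b c d) = +oo%E.
Proof.
move=> ab cd; pose B (n : nat) : set space :=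
  ((`]a, b[%classic : set RR) `*` (`]c, d[%classic : set RR)) `*` (`]0, n.+1%:R^-1[%classic : set RR).
have mB n : measurable (B n) by apply: measurableX; [apply: measurableX|]; exact: measurable_itv.
have BE : low_box a b c d = B 0.
  apply/seteqP; split => u; rewrite /B /low_box /= !in_itv /= invr1; first by case.
  by move=> [[]].
split; first by rewrite BE.
set v := mu2 ((`]a, b[%classic : set RR) `*` (`]c, d[%classic : set RR)).
have v0 : (0 < v)%E by exact: mu2_box.
have [r r0 rv] : exists2 r : R, 0 < r & (r%:E <= v)%E.
  move: v0; case: v => [r| |] //; first by rewrite lte_fin; exists r.
  by exists 1 => //; rewrite leey.
have ge n : ((n.+1%:R * r)%:E <= nu (low_box a b c d))%E.
  have n0 : 0 < n.+1%:R :> R by rewrite ltr0n.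
  apply: (@le_trans _ _ (nu (B n))); last first.
    apply: le_measure; rewrite ?inE //; first by rewrite BE.
    move=> u; rewrite /B /low_box /= !in_itv /= => -[[-> ->] /andP[-> un]]; split => //=.
    by rewrite (lt_le_trans un) // invf_le1 // ler1n.
  apply: (@le_trans _ _ (\int[m3]_(u in B n) (n.+1%:R ^+ 3)%:E)%E).
    rewrite integral_cst //.
    rewrite [X in (_ <= _ * X)%E](_ : _ = (v * (n.+1%:R^-1)%R%:E)%E); last first.
      transitivity (v * leb (`]0%R, (n.+1%:R^-1)%R[%classic : set RR))%E.
        by apply: (product_measure1E mu2 leb); [apply: measurableX|]; exact: measurable_itv.
      by rewrite lebesgue_measure_itv /= lte_fin invr_gt0 n0 oppr0 adde0.
    rewrite [(v * _)%E]muleC muleA -EFinM.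
    have -> : n.+1%:R ^+ 3 / n.+1%:R = n.+1%:R ^+ 2 :> R by field; rewrite gt_eqF.
    apply: (@le_trans _ _ ((n.+1%:R ^+ 2)%:E * r%:E)%E); last by rewrite lee_pmul2l // lte_fin exprn_gt0.
    by rewrite -EFinM lee_fin ler_pM2r // expr2 ler_peMr ?ler1n // ltW.
  rewrite /nu /= /density_measure; apply: ge0_le_integral => //.
  - apply/measurable_EFinP; apply: measurable_funTS; exact: measurable_hweight.
  - move=> u; rewrite /B /= !in_itv /= => -[_ /andP[u0 un]]; rewrite lee_fin /hweight gtr0_norm //.
    rewrite -exprVn; apply: lerXn2r; rewrite ?nnegrE ?ltW // ?invr_gt0 //.
    by rewrite -[X in X < _]invrK ltf_pV2 ?posrE ?invr_gt0.
move: ge; case: (nu _) => [x| |] // ge; last by have := ge 0%N; rewrite leNgt ltNyr.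
have [n xn] : exists n : nat, x / r < n%:R by exists (Num.truncn (x / r)).+1; exact: truncnS_gt.
have := ge n; rewrite lee_fin leNgt => /negP[].
by rewrite -ltr_pdivrMr // (lt_trans xn) // ltr_nat.
Qed.

Lemma weighted_measure : exists nu : {measure set space -> \bar R},
  [/\ forall E, E `<=` @H3 R -> (\int[m3]_(u in E) ((u.2 ^+ 3)^-1)%:E)%E = nu E,
      forall (A : SL2 C) (E : set space), measurable E -> E `<=` @H3 R ->
        measurable (@H3 R `&` (poincare A) @^-1` E : set space) /\
        nu (@H3 R `&` (poincare A) @^-1` E) = nu E
    & forall a b c d, a < b -> c < d ->
        measurable (low_box a b c d) /\ nu (low_box a b c d) = +oo%E].
Proof.
exists nu; split => [E EH|A|a b c d]; [|exact: vol_invariant_poincare|exact: low_box_volume].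
by apply: eq_integral => u; rewrite inE => /EH u0; rewrite /hweight gtr0_norm.
Qed.

End Volume.

Lemma plane_sigma_finite (R : realType) :
  sigma_finite setT (@lebesgue_measure R \x @lebesgue_measure R)%E.
Proof.
pose I (n : nat) : set (measurableTypeR R) := `]- n%:R, n%:R[%classic.
have mI n : measurable (I n) by exact: measurable_itv.
exists (fun n => I n `*` I n).
  apply/seteqP; split => // -[x y] _.
  exists (Num.truncn (Num.max `|x| `|y|)).+1 => //; rewrite /I /= !in_itv /= -!ltr_norml.
  by apply/andP; rewrite -gt_max; exact: truncnS_gt.
move=> n; split; first exact: measurableX.
rewrite [X in (X < _)%E](_ : _ = (lebesgue_measure (I n) * lebesgue_measure (I n))%E).
  by rewrite lebesgue_measure_itv /=; case: ifP; rewrite ?mule0 ?ltry.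
exact: (product_measure1E (@lebesgue_measure R) (@lebesgue_measure R)).
Qed.

Lemma hyperbolic_measure (R : realType) :
  exists nu : {measure set (measurableTypeR R * measurableTypeR R * measurableTypeR R)%type -> \bar R},
  [/\ forall E, E `<=` @H3 R -> hyperbolic_volume E = nu E,
      forall (A : SL2 R[i]) (E : set (measurableTypeR R * measurableTypeR R * measurableTypeR R)),
        measurable E -> E `<=` @H3 R ->
        measurable (@H3 R `&` (poincare A) @^-1` E : set (measurableTypeR R * measurableTypeR R * measurableTypeR R)) /\
        nu (@H3 R `&` (poincare A) @^-1` E) = nu E
    & forall a b c d, a < b -> c < d ->
        measurable (low_box a b c d) /\ nu (low_box a b c d) = +oo%E].
Proof.
have box (a b c d : R) : a < b -> c < d ->
    (0 < (lebesgue_measure \x lebesgue_measure)%E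
      ((`]a, b[%classic : set (measurableTypeR R)) `*` (`]c, d[%classic : set (measurableTypeR R))))%E.
  move=> ab cd.
  have E := product_measure1E (@lebesgue_measure R) (@lebesgue_measure R)
    (measurable_itv `]a, b[) (measurable_itv `]c, d[).
  rewrite [X in (_ < X)%E](_ : _ = ((b - a) * (d - c))%R%:E).
    by rewrite lte_fin mulr_gt0 // subr_gt0.
  transitivity (lebesgue_measure (`]a, b[%classic : set (measurableTypeR R))
    * lebesgue_measure (`]c, d[%classic : set (measurableTypeR R)))%E; first exact: E.
  by rewrite !lebesgue_measure_itv /= !lte_fin ab cd.
pose m : {measure set (measurableTypeR R * measurableTypeR R)%type -> \bar R} :=
  @lebesgue_integral_fubini_product_measure1__canonical__measure_function_Measure
    _ _ _ _ R (@lebesgue_measure R) (@lebesgue_measure R).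
pose mu2 : {sigma_finite_measure set (measurableTypeR R * measurableTypeR R)%type -> \bar R} :=
  HB.pack (Measure.sort m) (@Measure_isSigmaFinite.Build _ _ _ m (plane_sigma_finite R)).
have [nu [hE hA hB]] := weighted_measure (mu2 := mu2) (@plane_affine_substitution R) box.
exists nu; split; [|exact: hA|exact: hB].
exact: hE.
Qed.

(** * Words and commuting families *)

Section Countable.
Variable G : groupType.

Definition word_eval (s : seq G) (w : seq (bool * nat)) : G :=
  foldr (fun x acc => ((if x.1 then nth 1 s x.2 else (nth 1 s x.2)^-1) * acc)%g) 1%g w.

Lemma word_evalM s w1 w2 : word_eval s (w1 ++ w2) = (word_eval s w1 * word_eval s w2)%g.
Proof. by elim: w1 => [|x w IH] /=; rewrite ?mul1g // IH mulgA. Qed.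

Lemma word_evalV s w : exists w', word_eval s w' = (word_eval s w)^-1%g.
Proof.
elim: w => [|x w [w' IH]]; first by exists [::]; rewrite /= invg1.
exists (w' ++ [:: (~~ x.1, x.2)]); rewrite word_evalM IH /= mulg1 invgM.
by case: x.1; rewrite ?invgK.
Qed.

Lemma finitely_generated_countable (s : seq G) :
  (forall Q : G -> Prop, Q 1%g -> (forall g h, Q g -> Q h -> Q (g * h)%g) ->
    (forall g, Q g -> Q g^-1%g) -> (forall g, g \in s -> Q g) -> forall g, Q g) ->
  exists e : nat -> G, forall g, exists n, e n = g.
Proof.
move=> gen; exists (fun n => word_eval s (odflt [::] (unpickle n))) => g.
suff [w <-] : exists w, word_eval s w = g by exists (pickle w); rewrite pickleK.
apply: (gen (fun g => exists w, word_eval s w = g)) => [|{}g h [w <-] [w' <-]|{}g [w <-]|{}g gs].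
- by exists [::].
- by exists (w ++ w'); rewrite word_evalM.
- exact: word_evalV.
- by exists [:: (true, index g s)]; rewrite /= nth_index // mulg1.
Qed.

End Countable.

Section Conjugation.
Variable F : fieldType.

Lemma SL2_inv_subproof (A : SL2 F) : ent A 1 1 * ent A 0 0
  - - ent A 0 1 * - ent A 1 0 = 1.
Proof. by rewrite mulrNN mulrC SL2E. Qed.

Lemma SL2_invE (A : SL2 F) : (ent A^-1 0 0 = ent A 1 1) *
  (ent A^-1 0 1 = - ent A 0 1) *
  (ent A^-1 1 0 = - ent A 1 0) *
  (ent A^-1 1 1 = ent A 0 0).
Proof.
suff -> : A^-1%g = SL2_of (SL2_inv_subproof A) by rewrite !mx22E.
apply: (mulgI A); rewrite mulgV; have h := SL2E A.
by apply: SL2P; rewrite SL2_mulE !mx22E !mxE /= -?h; ring.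
Qed.

(** The condition says that the homography A fixes x, and upper x * weyl carries infinity
    to x. *)
Lemma SL2_triangularize (A : SL2 F) x :
  ent A 1 0 * x ^+ 2 + (ent A 1 1 - ent A 0 0) * x - ent A 0 1 = 0 ->
  ent ((upper x * weyl F)^-1 * (A * (upper x * weyl F))) 1 0 = 0.
Proof. by move=> h; rewrite !(SL2_mulE, SL2_invE, mx22E) -[RHS]h; ring. Qed.

Lemma SL2_commute_upper (A B : SL2 F) : (A * B = B * A)%g ->
  ent A 1 0 = 0 ->
  (ent A 0 1 != 0 \/ ent A 0 0 != ent A 1 1) ->
  ent B 1 0 = 0 /\
  ent A 0 1 * (ent B 1 1 - ent B 0 0) =
    ent B 0 1 * (ent A 1 1 - ent A 0 0).
Proof.
move=> /(congr1 (fun X : SL2 F => (X : 'M[F]_2))) AB A10 hA.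
have e i j : ent A i 0 * ent B 0 j + ent A i 1 * ent B 1 j =
    ent B i 0 * ent A 0 j + ent B i 1 * ent A 1 j.
  by rewrite -!SL2_mulE AB.
split.
  have := e 0 0; have := e 1 0; rewrite A10 !mulr0 !addr0 mul0r add0r => e10 e00.
  case: hA => hA.
    apply: (mulfI hA); rewrite mulr0; apply: (addrI (ent A 0 0 * ent B 0 0)).
    by rewrite e00 addr0 mulrC.
  have : (ent A 0 0 - ent A 1 1) * ent B 1 0 = 0.
    by rewrite mulrBl e10; ring.
  by move/eqP; rewrite mulf_eq0 subr_eq0 (negbTE hA) => /eqP.
have h := e 0 1; apply: (addrI (ent A 0 0 * ent B 0 1 - ent B 0 1 * ent A 1 1 + ent A 0 1 * ent B 0 0)).
have -> : ent A 0 0 * ent B 0 1 - ent B 0 1 * ent A 1 1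
    + ent A 0 1 * ent B 0 0 + ent A 0 1 * (ent B 1 1 - ent B 0 0)
  = ent A 0 0 * ent B 0 1 + ent A 0 1 * ent B 1 1
    - ent B 0 1 * ent A 1 1 by ring.
by rewrite h; ring.
Qed.

End Conjugation.

(** A non-scalar member is triangularized, and its centralizer is triangular with it. If
    its eigenvalues differ it can be made diagonal, and then so is its centralizer;
    otherwise the centralizer consists of matrices with a double eigenvalue. *)
Lemma commuting_normal_form (F : closedFieldType) (G : Type) (rho : G -> SL2 F) :
  (forall g h, rho g * rho h = rho h * rho g)%g ->
  exists S : SL2 F, (forall g, ent (S^-1 * (rho g * S)) 1 0 = 0) /\
   ((forall g, ent (S^-1 * (rho g * S)) 0 1 = 0) \/
    (forall g, ent (S^-1 * (rho g * S)) 0 0 = ent (S^-1 * (rho g * S)) 1 1)).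
Proof.
move=> com.
have conj1 (S T : SL2 F) g : ((S * T)^-1 * (rho g * (S * T)) = T^-1 * ((S^-1 * (rho g * S)) * T))%g.
  by rewrite invgM !mulgA.
have comS (S : SL2 F) g h : ((S^-1 * (rho g * S)) * (S^-1 * (rho h * S)) =
    (S^-1 * (rho h * S)) * (S^-1 * (rho g * S)))%g.
  have E x y : ((S^-1 * (rho x * S)) * (S^-1 * (rho y * S)) = S^-1 * (rho x * rho y * S))%g.
    by rewrite !mulgA mulgK.
  by rewrite !E com.
pose scalar (A : SL2 F) := [/\ ent A 1 0 = 0, ent A 0 1 = 0 & ent A 0 0 = ent A 1 1].
have [all_scalar|/existsNP[g0 ns]] := pselect (forall g, scalar (rho g)).
  by exists 1%g; split; [|left]; move=> g; rewrite invg1 mul1g mulg1; case: (all_scalar g).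
have [S S10] : exists S : SL2 F, ent (S^-1 * (rho g0 * S)) 1 0 = 0.
  have [c0|c0] := eqVneq (ent (rho g0) 1 0) 0.
    by exists 1%g; rewrite invg1 mul1g mulg1.
  set A := rho g0 in c0 *.
  pose p (i : nat) := [:: ent A 0 1 / ent A 1 0;
     (ent A 0 0 - ent A 1 1) / ent A 1 0]`_i.
  have [x] := @solve_monicpoly F 2 p isT; rewrite big_ord_recl big_ord1 /p /= expr0 expr1 mulr1 => xE.
  exists (upper x * weyl F)%g; apply: SL2_triangularize.
  by rewrite xE; field.
set A := (S^-1 * (rho g0 * S))%g in S10.
have A_ns : ent A 0 1 != 0 \/ ent A 0 0 != ent A 1 1.
  have [A01|] := eqVneq (ent A 0 1) 0; last by left.
  right; apply/eqP => Aeq; apply: ns.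
  have Asc : forall B : SL2 F, (A * B = B * A)%g.
    by move=> B; apply: SL2P; rewrite (SL2_mulE A B) (SL2_mulE B A) ?S10 ?A01 ?Aeq; ring.
  have -> : rho g0 = A; last by split.
  by apply: (mulIg S); rewrite Asc /A mulgA mulgV mul1g.
have tri g : ent (S^-1 * (rho g * S)) 1 0 = 0.
  by have [] := SL2_commute_upper (comS S g0 g) S10 A_ns.
have [Aeq|Ane] := eqVneq (ent A 0 0) (ent A 1 1).
  exists S; split => //; right => g.
  have [_] := SL2_commute_upper (comS S g0 g) S10 A_ns; rewrite -/A Aeq subrr mulr0.
  move/eqP; rewrite mulf_eq0; case: A_ns => [/negbTE ->|]; last by rewrite Aeq eqxx.
  by rewrite /= subr_eq0 => /eqP.
pose x := ent A 0 1 / (ent A 1 1 - ent A 0 0).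
have d0 : ent A 1 1 - ent A 0 0 != 0 by rewrite subr_eq0 eq_sym.
exists (S * upper x)%g; split; [|left] => g; rewrite conj1 2!SL2_mulE !SL2_invE !mx22E !(SL2_mulE _ (upper x)) !mx22E tri.
  by ring.
have [_ e] := SL2_commute_upper (comS S g0 g) S10 A_ns; rewrite -/A in e.
set B := (S^-1 * (rho g * S))%g in e *.
have -> : ent B 0 1 = x * (ent B 1 1 - ent B 0 0).
  by apply: (mulIf d0); rewrite -e /x; field.
by ring.
Qed.

(** * The knot group is not abelian *)

Section Nonabelian.
Variables (R : realType) (K : framed_knot R) (P : R * R * R -> sphere3 R)
  (rho0 : rep R[i] (pi1_exterior K)) (u0 : R * R * R).
Hypothesis hol : based_holonomy P rho0 u0.
Local Notation C := R[i].
Local Notation RR := (measurableTypeR R).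
Local Notation space := (R * R * R)%type.
Local Notation mspace := (RR * RR * RR)%type.
Local Notation Gamma := (pi1_exterior K).

Let hP : hyperbolic_structure K P. Proof. by case: hol. Qed.

Lemma exterior_group_countable : exists e : nat -> Gamma, forall g, exists n, e n = g.
Proof.
by have [S gen] := pi1_exterior_finitely_generated hol; exact: finitely_generated_countable gen.
Qed.

(** B meets each orbit at most once. Its pieces, according to the g that moves a point
    into the fundamental domain F, are therefore carried to disjoint subsets of F, and
    there are countably many g. *)
Lemma packed_set_volume (nu : {measure set mspace -> \bar R}) (B : set mspace) :
  (forall E, E `<=` @H3 R -> hyperbolic_volume E = nu E) ->
  (forall (A : SL2 C) (E : set mspace), measurable E -> E `<=` @H3 R ->
    measurable (@H3 R `&` (poincare A) @^-1` E : set mspace) /\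
    nu (@H3 R `&` (poincare A) @^-1` E) = nu E) ->
  measurable B -> B `<=` @H3 R ->
  (forall g u, B u -> B (hact rho0 g u) -> g = 1%g) -> (nu B < +oo)%E.
Proof.
move=> volE inv mB BH Bpack.
have [_ _ _ _ [F [mF FH [FK Finj Fsurj] volF]]] := hP.
have [e esurj] := exterior_group_countable.
(* The enumeration e may have repetitions; only the first occurrence counts. *)
pose first n := [forall m : 'I_n, e m != e n].
pose D n : set mspace := if first n then F `&` (@H3 R `&` (poincare (rho0 (e n)^-1%g)) @^-1` B) else set0.
have DH n : D n `<=` @H3 R by move=> u; rewrite /D; case: ifP => // _ [/FH].
have mD n : measurable (D n).
  rewrite /D; case: ifP => // _; apply: measurableI => //.
  by have [] := inv (rho0 (e n)^-1%g) B mB BH.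
pose A n : set mspace := @H3 R `&` (poincare (rho0 (e n))) @^-1` (D n).
have mA n : measurable (A n) by have [] := inv (rho0 (e n)) (D n) (mD n) (@DH n).
have nuA n : nu (A n) = nu (D n) by have [] := inv (rho0 (e n)) (D n) (mD n) (@DH n).
have trivD : trivIset setT D.
  apply/trivIsetP => i j _ _ ij; apply/seteqP; split => // f; rewrite /D.
  case: ifP => [/forallP fi|_ []//]; case: ifP => [/forallP fj|_ [_ []]//].
  move=> [[Ff [hf Bi]] [_ [_ Bj]]].
  have eij : e i = e j.
    apply: (mulIg (e i)^-1%g); rewrite mulgV; apply/esym.
    have hj : poincare (rho0 (e j)^-1%g) f = hact rho0 (e j)^-1%g f by [].
    have hi : poincare (rho0 (e i)^-1%g) f = hact rho0 (e i)^-1%g f by [].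
    rewrite /= hi in Bi; rewrite /= hj in Bj.
    have hE : hact rho0 ((e j)^-1 * e i)%g (hact rho0 (e i)^-1%g f) = hact rho0 (e j)^-1%g f.
      by rewrite -hactM // mulgK.
    have := Bpack ((e j)^-1 * e i)%g _ Bi; rewrite hE => /(_ Bj) /(congr1 (fun x => e j * x)%g).
    by rewrite mulgA mulgV mul1g mulg1 => ->; rewrite mulgV.
  move: ij; rewrite neq_ltn => /orP[ij|ji].
    by have := fj (Ordinal ij); rewrite /= eij eqxx.
  by have := fi (Ordinal ji); rewrite /= eij eqxx.
have BA : B `<=` \bigcup_n A n.
  move=> v Bv; have hv := BH v Bv.
  have [f Ff fv] : (P @` F) (P v).
    by apply: Fsurj; have [[PH _] _ _ _ _] := hP; rewrite -PH; exists v.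
  have [g vg] := hact_transitive hol hv (FH _ Ff) (esym fv).
  have exn : exists n, e n == g by have [n <-] := esurj g; exists n.
  have [n /eqP en nmin] := ex_minnP exn.
  exists n => //; split => //=; rewrite /D ifT; last first.
    apply/forallP => m; apply/eqP => emn; have := nmin m; rewrite emn en eqxx => /(_ isT).
    by rewrite leqNgt ltn_ord.
  have -> : poincare (rho0 (e n)) v = f by rewrite en vg.
  split => //; split; first exact: FH.
  rewrite /= vg -/(hact rho0 (e n)^-1%g _) en hactK //.
apply: (@le_lt_trans _ _ (nu F)); last by rewrite -volE.
apply: (@le_trans _ _ (\sum_(0 <= n <oo) nu (A n))%E).
  exact: (@measure_sigma_subadditive _ _ _ nu B A mA mB BA).
rewrite (eq_eseriesr (fun n _ => nuA n)).
rewrite -(@measure_semi_bigcup _ _ _ nu D mD trivD); last exact: bigcupT_measurable.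
apply: le_measure; rewrite ?inE //; first exact: bigcupT_measurable.
by move=> f [n _]; rewrite /D; case: ifP => // _ [].
Qed.

(** The vertical projection to the surface (z, eta z) commutes with the group. As P is
    injective near a point of the surface, a box over a small square around z0 that
    reaches down to t = 0 meets each orbit at most once; but its volume is infinite. *)
Lemma no_equivariant_section (S : SL2 C) (eta : R * R -> R) (z0 : R * R) :
  {for z0, continuous eta} -> 0 < eta z0 ->
  (forall g u, H3 u -> 0 < eta u.1 ->
    poincare (S^-1 * (rho0 g * S))%g (u.1, eta u.1) =
    ((poincare (S^-1 * (rho0 g * S))%g u).1, eta (poincare (S^-1 * (rho0 g * S))%g u).1)) -> False.
Proof.
move=> ceta eta0 equi.
have hw : H3 (z0, eta z0) by [].
have [U [oU Uw UH Uinj]] := P_inj_near hP (poincare_H3 S hw).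
have : \forall z \near z0, U (poincare S (z, eta z)) /\ 0 < eta z.
  apply: filterI; last by apply: (ceta [set y | 0 < y]); apply: open_nbhs_nbhs; split => //; exact: open_gt.
  have cs : (fun z => poincare S (z, eta z)) @ z0 --> poincare S (z0, eta z0).
    apply: (@continuous_comp _ _ _ (fun z => (z, eta z)) (poincare S)); last exact: continuous_poincare.
    exact: (cvg_pair (@cvg_id _ (nbhs z0)) ceta).
  by apply: cs; exact: open_nbhs_nbhs.
move=> /nbhs_ballP[e /= e0 he].
have [nu [volE inv box]] := hyperbolic_measure R.
set a := z0.1; set c := z0.2.
pose B0 := @low_box R (a - e) (a + e) (c - e) (c + e).
have [mB0 vB0] : measurable (B0 : set (RR * RR * RR)) /\ nu B0 = +oo%E by apply: box; rewrite ltrD2l gt0_cp //.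
have B0H : B0 `<=` @H3 R by move=> u [_ _ /andP[]].
have [mB vB] := inv S^-1%g B0 mB0 B0H.
set B := _ `&` _ in mB vB.
have : (nu B < +oo)%E; last by rewrite vB vB0 ltxx.
apply: (packed_set_volume volE inv mB) => [u []//|g u [hu B1] [hgu B2]].
set v := poincare S^-1%g u in B1.
have hv : H3 v by exact: poincare_H3.
have uE : u = poincare S v by rewrite poincareVK.
have gv : poincare S^-1%g (hact rho0 g u) = poincare (S^-1 * (rho0 g * S))%g v.
  by rewrite !poincareM ?uE //; exact: poincare_H3.
rewrite /= gv in B2.
set v' := poincare _ v in B2 gv.
have near (y : space) : B0 y -> U (poincare S (y.1, eta y.1)) /\ 0 < eta y.1.
  move=> [/andP[x1 x2] /andP[y1 y2] _]; apply: he; split; rewrite /ball /=.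
    by rewrite ltr_distlC x1 x2.
  by rewrite ltr_distlC y1 y2.
have [Uv ev] := near v B1; have [Uv' ev'] := near v' B2.
have hve : H3 (v.1, eta v.1) by [].
have E : hact rho0 g (poincare S (v.1, eta v.1)) = poincare S (v'.1, eta v'.1).
  rewrite -equi // /hact -!poincareM //; congr (poincare (SL2_mx _) _).
  by rewrite mulgA mulgV mul1g.
apply: (hact_free hol (UH _ Uv)); rewrite E; apply/esym/Uinj => //.
by rewrite -E (P_hact hol) //; exact: UH.
Qed.

Lemma poincare_triangular (A : SL2 C) u : ent A 1 0 = 0 ->
  poincare A u = (complex.Re ((ent A 0 0 * zcoord u + ent A 0 1) * conjc (ent A 1 1)) / sqmod (ent A 1 1),
    complex.Im ((ent A 0 0 * zcoord u + ent A 0 1) * conjc (ent A 1 1)) / sqmod (ent A 1 1),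
    u.2 / sqmod (ent A 1 1)).
Proof.
move=> A10; rewrite poincareE /pnum /pden A10 mul0r add0r conjc0 mulr0 mul0r addr0.
have -> : sqmod (0 : C) = 0 by apply/eqP; rewrite sqmod_eq0.
by rewrite mul0r addr0.
Qed.

(** After a conjugation, abelian holonomy is either diagonal, and preserves the cone
    t = |z|, or consists of translations, and preserves the horosphere t = 1.
    Either surface is excluded by the finite volume. *)
Theorem exterior_group_nonabelian : ~ (forall g h : Gamma, g * h = h * g)%g.
Proof.
move=> ab.
have com g h : (rho0 g * rho0 h = rho0 h * rho0 g)%g by rewrite -!gmulfM ab.
have [S [low [up|eqd]]] := @commuting_normal_form _ Gamma rho0 com.
- pose eta (z : R * R) := Num.sqrt (z.1 ^+ 2 + z.2 ^+ 2).
  apply: (@no_equivariant_section S eta (1, 0)).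
  + apply: (@continuous_comp _ _ _ (fun z : R * R => z.1 ^+ 2 + z.2 ^+ 2) Num.sqrt).
      by apply: cvgD; rewrite expr2; apply: cvgM; (exact: cvg_fst || exact: cvg_snd).
    exact: sqrt_continuous.
  + by rewrite /eta sqrtr_gt0 /= expr0n addr0 expr1n.
  + move=> g u hu eu; move: (S^-1 * (rho0 g * S))%g (low g) (up g) => A A10 A01.
    rewrite !poincare_triangular // A01 !addr0 /=.
    have -> : zcoord (u.1, eta u.1) = zcoord u by [].
    set w := ent A 0 0 * zcoord u * _; set d := sqmod _.
    have ad : ent A 0 0 * ent A 1 1 = 1 by have := SL2E A; rewrite A01 mul0r subr0.
    have d0 : 0 < d.
      rewrite lt0r sqmod_ge0 sqmod_eq0 andbT; apply/eqP => d0; move/eqP: ad.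
      by rewrite d0 mulr0 eq_sym oner_eq0.
    congr (_, _, _); rewrite /eta /=.
    have -> : (complex.Re w / d) ^+ 2 + (complex.Im w / d) ^+ 2 = (u.1.1 ^+ 2 + u.1.2 ^+ 2) / d ^+ 2.
      have <- : sqmod w = u.1.1 ^+ 2 + u.1.2 ^+ 2.
        rewrite -[RHS]/(sqmod (zcoord u)); apply: (@complexI R); rewrite !sqmodE /w !conjcM conjcK.
        have := congr1 (@conjc R) ad; rewrite conjcM conjc1 => ad'.
        set a := ent A 0 0 in ad ad' *; set e := ent A 1 1 in ad ad' *.
        transitivity ((a * e) * (conjc a * conjc e) * (zcoord u * conjc (zcoord u))); first by ring.
        by rewrite ad ad' !mul1r.
      by rewrite /sqmod; field; rewrite gt_eqF.
    by rewrite sqrtrM ?addr_ge0 ?sqr_ge0 // -exprVn sqrtr_sqr ger0_norm // invr_ge0 ltW.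
- apply: (@no_equivariant_section S (fun=> 1) (0, 0)) => //; first exact: cvg_cst.
  move=> g u hu _; move: (S^-1 * (rho0 g * S))%g (low g) (eqd g) => A A10 Ad.
  rewrite !poincare_triangular //=; congr (_, _, _).
  have := SL2E A; rewrite A10 mulr0 subr0 Ad => /(congr1 (fun x => sqmod x)).
  have -> : sqmod (1 : C) = 1 by rewrite /sqmod /= expr1n expr0n addr0.
  set d := ent A 1 1; have -> : sqmod (d * d) = sqmod d ^+ 2.
    by apply: (@complexI R); rewrite realcX !sqmodE conjcM; ring.
  by move=> /eqP; rewrite sqrp_eq1 ?sqmod_ge0 // => /eqP ->; rewrite divr1.
Qed.

End Nonabelian.

(** * Angles of plane vectors *)

Section Angles.
Variable R : realType.
Local Notation plane := (R * R)%type.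

Lemma turnD (a b : R) : turn (a + b) =
  ((turn a).1 * (turn b).1 - (turn a).2 * (turn b).2,
   (turn a).2 * (turn b).1 + (turn a).1 * (turn b).2).
Proof. by rewrite /turn mulrDr cosD sinD. Qed.

Lemma turnN (a : R) : turn (- a) = ((turn a).1, - (turn a).2).
Proof. by rewrite /turn mulrN cosN sinN. Qed.

Lemma turn_inj (a b : R) : turn a = turn b -> exists n : int, a = b + n%:~R.
Proof.
move=> ab; pose d := a - b; pose n := Num.floor d.
exists n; suff : d - n%:~R = 0 by rewrite /d; lra.
pose e := d - n%:~R.
have /andP[e0 e1] : 0 <= e < 1.
  by rewrite /e subr_ge0 ge_floor ltrBlDl; have := lt_succ_floor d; rewrite intrD addrC.
have te : turn e = (1, 0).
  have -> : e = d + (- n)%:~R by rewrite /e intrN.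
  rewrite turnDz /d turnD turnN ab /= -expr2.
  have := sqnorm_turn b; rewrite /sqnorm => sb.
  by congr (_, _); rewrite /= in sb *; [rewrite mulrN opprK -expr2 | ring].
rewrite -/e; have p0 := @pi_gt0 R; case: te => cose sine.
have [//|e_gt0] := eqVneq e 0; have {e0}e0 : 0 < e by rewrite lt0r e_gt0.
have [e2|e2] := ltP e (1 / 2).
  have : 0 < sin (2 * pi * e) by apply: sin_gt0_pi; apply/andP; split; nra.
  by rewrite sine ltxx.
have [e3|e3] := eqVneq e (1 / 2).
  move: cose; rewrite e3; have -> : 2 * pi * (1 / 2) = pi :> R by field.
  by rewrite cospi; lra.
have {}e2 : 1 / 2 < e by rewrite lt_neqAle eq_sym e3.
have : 0 < sin (2 * pi * e - pi) by apply: sin_gt0_pi; apply/andP; split; nra.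
by rewrite sinB sinpi cospi sine mulr0 subr0 mul0r ltxx.
Qed.

Lemma angle_scale (t : R) : 2 * pi * (t / (2 * pi)) = t.
Proof. by rewrite mulrC divfK // mulf_neq0 // gt_eqF // pi_gt0. Qed.

Lemma unit_turn (u : plane) : sqnorm u = 1 -> exists a, u = turn a.
Proof.
case: u => x y; rewrite /sqnorm /= => xy.
have xI : -1 <= x <= 1 by rewrite -ler_norml -(@expr_le1 _ 2) // real_normK ?num_real //; nra.
pose t := acos x.
have ct : cos t = x by rewrite acosK // in_itv.
have st : sin t = `|y|.
  rewrite sin_acos // -sqrtr_sqr; congr Num.sqrt; rewrite -xy; ring.
have [y0|y0] := leP 0 y.
  exists (t / (2 * pi)); rewrite /turn.
  rewrite angle_scale.
  by rewrite ct st ger0_norm.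
exists (- (t / (2 * pi))); rewrite turnN /turn /=.
rewrite angle_scale.
by rewrite ct st ltr0_norm // opprK.
Qed.

Lemma polar (u : plane) : exists a, u = (norm2 u * (turn a).1, norm2 u * (turn a).2).
Proof.
have [->|u0] := eqVneq u (0, 0).
  by exists 0; rewrite /norm2 sqnorm0 sqrtr0 !mul0r.
have n0 := norm2_gt0 u0.
have [|a ua] := @unit_turn (u.1 / norm2 u, u.2 / norm2 u).
  by have := norm2_sqr u; rewrite /sqnorm /= => h; rewrite !exprMn exprVn -mulrDl -h mulfV // gt_eqF // exprn_gt0.
exists a; rewrite -ua /=; case: (u) n0 => x y n0 /=; congr (_, _); field; rewrite gt_eqF //.
Qed.

(** In the frame turned by a0 the angle is the arctangent of a quotient. *)
Lemma local_angle (X : topologicalType) (z : X -> plane) x (rho a0 : R) :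
  0 < rho -> z x = (rho * (turn a0).1, rho * (turn a0).2) ->
  (\forall y \near x, {for y, continuous z}) ->
  exists a : X -> R, a x = a0 /\
    \forall y \near x, [/\ {for y, continuous a}, z y != (0, 0)
      & z y = (norm2 (z y) * (turn (a y)).1, norm2 (z y) * (turn (a y)).2)].
Proof.
move=> rho0 zx cz; move: (sqnorm_turn a0) zx; rewrite /sqnorm.
case ta : (turn a0) => [c s] s1 zx; rewrite /= in s1 zx.
pose re y := (z y).1 * c + (z y).2 * s.
pose im y := (z y).2 * c - (z y).1 * s.
have cre y : {for y, continuous z} -> {for y, continuous re}.
  move=> czy; apply: cvgD; apply: cvgM; try exact: cvg_cst.
  - by apply: (cvg_comp _ _ czy); exact: cvg_fst.
  - by apply: (cvg_comp _ _ czy); exact: cvg_snd.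
have cim y : {for y, continuous z} -> {for y, continuous im}.
  move=> czy; apply: cvgB; apply: cvgM; try exact: cvg_cst.
  - by apply: (cvg_comp _ _ czy); exact: cvg_snd.
  - by apply: (cvg_comp _ _ czy); exact: cvg_fst.
have rex : re x = rho by rewrite /re zx /= -!mulrA -mulrDr -!expr2 s1 mulr1.
have imx : im x = 0 by rewrite /im zx /=; ring.
pose a y := a0 + atan (im y / re y) / (2 * pi).
exists a; split.
  by rewrite /a imx mul0r atan0 mul0r addr0.
have re_near : \forall y \near x, 0 < re y.
  apply: (cre x (nbhs_singleton cz) [set r | 0 < r]); apply: open_nbhs_nbhs.
  by split; [exact: open_gt|rewrite rex].
apply: filterS2 cz re_near => y czy rey.
have zE : z y = (re y * c - im y * s, re y * s + im y * c).
  rewrite /re /im; case: (z y) => u v /=.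
  by congr (_, _); rewrite -[LHS]mulr1 -s1; ring.
have nE : sqnorm (z y) = re y ^+ 2 + im y ^+ 2.
  rewrite zE /sqnorm /=.
  by rewrite -[RHS]mulr1 -s1; ring.
have z0 : z y != (0, 0) by rewrite -sqnorm_eq0 nE gt_eqF // ltr_wpDr ?sqr_ge0 ?exprn_gt0.
split => //.
  apply: cvgD; first exact: cvg_cst.
  apply: cvgM; last exact: cvg_cst.
  apply: (@continuous_comp _ _ _ (fun y => im y / re y) (@atan R)); last exact: continuous_atan.
  apply: cvgM; first exact: cim.
  by apply: cvgV; [rewrite gt_eqF|exact: cre].
have tE : turn (atan (im y / re y) / (2 * pi)) = (re y / norm2 (z y), im y / norm2 (z y)).
  rewrite /turn angle_scale.
  have sE : Num.sqrt (1 + (im y / re y) ^+ 2) = norm2 (z y) / re y.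
    rewrite /norm2 nE.
    have -> : 1 + (im y / re y) ^+ 2 = (re y ^+ 2 + im y ^+ 2) * (re y)^-1 ^+ 2.
      by field; rewrite gt_eqF.
    by rewrite sqrtrM ?addr_ge0 ?sqr_ge0 // sqrtr_sqr ger0_norm // invr_ge0 ltW.
  have cE : cos (atan (im y / re y)) = re y / norm2 (z y).
    by rewrite cos_atan sE invf_div.
  rewrite cE; congr (_, _).
  have := atanK (im y / re y); rewrite /tan cE => /(congr1 (fun t => t * (re y / norm2 (z y)))).
  have n0 := norm2_gt0 z0.
  rewrite mulfVK; last by rewrite mulf_neq0 ?invr_eq0 ?gt_eqF.
  by move=> ->; field; rewrite !gt_eqF.
rewrite /a turnD tE ta {1}zE /=; have n0 := norm2_gt0 z0.
by congr (_, _); field; rewrite gt_eqF.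
Qed.

Lemma near_int_const (X : topologicalType) (f : X -> R) x :
  {for x, continuous f} -> (\forall y \near x, exists n : int, f y = n%:~R) ->
  exists n : int, \forall y \near x, f y = n%:~R.
Proof.
move=> cf hf; have [n fx] := nbhs_singleton hf; exists n.
have : \forall y \near x, `|f x - f y| < 1 by apply: cvgr_dist_lt.
apply: filterS2 hf => y [m ->]; rewrite fx -intrB => h; congr (_%:~R).
by move: h; rewrite -intr_norm ltrz1 -[1]add0r ltzD1 normr_le0 subr_eq0 => /eqP ->.
Qed.

End Angles.

(** * Homotopies in the filling *)

Section FillingKernel.
Variable R : realType.
Local Notation C := R[i].
Local Notation plane := (R * R)%type.
Local Notation space := (R * R * R)%type.
Variable K : framed_knot R.
Local Notation bp := (boundary_incl (base_pt K)).
Local Notation Gamma := (pi1_exterior K).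
Variables (P : space -> sphere3 R) (rho0 : rep C Gamma) (u0 : space).
Hypothesis hol : based_holonomy P rho0 u0.

Let hP : hyperbolic_structure K P. Proof. by case: hol. Qed.
Let hu0 : H3 u0. Proof. by case: hol. Qed.

(** A set-theoretic section of P identifies each orbit with the group. *)
Lemma orbit_coordinate : exists coord : space -> Gamma,
  forall g u, H3 u -> coord (hact rho0 g u) = (g * coord u)%g.
Proof.
pose sec x := xget u0 [set v | H3 v /\ P v = x].
pose coord u := xget 1%g [set g | u = hact rho0 g (sec (P u))].
have secP u : H3 u -> H3 (sec (P u)) /\ P (sec (P u)) = P u.
  by move=> hu; apply: (xgetPex u0 (P := [set v | H3 v /\ P v = P u])); exists u.
have coordP u : H3 u -> u = hact rho0 (coord u) (sec (P u)).
  move=> hu; have [hs Ps] := secP u hu.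
  by apply: (xgetPex 1%g (P := [set g | u = hact rho0 g (sec (P u))])); exact: (hact_transitive hol hs hu Ps).
exists coord => g u hu; have [hs _] := secP u hu.
apply: (hact_inj hol hs); have hgu := hact_H3 rho0 g hu.
rewrite hactM // -(coordP u hu) -[in X in hact _ _ X](P_hact hol g hu).
by rewrite -(coordP _ hgu).
Qed.

Variables (T : plane -> space) (c : int -> int -> Gamma).
Hypothesis hT : peripheral_lift P rho0 u0 T c.
Variables (p q r s : int) (Q : groupType) (phi : Gamma -> Q).
Hypothesis phiM : forall g h, phi (g * h)%g = (phi g * phi h)%g.
Hypothesis phi_slope : phi (c q p) = 1%g.

Let phi1 : phi 1%g = 1%g.
Proof. by apply: (mulgI (phi 1%g)); rewrite -phiM !mulg1. Qed.

Lemma phi_slope_mul (k : int) : phi (c (q * k) (p * k)) = 1%g.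
Proof.
have cM := peripheralM hol hT.
have c00 : c 0 0 = 1%g by apply: (mulgI (c 0 0)); rewrite -cM addr0 mulg1.
have pos (n : nat) : phi (c (q * n%:Z) (p * n%:Z)) = 1%g.
  elim: n => [|n IH]; first by rewrite !mulr0 c00.
  have -> : n.+1%:Z = 1 + n%:Z by rewrite -addn1 PoszD addrC.
  by rewrite !mulrDr !mulr1 cM phiM phi_slope IH mulg1.
case: k => n; first exact: pos.
rewrite NegzE !mulrN; apply: (mulIg (phi (c (q * n.+1%:Z) (p * n.+1%:Z)))).
by rewrite -phiM -cM !addNr c00 phi1 pos mulg1.
Qed.

(* A map from the plane to the filling, described through functions. On the solid
   torus k0 is the depth 1 - |w|^2, which is 1 on the core and 0 on the exterior; k1 and
   k2 are the coordinates along the core and in the disk, scaled by k0 so as to vanish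
   on the exterior. rH is the map followed by the retraction to the exterior along the
   rays of the disks, which makes sense off the core. *)
Variables (k0 : plane -> R) (k1 k2 : plane -> plane) (rH : plane -> sphere3 R).
Hypotheses (ck0 : continuous k0) (ck1 : continuous k1) (ck2 : continuous k2).
Hypothesis rH_cont : forall x, k0 x < 1 -> {for x, continuous rH}.
Hypothesis rH_off : forall x, k0 x < 1 -> ~ knot K (rH x).
Hypothesis k1_norm : forall x, 0 < k0 x -> sqnorm (k1 x) = k0 x ^+ 2.
Hypothesis k2_neq0 : forall x, 0 < k0 x < 1 -> k2 x != (0, 0).
Hypothesis rH_tube : forall x a b, 0 < k0 x < 1 ->
  k1 x = (norm2 (k1 x) * (turn a).1, norm2 (k1 x) * (turn a).2) ->
  k2 x = (norm2 (k2 x) * (turn b).1, norm2 (k2 x) * (turn b).2) ->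
  rH x = tube K (turn (s%:~R * a + q%:~R * b), turn (r%:~R * a + p%:~R * b)).

Let near_lt1 x : k0 x < 1 -> \forall y \near x, k0 y < 1.
Proof.
move=> kx; apply: (@ck0 x [set z | z < 1]); apply: open_nbhs_nbhs.
by split => //; exact: open_lt.
Qed.

Let near_gt0 x : 0 < k0 x -> \forall y \near x, 0 < k0 y.
Proof.
move=> kx; apply: (@ck0 x [set z | 0 < z]); apply: open_nbhs_nbhs.
by split => //; exact: open_gt.
Qed.

(* The lift, in the coordinates of the solid torus, of its boundary. *)
Let torus_lift (a b : R) := T (s%:~R * a + q%:~R * b, r%:~R * a + p%:~R * b).

Let torus_lift_H3 a b : H3 (torus_lift a b).
Proof. by have [_ h _ _ _] := hT; exact: h. Qed.

Let torus_liftDl a b (n : int) : torus_lift (a + n%:~R) b = hact rho0 (c (s * n) (r * n)) (torus_lift a b).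
Proof.
have [_ _ _ _ Tc] := hT; rewrite /torus_lift -Tc !intrM; congr (T (_, _)); ring.
Qed.

Let torus_liftDr a b (n : int) : torus_lift a (b + n%:~R) = hact rho0 (c (q * n) (p * n)) (torus_lift a b).
Proof.
have [_ _ _ _ Tc] := hT; rewrite /torus_lift -Tc !intrM; congr (T (_, _)); ring.
Qed.

Let torus_lift_continuous (a b : plane -> R) x : {for x, continuous a} -> {for x, continuous b} ->
  {for x, continuous (fun y => torus_lift (a y) (b y))}.
Proof.
move=> ca cb; have [cT _ _ _ _] := hT.
apply: (@continuous_comp _ _ _ (fun y => (s%:~R * a y + q%:~R * b y, r%:~R * a y + p%:~R * b y)) T); last exact: cT.
have comb (u v : R) : {for x, continuous (fun y => u * a y + v * b y)}.
  by apply: cvgD; apply: cvgM; (exact: cvg_cst || exact: ca || exact: cb).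
exact: (cvg_pair (comb _ _) (comb _ _)).
Qed.

(** Off the core the retracted map rH has local lifts to H3, which differ by elements of
    the group. Near the core a lift is read off from the angles of the point instead;
    the angle be in the disk cannot be continuous there, but changing it by an integer
    multiplies the lift by a power of the slope, which phi kills. So the images under phi
    of the orbit coordinates of all these lifts are local sections of a principal
    Q-bundle with flat structure over the plane, and flat_plane provides a global one, F.
    Following F around the boundary of the unit square compares phi [l] with 1. *)
Lemma filling_kernel (l : loop R (exterior K) bp) :
  (forall t, k0 (0, t) < 1) -> (forall t, rH (0, t) = set_val (l t)) ->
  (forall t, k0 (1, t) < 1) -> (forall t, rH (1, t) = set_val bp) ->
  (forall t, k0 (t, 0) < 1) -> (forall t, rH (t, 0) = set_val bp) ->
  (forall t, k0 (t, 1) < 1) -> (forall t, rH (t, 1) = set_val bp) ->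
  phi (pi1_class l) = 1%g.
Proof.
move=> k0l rl k0r rr k0b rb k0t rt.
have [coord coordM] := orbit_coordinate.
have [be hbe] : {be : plane -> R & forall y, k2 y =
    (norm2 (k2 y) * (turn (be y)).1, norm2 (k2 y) * (turn (be y)).2)}.
  apply: (choice (P := fun y b => k2 y = (norm2 (k2 y) * (turn b).1, norm2 (k2 y) * (turn b).2))) => y.
  exact: polar.
pose off_core (x : plane) (m : plane -> space) := \forall y \near x,
  [/\ H3 (m y), P (m y) = rH y & {for y, continuous m}].
pose on_core (x : plane) (m : plane -> space) := exists2 a : plane -> R,
  (\forall y \near x, [/\ {for y, continuous a}, 0 < k0 y &
     k1 y = (norm2 (k1 y) * (turn (a y)).1, norm2 (k1 y) * (turn (a y)).2)]) &
  (forall y, m y = torus_lift (a y) (be y)).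
have [m hm] : {m : plane -> plane -> space & forall x,
    (k0 x < 1 -> off_core x (m x)) /\ (1 <= k0 x -> on_core x (m x))}.
  apply: (choice (P := fun x m => (k0 x < 1 -> off_core x m) /\ (1 <= k0 x -> on_core x m))) => x.
  have [kx|kx] := ltP (k0 x) 1.
    have /(P_image hP)[v hv Pv] := rH_off kx.
    have [|L [_ hL]] := @local_lift _ _ _ hP _ rH x v _ hv Pv; last by exists L; split => // /le_lt_trans/(_ kx); rewrite ltxx.
    by apply: filterS (near_lt1 kx) => y; exact: rH_cont.
  have k0x : 0 < k0 x by exact: lt_le_trans ltr01 kx.
  have [a0 ha0] := polar (k1 x).
  have n0 : 0 < norm2 (k1 x) by rewrite sqrtr_gt0 k1_norm // exprn_gt0.
  have [|a [_ ha]] := local_angle n0 ha0 (z := k1).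
    by apply: (@filterS _ (nbhs x) _ setT) => [y _|]; [exact: ck1|exact: filterT].
  exists (fun y => torus_lift (a y) (be y)); split => // _; exists a => //.
  by apply: filterS2 ha (near_gt0 k0x) => y [].
(* The local sections to which flat_plane is applied, with Q acting on itself. *)
pose f (x y : plane) := phi (coord (m x y)).
have lift_off x : k0 x < 1 -> [/\ H3 (m x x), P (m x x) = rH x & {for x, continuous (m x)}].
  by move=> /(hm x).1/nbhs_singleton.
(* Where both are defined, two lifts of the same map have orbit coordinates that differ
   by a constant factor on the left. *)
have compare (X : topologicalType) (g : X -> plane) (L : X -> space) x t : {for t, continuous g} ->
    (\forall t' \near t, [/\ H3 (m x (g t')), P (m x (g t')) = P (L t') & {for t', continuous (m x \o g)}]) ->
    H3 (L t) -> {for t, continuous L} ->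
    exists h, \forall t' \near t, phi (coord (L t')) = (phi h * f x (g t'))%g.
  move=> cg hmx hL cL; have [H1 P1 c1] := nbhs_singleton hmx.
  have [h hE] := hact_transitive hol H1 hL P1.
  exists h; have : \forall t' \near t, L t' = hact rho0 h (m x (g t')).
    apply: (near_lift_eq hP) => //.
      by apply: (@continuous_comp _ _ _ (m x \o g) (hact rho0 h)) => //; exact: hact_continuous.
    by apply: filterS hmx => t' [H' P' _]; rewrite (P_hact hol).
  by apply: filterS2 hmx => t' [H' _ _] ->; rewrite coordM // phiM.
have f_loc x : \forall y \near x, True /\ exists2 c, True & \forall z \near y, f y z = (c * f x z)%g.
  have [kx|kx] := ltP (k0 x) 1.
    have := near_join ((hm x).1 kx); apply: filterS2 (near_lt1 kx) => y ky hy; split => //.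
    have [Hy Py cy] := lift_off y ky.
    have [|h hh] := compare _ id (m y) x y (@cvg_id _ _) _ Hy cy; last by exists (phi h).
    by apply: filterS2 hy ((hm y).1 ky) => z [? Pz ?] [_ Pz' _]; split => //; rewrite Pz Pz'.
  have [a ha ma] := (hm x).2 kx.
  have := near_join ha; apply: filterS => y hy; split => //.
  have [cay k0y k1y] := nbhs_singleton hy.
  have [ky|ky] := ltP (k0 y) 1; last first.
    have [a' ha' ma'] := (hm y).2 ky; have [ca'y _ _] := nbhs_singleton ha'.
    have [||n hn] := @near_int_const R _ (fun z => a' z - a z) y.
    - by apply: cvgB.
    - apply: filterS2 hy ha' => z [_ k0z e] [_ _ e'].
      have n0 : 0 < norm2 (k1 z) by rewrite sqrtr_gt0 k1_norm // exprn_gt0.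
      have [|n ->] := @turn_inj R (a' z) (a z); last by exists n; ring.
      move: e'; rewrite {1}e => -[e1 e2].
      rewrite [LHS]surjective_pairing [RHS]surjective_pairing; congr (_, _).
        by apply: (mulfI (lt0r_neq0 n0)).
      by apply: (mulfI (lt0r_neq0 n0)).
    exists (phi (c (s * n) (r * n))) => //; apply: filterS hn => z hn.
    rewrite /f ma' ma; have -> : a' z = a z + n%:~R by rewrite -hn; ring.
    by rewrite torus_liftDl coordM // phiM.
  have [Hy Py cy] := lift_off y ky.
  have n0 : 0 < norm2 (k2 y) by rewrite norm2_gt0 // k2_neq0 // k0y.
  have [|b [_ hb]] := local_angle n0 (hbe y) (z := k2).
    by apply: (@filterS _ (nbhs y) _ setT) => [z _|]; [exact: ck2|exact: filterT].
  pose mu z := torus_lift (a z) (b z).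
  have cmu z : {for z, continuous a} -> {for z, continuous b} -> {for z, continuous mu}.
    by move=> caz cbz; exact: torus_lift_continuous.
  have muP : \forall z \near y, P (mu z) = rH z.
    apply: filterS3 hy hb (near_lt1 ky) => z [_ k0z e] [_ _ e'] kz.
    have [_ _ PT _ _] := hT; rewrite PT /=; apply/esym; apply: rH_tube => //.
    by rewrite k0z.
  have [cby _ _] := nbhs_singleton hb.
  have [h hE] := hact_transitive hol (torus_lift_H3 (a y) (b y)) Hy (etrans (nbhs_singleton muP) (esym Py)).
  exists (phi h) => //.
  have : \forall z \near y, m y z = hact rho0 h (mu z).
    apply: (near_lift_eq hP) => //.
      by apply: (@continuous_comp _ _ _ mu (hact rho0 h)); [exact: cmu|apply: hact_continuous; exact: torus_lift_H3].
    by apply: filterS2 muP ((hm y).1 ky) => z Pz [_ Pz' _]; rewrite (P_hact hol h (torus_lift_H3 (a z) (b z))) Pz.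
  apply: filterS2 hb => z [_ z0 e] ez.
  have [|k bE] := @turn_inj R (b z) (be z).
    move: e; rewrite {1}(hbe z) => -[e1 e2].
    have nz : norm2 (k2 z) != 0 by rewrite gt_eqF // norm2_gt0.
    rewrite [LHS]surjective_pairing [RHS]surjective_pairing; congr (_, _).
      by apply: (mulfI nz).
    by apply: (mulfI nz).
  rewrite /f ez (coordM _ _ (torus_lift_H3 (a z) (b z))) phiM; congr (_ * _)%g.
  by rewrite /mu bE torus_liftDr (coordM _ _ (torus_lift_H3 (a z) (be z))) phiM phi_slope_mul mul1g ma.
have free (a y : Q) : True -> True -> (a * y)%g = y -> forall z : Q, True -> (a * z)%g = z.
  move=> _ _ e z _; suff -> : a = 1%g by rewrite mul1g.
  by apply: (mulIg y); rewrite e mul1g.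
have [F [fF _]] := @flat_plane R Q Q (fun a b => a * b)%g (fun=> True) (fun=> True)
  (fun y _ => mul1g y) (fun a b y _ _ _ => esym (mulgA a b y)) (fun _ _ _ _ => Logic.I)
  (fun _ _ => Logic.I) free f f_loc (0, 0) 1%g Logic.I.
(* Along a path off the core, F differs from the orbit coordinate of a lift by a factor
   on the left that is constant. *)
have edge (g : R -> plane) (L : R -> space) : continuous g -> continuous L -> (forall t, H3 (L t)) ->
    (forall t, k0 (g t) < 1) -> (forall t, P (L t) = rH (g t)) ->
    (F (g 0%R) * (phi (coord (L 0%R)))^-1 = F (g 1%R) * (phi (coord (L 1%R)))^-1)%g.
  move=> cg cL hL kg PL.
  pose S t := (F (g 0%R) * (phi (coord (L 0%R)))^-1 = F (g t) * (phi (coord (L t)))^-1)%g.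
  suff : S 0 <-> S 1 by move=> [h _]; exact: h.
  apply: (@locally_constant_itv R S 0 1 ler01) => t _.
  have [a _ ha] := fF (g t) Logic.I.
  have hga := cg t _ ha.
  have hmg : \forall t' \near t, [/\ H3 (m (g t) (g t')), P (m (g t) (g t')) = P (L t') &
      {for t', continuous (m (g t) \o g)}].
    have := cg t _ ((hm (g t)).1 (kg t)); apply: (@filterS _ (nbhs t)) => t' [h1 h2 h3].
    by split; rewrite ?PL //; exact: (continuous_comp (cg t') h3).
  have [h hh] := compare _ g L (g t) t (cg t) hmg (hL t) (cL t).
  have const : \forall t' \near t, (F (g t') * (phi (coord (L t')))^-1 = a * (phi h)^-1)%g.
    by apply: (@filterS2 _ (nbhs t)) hga hh => t' /(_ Logic.I) -> ->; rewrite invgM mulgA mulgK.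
  have := const; apply: filterS => t' e _; rewrite /S e.
  by rewrite (nbhs_singleton const).
have [L [cL hL PL L0 _]] : exists L : R -> space, [/\ continuous L, forall t, H3 (L t),
  forall t, P (L t) = set_val (l t), L 0 = u0 & L 1 = poincare (rho0 (pi1_class l)) u0] by case: hol.
have Pu0 : P u0 = set_val bp by case: hol.
have cx (b : R) : continuous (fun t : R => (t, b)).
  by apply: continuous_pair; [move=> ?; exact: cvg_id|exact: cst_continuous].
have cy (b : R) : continuous (fun t : R => (b, t)).
  by apply: continuous_pair; [exact: cst_continuous|move=> ?; exact: cvg_id].
have e1 := edge (fun t => (t, 0)) (cst u0) (cx 0) (@cst_continuous _ _ _) (fun=> hu0) k0b (fun t => etrans Pu0 (esym (rb t))).
have e2 := edge (fun t => (t, 1)) (cst u0) (cx 1) (@cst_continuous _ _ _) (fun=> hu0) k0t (fun t => etrans Pu0 (esym (rt t))).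
have e3 := edge (fun t => (1, t)) (cst u0) (cy 1) (@cst_continuous _ _ _) (fun=> hu0) k0r (fun t => etrans Pu0 (esym (rr t))).
have := edge (fun t => (0, t)) L (cy 0) cL hL k0l (fun t => etrans (PL t) (esym (rl t))).
rewrite L0 (loop_lift_end hol cL hL PL L0) coordM // phiM invgM.
move: e1 e2 e3 => /= /mulIg e1 /mulIg e2 /mulIg e3.
rewrite e1 e3 -e2 mulgA -[X in X = _]mulg1 => /mulgI/esym.
by move=> /(congr1 (fun x => x^-1)%g); rewrite invgK invg1.
Qed.

End FillingKernel.

(** * Quotient groups *)

Section QuotientGroup.
Variables (G : groupType) (N : G -> Prop).
Hypotheses (N1 : N 1%g) (NM : forall g h, N g -> N h -> N (g * h)%g)
  (NV : forall g, N g -> N g^-1%g) (NJ : forall g h, N g -> N (h^-1 * (g * h))%g).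

Let rel g h := `[< N (g^-1 * h)%g >].

Let rel_refl : reflexive rel.
Proof. by move=> g; apply/asboolP; rewrite mulVg. Qed.

Let rel_sym : symmetric rel.
Proof.
have h g g' : N (g^-1 * g')%g -> N (g'^-1 * g)%g by move/NV; rewrite invgM invgK.
by move=> g g'; apply/asbool_equiv_eq; split; exact: h.
Qed.

Let rel_trans : transitive rel.
Proof.
move=> g f h /asboolP fg /asboolP gh; apply/asboolP.
by have := NM fg gh; rewrite mulgA mulgK.
Qed.

Let rel_equiv := EquivRel rel rel_refl rel_sym rel_trans.

Definition quotient_group : Type := {eq_quot rel_equiv}.
HB.instance Definition _ := Choice.on quotient_group.

Definition quotient_class (g : G) : quotient_group := \pi_({eq_quot rel_equiv}) g.

Let classP g h : quotient_class g = quotient_class h <-> N (g^-1 * h)%g.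
Proof.
split=> [/(eqquotP {eq_quot rel_equiv})/asboolP //|gh].
by apply/(eqquotP {eq_quot rel_equiv})/asboolP.
Qed.

Let rep (a : quotient_group) : G := repr (a : {eq_quot rel_equiv}).

Let repK a : quotient_class (rep a) = a. Proof. exact: reprK. Qed.

Let mul a b := quotient_class (rep a * rep b).
Let inv a := quotient_class (rep a)^-1%g.

Let classM g h : mul (quotient_class g) (quotient_class h) = quotient_class (g * h)%g.
Proof.
apply/classP; set g' := rep _; set h' := rep _.
have Ng : N (g'^-1 * g)%g by apply/classP; rewrite repK.
have Nh : N (h'^-1 * h)%g by apply/classP; rewrite repK.
rewrite invgM; have := NM Nh (NJ h Ng).
have -> : (h'^-1 * h * (h^-1 * ((g'^-1 * g) * h)) = h'^-1 * g'^-1 * (g * h))%g; last by [].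
by rewrite !mulgA mulgK.
Qed.

Let classV g : inv (quotient_class g) = quotient_class g^-1%g.
Proof.
apply/classP; set g' := rep _; rewrite invgK.
have Ng : N (g'^-1 * g)%g by apply/classP; rewrite repK.
have := NJ g'^-1%g (NV Ng); rewrite invgK invgM invgK.
by rewrite !mulgA mulgK.
Qed.

Let mulA : associative mul.
Proof. by move=> a b c; rewrite -[a]repK -[b]repK -[c]repK !classM mulgA. Qed.
Let mul1 : left_id (quotient_class 1%g) mul.
Proof. by move=> a; rewrite -[a]repK classM mul1g. Qed.
Let mulg1' : right_id (quotient_class 1%g) mul.
Proof. by move=> a; rewrite -[a]repK classM mulg1. Qed.
Let mulV : left_inverse (quotient_class 1%g) inv mul.
Proof. by move=> a; rewrite -[a]repK classV classM mulVg. Qed.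
Let mulgV' : right_inverse (quotient_class 1%g) inv mul.
Proof. by move=> a; rewrite -[a]repK classV classM mulgV. Qed.

HB.instance Definition _ := isGroup.Build quotient_group mulA mul1 mulg1' mulV mulgV'.

Lemma quotient_map : exists (Q : groupType) (phi : G -> Q),
  (forall g h, phi (g * h)%g = (phi g * phi h)%g) /\ (forall g, phi g = 1%g <-> N g).
Proof.
exists quotient_group, quotient_class; split => [g h|g]; first by rewrite -classM.
split => [/esym/classP|Ng]; first by rewrite invg1 mul1g.
by apply/esym/classP; rewrite invg1 mul1g.
Qed.

End QuotientGroup.

(** * Maps on the Dehn filling *)

Section Filling.
Variable R : realType.
Local Notation C := R[i].
Local Notation plane := (R * R)%type.
Local Notation space := (R * R * R)%type.
Variable K : framed_knot R.
Variables p q r s : int.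
Local Notation bp := (boundary_incl (base_pt K)).
Local Notation pieces := {b & filling_piece K b}.
Local Notation W := (dehn_filling K p q r s).
Local Notation Q := {eq_quot (glue_equiv K p q r s)}.
Local Notation solid := (@solid_torus R).

Definition piece_fun (Y : Type) (f : exterior K -> Y) (g : solid -> Y) (x : pieces) : Y :=
  let: existT b y := x in
  (if b as b return filling_piece K b -> Y then f else g) y.

Definition filling_fun (Y : Type) (f : exterior K -> Y) (g : solid -> Y) (w : W) : Y :=
  piece_fun f g (repr (w : Q)).

Definition filling_exterior (x : exterior K) : W := \pi_Q (in_exterior x).
Definition filling_solid (u : solid) : W := \pi_Q (in_solid K u).

Definition glue_compatible (Y : Type) (f : exterior K -> Y) (g : solid -> Y) :=
  forall (a b : R) (u : solid), set_val u = (turn a, turn b) ->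
    g u = f (exterior_pt K (s%:~R * a + q%:~R * b) (r%:~R * a + p%:~R * b)).

Lemma filling_funE (Y : Type) (f : exterior K -> Y) (g : solid -> Y) x : glue_compatible f g ->
  filling_fun f g (\pi_Q x) = piece_fun f g x.
Proof.
move=> fg; suff gen y z : clos_refl_sym_trans pieces (@Defs.glue R K p q r s) y z ->
    piece_fun f g y = piece_fun f g z.
  have : \pi_Q (repr (\pi_Q x)) = \pi_Q x by rewrite reprK.
  by rewrite /filling_fun => /(eqquotP Q)/asboolP; exact: gen.
elim => // [_ _ [a b u /fg]//|? ? ? _ -> _ -> //].
Qed.

Lemma filling_funM (Y : Type) (f : exterior K -> Y) (g : solid -> Y) x : glue_compatible f g ->
  filling_fun f g (filling_exterior x) = f x.
Proof. by move=> fg; rewrite /filling_exterior filling_funE. Qed.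

Lemma filling_funS (Y : Type) (f : exterior K -> Y) (g : solid -> Y) u : glue_compatible f g ->
  filling_fun f g (filling_solid u) = g u.
Proof. by move=> fg; rewrite /filling_solid filling_funE. Qed.

Lemma filling_cases (w : W) : (exists x, w = filling_exterior x) \/ (exists u, w = filling_solid u).
Proof.
rewrite -[w](@reprK _ Q); case: (repr _) => -[] y; [left|right]; by exists y.
Qed.

Lemma filling_openP (U : set W) : open (filling_exterior @^-1` U) ->
  open (filling_solid @^-1` U) -> open U.
Proof.
move=> oM oS; suff : open (\pi_Q @^-1` U : set pieces) by [].
by apply/sigT_openP => -[].
Qed.

Lemma filling_fun_continuous (Y : topologicalType) (f : exterior K -> Y) (g : solid -> Y) :
  glue_compatible f g -> continuous f -> continuous g -> continuous (filling_fun f g).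
Proof.
move=> fg cf cg; apply/continuousP => A oA; apply: filling_openP.
  have -> : filling_exterior @^-1` (filling_fun f g @^-1` A) = f @^-1` A.
    by apply/seteqP; split => x /=; rewrite filling_funM.
  exact: (continuousP f).1.
have -> : filling_solid @^-1` (filling_fun f g @^-1` A) = g @^-1` A.
  by apply/seteqP; split => x /=; rewrite filling_funS.
exact: (continuousP g).1.
Qed.

Lemma filling_exterior_continuous : continuous filling_exterior.
Proof.
apply/continuousP => A oA.
have : open (\pi_Q @^-1` A : set pieces) by [].
by move=> /sigT_openP/(_ true).
Qed.

HB.instance Definition _ :=
  isContinuous.Build (exterior K) W filling_exterior filling_exterior_continuous.

End Filling.

(** * The kernel of surgery *)

Section FillingSurgery.
Variable R : realType.
Local Notation C := R[i].
Local Notation plane := (R * R)%type.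
Local Notation space := (R * R * R)%type.
Variable K : framed_knot R.
Variables p q r s : int.
Local Notation bp := (boundary_incl (base_pt K)).
Local Notation Gamma := (pi1_exterior K).
Local Notation W := (dehn_filling K p q r s).
Local Notation solid := (@solid_torus R).
Local Notation fill_fun := (@filling_fun R K p q r s).
Local Notation compatible := (@glue_compatible R K p q r s).

Definition angle (u : plane) : R :=
  xget 0 [set a | u = (norm2 u * (turn a).1, norm2 u * (turn a).2)].

Lemma angleP u : u = (norm2 u * (turn (angle u)).1, norm2 u * (turn (angle u)).2).
Proof.
have [a ua] := polar u.
by apply: (xgetPex 0 (P := [set a | u = (norm2 u * (turn a).1, norm2 u * (turn a).2)])); exists a.
Qed.

Lemma angle_unique u a : u != (0, 0) -> u = (norm2 u * (turn a).1, norm2 u * (turn a).2) ->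
  exists n : int, angle u = a + n%:~R.
Proof.
move=> u0 ua; have n0 : norm2 u != 0 by rewrite gt_eqF // norm2_gt0.
apply: turn_inj; have := angleP u; rewrite {1}ua => -[/(mulfI n0) e1 /(mulfI n0) e2].
by rewrite /turn e1 e2.
Qed.

(** The end on the boundary torus of the ray of the disk through u, in the coordinates of
    the exterior. On the core the direction of the ray is a junk value. *)
Definition ray_end (u : plane * plane) : sphere3 R :=
  tube K (turn (s%:~R * angle u.1 + q%:~R * angle u.2), turn (r%:~R * angle u.1 + p%:~R * angle u.2)).

Lemma ray_endE u a b : u.1 != (0, 0) -> u.2 != (0, 0) ->
  u.1 = (norm2 u.1 * (turn a).1, norm2 u.1 * (turn a).2) ->
  u.2 = (norm2 u.2 * (turn b).1, norm2 u.2 * (turn b).2) ->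
  ray_end u = tube K (turn (s%:~R * a + q%:~R * b), turn (r%:~R * a + p%:~R * b)).
Proof.
move=> u1 u2 ua ub; have [n an] := angle_unique u1 ua; have [m bm] := angle_unique u2 ub.
rewrite /ray_end an bm; congr (tube K (_, _)).
  rewrite -[RHS](turnDz _ (s * n + q * m)); congr turn; rewrite intrD !intrM; ring.
rewrite -[RHS](turnDz _ (r * n + p * m)); congr turn; rewrite intrD !intrM; ring.
Qed.

(** The depth in the solid torus extends by 0 to the exterior, and so do the coordinates
    of the solid torus once they are multiplied by it. *)
Definition depth : W -> R := fill_fun (cst 0) (fun u => 1 - sqnorm (set_val u).2).

Definition depth_core : W -> plane := fill_fun (cst (0, 0))
  (fun u => ((1 - sqnorm (set_val u).2) * (set_val u).1.1, (1 - sqnorm (set_val u).2) * (set_val u).1.2)).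

Definition depth_ray : W -> plane := fill_fun (cst (0, 0))
  (fun u => ((1 - sqnorm (set_val u).2) * (set_val u).2.1, (1 - sqnorm (set_val u).2) * (set_val u).2.2)).

Definition filling_ray_end : W -> sphere3 R := fill_fun set_val (fun u => ray_end (set_val u)).

Lemma norm2_turn a : norm2 (turn a : plane) = 1.
Proof. by rewrite /norm2 sqnorm_turn sqrtr1. Qed.

Lemma turn_neq0 a : (turn a : plane) != (0, 0).
Proof. by rewrite -sqnorm_eq0 sqnorm_turn oner_eq0. Qed.

Lemma depth_compatible : compatible (cst 0) (fun u => 1 - sqnorm (set_val u).2).
Proof. by move=> a b u -> /=; rewrite sqnorm_turn subrr. Qed.

Lemma depth_core_compatible : compatible (cst (0, 0))
  (fun u => ((1 - sqnorm (set_val u).2) * (set_val u).1.1, (1 - sqnorm (set_val u).2) * (set_val u).1.2)).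
Proof. by move=> a b u -> /=; rewrite sqnorm_turn subrr !mul0r. Qed.

Lemma depth_ray_compatible : compatible (cst (0, 0))
  (fun u => ((1 - sqnorm (set_val u).2) * (set_val u).2.1, (1 - sqnorm (set_val u).2) * (set_val u).2.2)).
Proof. by move=> a b u -> /=; rewrite sqnorm_turn subrr !mul0r. Qed.

Lemma ray_end_compatible : compatible set_val (fun u => ray_end (set_val u)).
Proof.
by move=> a b u ->; rewrite (@ray_endE _ a b) ?turn_neq0 ?norm2_turn ?mul1r -?surjective_pairing.
Qed.

Let cval : continuous (set_val : solid -> plane * plane).
Proof. exact: initial_continuous. Qed.
Let cval1 : continuous (fun u : solid => (set_val u).1).
Proof. by apply: continuous_compose cval _; exact: continuous_fst. Qed.
Let cval2 : continuous (fun u : solid => (set_val u).2).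
Proof. by apply: continuous_compose cval _; exact: continuous_snd. Qed.
Let cdepth : continuous (fun u : solid => 1 - sqnorm (set_val u).2).
Proof. by apply: continuous_csub; apply: continuous_compose cval2 _; exact: sqnorm_continuous. Qed.
Let cscaled (f : solid -> plane) : continuous f ->
  continuous (fun u : solid => ((1 - sqnorm (set_val u).2) * (f u).1, (1 - sqnorm (set_val u).2) * (f u).2)).
Proof.
move=> cf; have c1 : continuous (fun u => (f u).1) by exact: continuous_compose cf (@continuous_fst _ _).
have c2 : continuous (fun u => (f u).2) by exact: continuous_compose cf (@continuous_snd _ _).
by apply: continuous_pair => u; [exact: (cvgM (@cdepth u) (c1 u))|exact: (cvgM (@cdepth u) (c2 u))].
Qed.

Lemma depth_continuous : continuous depth.
Proof. exact: filling_fun_continuous depth_compatible (@cst_continuous _ _ _) cdepth. Qed.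

Lemma depth_core_continuous : continuous depth_core.
Proof. exact: filling_fun_continuous depth_core_compatible (@cst_continuous _ _ _) (cscaled cval1). Qed.

Lemma depth_ray_continuous : continuous depth_ray.
Proof. exact: filling_fun_continuous depth_ray_compatible (@cst_continuous _ _ _) (cscaled cval2). Qed.

Lemma solid1_neq0 (u : solid) : (set_val u).1 != (0, 0).
Proof. by have [u1 _] := set_valP u; rewrite -sqnorm_eq0 u1 oner_eq0. Qed.

Lemma ray_end_continuous (u : solid) : (set_val u).2 != (0, 0) ->
  {for u, continuous (fun v : solid => ray_end (set_val v))}.
Proof.
move=> u2.
have [|a [_ ha]] := local_angle (norm2_gt0 (solid1_neq0 u)) (angleP (set_val u).1) (z := fun v : solid => (set_val v).1).
  by apply: (@filterS _ (nbhs u) _ setT) => [v _|]; [exact: cval1|exact: filterT].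
have [|b [_ hb]] := local_angle (norm2_gt0 u2) (angleP (set_val u).2) (z := fun v : solid => (set_val v).2).
  by apply: (@filterS _ (nbhs u) _ setT) => [v _|]; [exact: cval2|exact: filterT].
pose t (v : solid) := tube K (turn (s%:~R * a v + q%:~R * b v), turn (r%:~R * a v + p%:~R * b v)).
have E : \forall v \near u, ray_end (set_val v) = t v.
  by apply: filterS2 ha hb => v [_ v1 va] [_ v2 vb]; exact: ray_endE.
have ct : {for u, continuous t}.
  have [ca _ _] := nbhs_singleton ha; have [cb _ _] := nbhs_singleton hb.
  have comb (x y : R) : {for u, continuous (fun v => turn (x * a v + y * b v))}.
    apply: (@continuous_comp _ _ _ (fun v => x * a v + y * b v) (@turn R)); last exact: continuous_turn.
    exact: (cvgD (cvgM (cvg_cst x) ca) (cvgM (cvg_cst y) cb)).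
  apply: (@tube_comp_continuous _ _ _ (fun v => (turn (s%:~R * a v + q%:~R * b v), turn (r%:~R * a v + p%:~R * b v)))).
    exact: (cvg_pair (comb _ _) (comb _ _)).
  by apply: (@filterS _ (nbhs u) _ setT) => [v _|]; [exact: circle_disk_turn|exact: filterT].
move=> A; rewrite (nbhs_singleton E) => /ct hA.
by apply: (@filterS2 _ (nbhs u)) E hA => v /= ->.
Qed.

Lemma filling_ray_end_continuous w : depth w < 1 -> {for w, continuous filling_ray_end}.
Proof.
move=> w1 A; rewrite nbhsE => -[B [oB Bw] BA].
pose V := [set v : W | depth v < 1 /\ B (filling_ray_end v)].
suff oV : open V by apply: (@filterS _ _ _ V) => [v [_ /BA]//|]; apply: open_nbhs_nbhs.
apply: filling_openP.
  have -> : (@filling_exterior R K p q r s) @^-1` V = set_val @^-1` B.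
    apply/seteqP; split => x /=; rewrite /V /= /depth /filling_ray_end.
      by rewrite !filling_funM; [case|exact: ray_end_compatible|exact: depth_compatible].
    by rewrite !filling_funM ?ltr01; [|exact: ray_end_compatible|exact: depth_compatible].
  by apply: open_comp => // x _; exact: initial_continuous.
rewrite openE => u; rewrite /V /= /depth /filling_ray_end.
rewrite (filling_funS _ ray_end_compatible) (filling_funS _ depth_compatible).
move=> [u1 Bu]; rewrite /interior.
have u2 : (set_val u).2 != (0, 0).
  by apply/eqP => e; move: u1; rewrite e sqnorm0 subr0 ltxx.
have hB : \forall v \near u, B (ray_end (set_val v)).
  by apply: (ray_end_continuous u2); exact: open_nbhs_nbhs.
have h1 : \forall v \near u, 1 - sqnorm (set_val v).2 < 1.
  by apply: (@cdepth u [set x | x < 1]); apply: open_nbhs_nbhs; split => //; exact: open_lt.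
apply: filterS2 hB h1 => v Bv v1.
by rewrite /= (filling_funS _ ray_end_compatible) (filling_funS _ depth_compatible).
Qed.

Variables (P : space -> sphere3 R) (rho0 : rep C Gamma) (u0 : space).
Hypothesis hol : based_holonomy P rho0 u0.
Variables (T : plane -> space) (c : int -> int -> Gamma).
Hypothesis hT : peripheral_lift P rho0 u0 T c.

Local Notation iota := (@filling_exterior R K p q r s).

(** This is the half of van Kampen's theorem that bounds the kernel from above: a
    null-homotopy in the filling is analysed by filling_kernel, for the quotient by N. *)
Theorem surgery_kernel (N : Gamma -> Prop) : N 1%g ->
  (forall g h, N g -> N h -> N (g * h)%g) -> (forall g, N g -> N g^-1%g) ->
  (forall g h, N g -> N (h^-1 * (g * h))%g) -> N (c q p) ->
  forall g, pi1_map R iota bp g = 1%g -> N g.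
Proof.
move=> N1 NM NV NJ Nslope g.
have [Q [phi [phiM phiP]]] := quotient_map N1 NM NV NJ.
rewrite -[g]pi1_reprK; set l := pi1_repr g => hg; apply/phiP.
have [H [cH H0 H1 Hb]] : homotopic (loop_map iota l) (loop_cst R (iota bp)).
  by apply/pi1_classP; rewrite -pi1_map_class.
have phi_slope : phi (c q p) = 1%g by apply/phiP.
have depthM x : depth (iota x) = 0 by rewrite /depth filling_funM //; exact: depth_compatible.
have endM x : filling_ray_end (iota x) = set_val x.
  by rewrite /filling_ray_end filling_funM //; exact: ray_end_compatible.
have cases (w : W) : (exists x, w = iota x) \/
    exists u : solid, [/\ depth w = 1 - sqnorm (set_val u).2, filling_ray_end w = ray_end (set_val u),
      depth_core w = ((1 - sqnorm (set_val u).2) * (set_val u).1.1, (1 - sqnorm (set_val u).2) * (set_val u).1.2)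
    & depth_ray w = ((1 - sqnorm (set_val u).2) * (set_val u).2.1, (1 - sqnorm (set_val u).2) * (set_val u).2.2)].
  case: (filling_cases w) => -[x ->]; [by left; exists x|right; exists x].
  rewrite /depth /filling_ray_end /depth_core /depth_ray.
  by rewrite (filling_funS _ ray_end_compatible) (filling_funS _ depth_compatible)
    (filling_funS _ depth_core_compatible) (filling_funS _ depth_ray_compatible).
have edge x y : H x = iota y -> (depth (H x) < 1) /\ filling_ray_end (H x) = set_val y.
  by move=> ->; rewrite depthM ltr01 endM.
have H0' t : H (0, t) = iota (l t) by rewrite H0 loop_mapE.
have H1' t : H (1, t) = iota bp by rewrite H1.
have Hb0 t : H (t, 0) = iota bp by rewrite Hb //; left.
have Hb1 t : H (t, 1) = iota bp by rewrite Hb //; right.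
have scaled (k : R) (v : plane) : sqnorm (k * v.1, k * v.2) = k ^+ 2 * sqnorm v by exact: sqnormZ.
have unscale (k : R) (v : plane) a : 0 < k ->
    (k * v.1, k * v.2) = (norm2 (k * v.1, k * v.2) * (turn a).1, norm2 (k * v.1, k * v.2) * (turn a).2) ->
    v = (norm2 v * (turn a).1, norm2 v * (turn a).2).
  move=> k0; rewrite {1 2}/norm2 scaled sqrtrM ?sqr_ge0 // sqrtr_sqr gtr0_norm // -!mulrA.
  by move=> [/(mulfI (lt0r_neq0 k0)) e1 /(mulfI (lt0r_neq0 k0)) e2]; rewrite -e1 -e2 -surjective_pairing.
apply: (@filling_kernel R K P rho0 u0 hol T c hT p q r s Q phi phiM phi_slope
  (depth \o H) (depth_core \o H) (depth_ray \o H) (filling_ray_end \o H)) => /=.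
- by apply: continuous_compose cH _; exact: depth_continuous.
- by apply: continuous_compose cH _; exact: depth_core_continuous.
- by apply: continuous_compose cH _; exact: depth_ray_continuous.
- move=> x hx; apply: continuous_comp; [exact: cH|exact: filling_ray_end_continuous].
- move=> x /=; case: (cases (H x)) => [[y ->] _|[u [-> -> _ _]] u1].
    by rewrite endM; apply: exterior_off_knot; exact: set_valP.
  exact: torus_off_knot.
- move=> x /=; case: (cases (H x)) => [[y ->]|[u [-> _ -> _]] u1]; first by rewrite depthM ltxx.
  by rewrite scaled; have [-> _] := set_valP u; rewrite mulr1.
- move=> x /=; case: (cases (H x)) => [[y ->]|[u [-> _ _ ->]] /andP[u0' u1]]; first by rewrite depthM ltxx.
  rewrite -sqnorm_eq0 scaled mulf_neq0 ?expf_neq0 ?gt_eqF //.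
  by move: u1; rewrite ltrBlDr ltrDl.
- move=> x a b /=; case: (cases (H x)) => [[y ->]|[u [-> -> -> ->]] /andP[u0' u1]]; first by rewrite depthM ltxx.
  move=> /(unscale _ _ _ u0') e1 /(unscale _ _ _ u0') e2; apply: ray_endE => //.
    exact: solid1_neq0.
  by rewrite -sqnorm_eq0 gt_eqF //; move: u1; rewrite ltrBlDr ltrDl.
- by move=> t; case: (edge _ _ (H0' t)).
- by move=> t; case: (edge _ _ (H0' t)).
- by move=> t; case: (edge _ _ (H1' t)).
- by move=> t; case: (edge _ _ (H1' t)).
- by move=> t; case: (edge _ _ (Hb0 t)).
- by move=> t; case: (edge _ _ (Hb0 t)).
- by move=> t; case: (edge _ _ (Hb1 t)).
- by move=> t; case: (edge _ _ (Hb1 t)).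
Qed.

End FillingSurgery.

(** * Cyclic fillings *)

(** The image of f is a subgroup of a cyclic group, generated by the power of the
    generator with the least positive exponent. *)
Lemma cyclic_image (G H : groupType) (f : {multiplicative G -> H}) : cyclic_group H ->
  exists x, forall g, exists n, f g = (f x ^+ n)%g \/ f g = (f x ^- n)%g.
Proof.
move=> [w hw].
have pos g : exists n, f g = (w ^+ n)%g \/ f g^-1%g = (w ^+ n)%g.
  have [n [e|e]] := hw (f g); exists n; [by left|right].
  by rewrite homV e invgK.
have [[k [k0 [x xk]]]|none] := pselect (exists k, (0 < k)%N /\ exists x, f x = (w ^+ k)%g); last first.
  exists 1%g => g; exists 0%N; left; rewrite expg0.
  have [[|n] [e|e]] := pos g; first by rewrite e.
  - by rewrite -[g]invgK homV e expg0 invg1.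
  - by case: none; exists n.+1; split => //; exists g.
  - by case: none; exists n.+1; split => //; exists g^-1%g.
have ex : exists k, (0 < k)%N && `[< exists x, f x = (w ^+ k)%g >].
  by exists k; rewrite k0; apply/asboolP; exists x.
case: (ex_minnP ex) => {k0 xk x}k /andP[k0 /asboolP[x xk]] kmin; exists x.
have main g n : f g = (w ^+ n)%g -> f g = (f x ^+ (n %/ k))%g.
  move=> e; have := ltn_pmod n k0; case nk : (n %% k)%N => [|j] jk.
    by rewrite e xk -expgnA mulnC {1}(divn_eq n k) nk addn0.
  suff /kmin : (0 < j.+1)%N && `[< exists y, f y = (w ^+ j.+1)%g >] by rewrite leqNgt jk.
  apply/andP; split => //; apply/asboolP; exists ((x ^+ (n %/ k))^-1 * g)%g.
  rewrite gmulfM homV homX xk e -expgnA {2}(divn_eq n k) nk [(_ %/ _ * _)%N]mulnC expgnDr.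
  by rewrite mulgA mulVg mul1g.
move=> g; have [n [/main e|/main e]] := pos g; exists (n %/ k)%N; [by left|right].
by rewrite -e homV invgK.
Qed.

Section CyclicFilling.
Variable R : realType.
Local Notation space := (R * R * R)%type.
Variable K : framed_knot R.
Local Notation Gamma := (pi1_exterior K).
Variables (P : space -> sphere3 R) (rho0 : rep R[i] Gamma) (u0 : space).
Hypothesis hol : based_holonomy P rho0 u0.
Variables (T : R * R -> space) (c : int -> int -> Gamma).
Hypothesis hT : peripheral_lift P rho0 u0 T c.
Variables p q r s : int.

(** The elements with a central image under rho form a normal subgroup. By surgery_kernel
    it contains the kernel of the map to the group of the filling. Hence the image of rho
    is cyclic modulo central elements, and such a group is abelian. *)
Lemma cyclic_filling_abelian (F : fieldType) (rho : rep F Gamma) :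
  cyclic_group (pi1_filling K p q r s) ->
  (forall A, (rho (c q p) * A = A * rho (c q p))%g) ->
  forall g h, (rho g * rho h = rho h * rho g)%g.
Proof.
move=> hcyc central.
pose N g := forall A, (rho g * A = A * rho g)%g.
pose bp := boundary_incl (base_pt K); pose iota := @filling_exterior R K p q r s.
pose f : {multiplicative pi1 R _ bp -> pi1 R _ (iota bp)} := pi1_map R iota bp.
have NJ g h : N g -> N (h^-1 * (g * h))%g.
  by move=> Ng A; rewrite !repM Ng mulgA homV mulVg mul1g.
have NV g : N g -> N g^-1%g.
  move=> Ng A; apply: (mulgI (rho g)); rewrite homV mulgA mulgV mul1g mulgA Ng -mulgA mulgV mulg1 //.
have N1 : N (1%g : Gamma) by move=> A; rewrite hom1 mulg1 mul1g.
have NM (g h : Gamma) : N g -> N h -> N (g * h)%g.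
  by move=> Ng Nh A; rewrite repM -mulgA Nh !mulgA Ng.
have ker (g : Gamma) : f g = 1%g -> N g.
  have SK := @surgery_kernel R K p q r s P rho0 u0 hol T c hT N N1 NM NV NJ central g.
  exact: SK.
have f_inj g h : f g = f h -> N (h^-1 * g)%g.
  move=> e; apply: ker; rewrite gmulfM; apply: (mulgI (f h)).
  by rewrite homV mulgA mulgV mul1g mulg1.
have [x hx] := cyclic_image f hcyc.
(* B g is the power of x that has the same image as g in the filling. *)
have [B hB] : {B : Gamma -> Gamma & forall g, N ((B g)^-1 * g)%g /\
    (forall A, (rho x * A = A * rho x)%g -> (rho (B g) * A = A * rho (B g))%g)}.
  apply: (choice (P := fun g y => N (y^-1 * g)%g /\
    (forall A, (rho x * A = A * rho x)%g -> (rho y * A = A * rho y)%g))) => g.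
  have pw n A : (rho x * A = A * rho x)%g -> (rho (x ^+ n) * A = A * rho (x ^+ n))%g.
    move=> h; rewrite homX; elim: n => [|n IH]; first by rewrite expg0 mulg1 mul1g.
    by rewrite expgS -mulgA IH mulgA h mulgA.
  have [n [e|e]] := hx g.
    by exists (x ^+ n)%g; split; [apply: f_inj; rewrite homX|exact: pw].
  exists (x ^+ n)^-1%g; split; first by apply: f_inj; rewrite homV homX.
  move=> A /(pw n) h; rewrite homV; apply: (mulgI (rho (x ^+ n)%g)).
  by rewrite mulgA mulgV mul1g mulgA h -mulgA mulgV mulg1.
have split_rho g : rho g = (rho (B g) * rho ((B g)^-1 * g))%g by rewrite -repM mulgA mulgV mul1g.
have comx g : (rho x * rho g = rho g * rho x)%g.
  by rewrite (split_rho g) -[RHS]mulgA ((hB g).1 (rho x)) !mulgA ((hB g).2 (rho x)).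
move=> g h; rewrite (split_rho g) -[LHS]mulgA ((hB g).1 (rho h)) !mulgA.
by rewrite ((hB g).2 _ (comx h)).
Qed.

End CyclicFilling.

(** * Nakayama's lemma in a local ring *)

Section LocalIdeal.
Variables (T : Type) (F : fieldType) (A : (T -> F) -> Prop) (Z : set T) (x0 : T).
Hypothesis A_cst : forall c, A (fun=> c).
Hypothesis A_add : forall f g, A f -> A g -> A (fun x => f x + g x).
Hypothesis A_mul : forall f g, A f -> A g -> A (fun x => f x * g x).

(** The ideal generated by s in the ring A of functions, modulo those vanishing on Z. *)
Fixpoint ideal (s : seq (T -> F)) (f : T -> F) : Prop :=
  if s is k :: s' then exists2 p, A p & ideal s' (fun x => f x - p x * k x)
  else forall x, Z x -> f x = 0.

Lemma ideal_ext s f g : (forall x, Z x -> f x = g x) -> ideal s f -> ideal s g.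
Proof.
elim: s f g => [|k s IH] f g fg /=; first by move=> f0 x Zx; rewrite -fg // f0.
by move=> [p Ap fp]; exists p => //; apply: IH fp => x Zx; rewrite fg.
Qed.

Lemma ideal0 s : ideal s (fun=> 0).
Proof.
elim: s => [|k s IH] //=; exists (fun=> 0) => //.
by apply: ideal_ext IH => x _; rewrite mul0r subr0.
Qed.

Lemma idealD s f g : ideal s f -> ideal s g -> ideal s (fun x => f x + g x).
Proof.
elim: s f g => [|k s IH] f g /=; first by move=> f0 g0 x Zx; rewrite f0 // g0 // addr0.
move=> [p Ap fp] [q Aq gq]; exists (fun x => p x + q x); first exact: A_add.
by apply: ideal_ext (IH _ _ fp gq) => x _; ring.
Qed.

Lemma idealM s a f : A a -> ideal s f -> ideal s (fun x => a x * f x).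
Proof.
move=> Aa; elim: s f => [|k s IH] f /=; first by move=> f0 x Zx; rewrite f0 // mulr0.
move=> [p Ap fp]; exists (fun x => a x * p x); first exact: A_mul.
by apply: ideal_ext (IH _ fp) => x _; ring.
Qed.

Lemma ideal_cons s k f : ideal s f -> ideal (k :: s) f.
Proof. by move=> h; exists (fun=> 0) => //; apply: ideal_ext h => x _; rewrite mul0r subr0. Qed.

Lemma ideal_head s k : ideal (k :: s) k.
Proof. by exists (fun=> 1) => //; apply: ideal_ext (ideal0 s) => x _; rewrite mul1r subrr. Qed.

(** The ideal generated by s in the localization at x0, denominators being cleared. *)
Definition local_ideal s f := exists2 h, A h & h x0 != 0 /\ ideal s (fun x => h x * f x).

(** Modulo the localized ideal of s, f is the multiple (p / h) k of k; the scalar t is the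
    residue of this coefficient at x0. *)
Definition head_coefficient k s (f : T -> F) (t : F) :=
  exists h p, [/\ A h, A p, h x0 != 0, ideal s (fun x => h x * f x - p x * k x) & t = p x0 / h x0].

Lemma head_coefficient_ext k s f g t : (forall x, Z x -> f x = g x) ->
  head_coefficient k s f t -> head_coefficient k s g t.
Proof.
move=> fg [h [p [Ah Ap h0 I tE]]]; exists h, p; split => //.
by apply: ideal_ext I => x Zx; rewrite fg.
Qed.

Lemma head_coefficientD k s f g t u : head_coefficient k s f t -> head_coefficient k s g u ->
  head_coefficient k s (fun x => f x + g x) (t + u).
Proof.
move=> [h [p [Ah Ap h0 I ->]]] [h' [p' [Ah' Ap' h0' I' ->]]].
exists (fun x => h x * h' x), (fun x => h' x * p x + h x * p' x); split.
- exact: A_mul.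
- by apply: A_add; exact: A_mul.
- exact: mulf_neq0.
- by apply: ideal_ext (idealD (idealM Ah' I) (idealM Ah I')) => x _; ring.
- by field; rewrite h0 h0'.
Qed.

Lemma head_coefficientM k s a f t : A a -> head_coefficient k s f t ->
  head_coefficient k s (fun x => a x * f x) (a x0 * t).
Proof.
move=> Aa [h [p [Ah Ap h0 I ->]]]; exists h, (fun x => a x * p x); split => //.
- exact: A_mul.
- by apply: ideal_ext (idealM Aa I) => x _; ring.
- by rewrite mulrA.
Qed.

Lemma head_coefficient0 k s : head_coefficient k s (fun=> 0) 0.
Proof.
exists (fun=> 1), (fun=> 0); split => //; first exact: oner_neq0.
- by apply: ideal_ext (ideal0 s) => x _; rewrite mulr0 mul0r subr0.
- by rewrite mul0r.
Qed.

Lemma head_coefficient_head k s : head_coefficient k s k 1.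
Proof.
exists (fun=> 1), (fun=> 1); split => //; first exact: oner_neq0.
- by apply: ideal_ext (ideal0 s) => x _; rewrite subrr.
- by rewrite divr1.
Qed.

Variable fam : (T -> F) -> Prop.

Let generates s := (forall f, fam f -> local_ideal s f) /\ List.Forall fam s.

(** A generating list of minimal length is either empty or has a head k, and then the
    residue at x0 of the coefficient of k is well defined: two different residues would
    place k in the localized ideal of the remaining generators. So t is a nonzero linear
    functional on I / m I, where I is the ideal of the family and m the maximal ideal. *)
Lemma nakayama s0 : generates s0 ->
  (forall f, fam f -> local_ideal [::] f) \/
  exists k s, [/\ fam k, forall f, fam f -> exists t, head_coefficient k s f t &
    forall f t u, fam f -> head_coefficient k s f t -> head_coefficient k s f u -> t = u].
Proof.
move=> gen0.
have ex : exists n, `[< exists2 s, generates s & size s = n >].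
  by exists (size s0); apply/asboolP; exists s0.
case: (ex_minnP ex) => n /asboolP[[|k s] [gen mem] <-] nmin; first by left.
right; exists k, s; split; first by case/List.Forall_cons_iff: mem.
  move=> f /gen[h Ah [h0 [p Ap I]]]; exists (p x0 / h x0), h, p; split => //.
move=> f t u _ [h [p [Ah Ap h0 I ->]]] [h' [p' [Ah' Ap' h0' I' ->]]].
apply/eqP; apply: contraT => ne.
suff : (size (k :: s) <= size s)%N by rewrite ltnn.
apply: nmin; apply/asboolP; exists s => //; split; last by case/List.Forall_cons_iff: mem.
(* v k lies in the ideal of s, and v is invertible at x0 when the residues differ. *)
pose v x := h' x * p x + (-1) * (h x * p' x).
have Av : A v by apply: A_add; apply: A_mul => //; exact: A_mul.
have v0 : v x0 != 0.
  apply: contra_neq ne; rewrite /v => e; apply/eqP; rewrite eqr_div //; apply/eqP.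
  by apply/eqP; rewrite -subr_eq0; apply/eqP; rewrite -[RHS]e; ring.
have Iv : ideal s (fun x => v x * k x).
  have In : ideal s (fun x => (-1) * h' x * (h x * f x - p x * k x)).
    by apply: (idealM _ I); exact: A_mul.
  by apply: ideal_ext (idealD (idealM Ah I') In) => x _; rewrite /v; ring.
move=> g /gen[h1 Ah1 [h10 [p1 Ap1 I1]]]; exists (fun x => v x * h1 x); first exact: A_mul.
split; first exact: mulf_neq0.
by apply: ideal_ext (idealD (idealM Av I1) (idealM Ap1 Iv)) => x _; ring.
Qed.

End LocalIdeal.

(** * Commuting matrices and traces *)

Section DiagonalMatrices.
Variable F : fieldType.
Implicit Types A B D : SL2 F.

Lemma commute_diag A B : (A * B = B * A)%g -> ent A 0 1 = 0 -> ent A 1 0 = 0 ->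
  ent A 0 0 != ent A 1 1 -> ent B 0 1 = 0 /\ ent B 1 0 = 0.
Proof.
move=> AB A01 A10 ne.
have e i j : ent (A * B) i j = ent (B * A) i j by rewrite AB.
have d0 : ent A 0 0 - ent A 1 1 != 0 by rewrite subr_eq0.
split; apply: (mulfI d0); rewrite mulr0.
  by have := e 0 1; rewrite !SL2_mulE A01 mul0r addr0 mulr0 add0r => h; rewrite mulrBl h; ring.
by have := e 1 0; rewrite !SL2_mulE A10 mul0r add0r mulr0 addr0 => h; rewrite mulrBl h; ring.
Qed.

(** One coordinate of the statement that two vectors parallel to the same nonzero vector
    are parallel. *)
Lemma cross_parallel (w1 w2 w3 u1 u2 u3 v1 v2 v3 : F) :
  [\/ w1 != 0, w2 != 0 | w3 != 0] ->
  u1 * w2 = u2 * w1 -> u1 * w3 = u3 * w1 -> u2 * w3 = u3 * w2 ->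
  v1 * w2 = v2 * w1 -> v1 * w3 = v3 * w1 -> v2 * w3 = v3 * w2 ->
  u1 * v2 = u2 * v1.
Proof.
move=> [] w0 a1 a2 a3 b1 b2 b3.
- by apply: (mulfI w0); rewrite mulrCA [w1 * v2]mulrC -b1 mulrA [RHS]mulrA [w1 * _]mulrC -a1; ring.
- by apply: (mulfI w0); rewrite mulrA [w2 * _]mulrC a1 [RHS]mulrCA [w2 * v1]mulrC b1; ring.
- apply: (mulfI w0); apply: (mulfI w0).
  transitivity ((u1 * w3) * (v2 * w3)); first by ring.
  by transitivity ((u2 * w3) * (v1 * w3)); [rewrite a2 b3 a3 b2; ring|ring].
Qed.

(** The traceless parts of A and D are parallel to that of B, hence to one another. *)
Lemma centralizer_commute A B D : (A * B = B * A)%g -> (D * B = B * D)%g ->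
  [\/ ent B 0 1 != 0, ent B 1 0 != 0 | ent B 0 0 != ent B 1 1] -> (A * D = D * A)%g.
Proof.
move=> AB DB nB; pose d (X : SL2 F) := ent X 0 0 - ent X 1 1.
have nw : [\/ ent B 0 1 != 0, ent B 1 0 != 0 | d B != 0].
  by case: nB => h; [apply: Or31|apply: Or32|apply: Or33]; rewrite ?subr_eq0.
have par (X : SL2 F) : (X * B = B * X)%g -> [/\ ent X 0 1 * ent B 1 0 = ent X 1 0 * ent B 0 1,
    ent X 0 1 * d B = d X * ent B 0 1 & ent X 1 0 * d B = d X * ent B 1 0].
  move=> XB; have e i j : ent (X * B) i j = ent (B * X) i j by rewrite XB.
  split.
  - have := e 0 0; rewrite !SL2_mulE => /(congr1 (fun z => z - ent X 0 0 * ent B 0 0)) h.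
    by transitivity (ent X 0 0 * ent B 0 0 + ent X 0 1 * ent B 1 0 - ent X 0 0 * ent B 0 0);
      [ring|rewrite h; ring].
  - have := e 0 1; rewrite !SL2_mulE => /(congr1 (fun z => z - ent X 0 1 * ent B 1 1 - ent X 1 1 * ent B 0 1)) h.
    apply/esym; transitivity (ent X 0 0 * ent B 0 1 + ent X 0 1 * ent B 1 1 - ent X 0 1 * ent B 1 1 - ent X 1 1 * ent B 0 1);
      [rewrite /d; ring|rewrite h /d; ring].
  - have := e 1 0; rewrite !SL2_mulE => /(congr1 (fun z => z - ent B 1 0 * ent X 1 1 - ent X 1 0 * ent B 1 1)) h.
    transitivity (ent X 1 0 * ent B 0 0 + ent X 1 1 * ent B 1 0 - ent B 1 0 * ent X 1 1 - ent X 1 0 * ent B 1 1);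
      [rewrite /d; ring|rewrite h /d; ring].
have [a1 a2 a3] := par A AB; have [b1 b2 b3] := par D DB.
have nw2 : [\/ ent B 0 1 != 0, d B != 0 | ent B 1 0 != 0].
  by case: nw => h; [apply: Or31|apply: Or33|apply: Or32].
have nw3 : [\/ ent B 1 0 != 0, d B != 0 | ent B 0 1 != 0].
  by case: nw => h; [apply: Or33|apply: Or31|apply: Or32].
have c1 := cross_parallel nw a1 a2 a3 b1 b2 b3.
have c2 := cross_parallel nw2 a2 a1 (esym a3) b2 b1 (esym b3).
have c3 := cross_parallel nw3 a3 (esym a1) (esym a2) b3 (esym b1) (esym b2).
apply: SL2P; rewrite !SL2_mulE.
- by rewrite c1; ring.
- apply/eqP; rewrite -subr_eq0; apply/eqP.
  by transitivity (d A * ent D 0 1 - ent A 0 1 * d D); [rewrite /d; ring|rewrite c2; ring].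
- apply/eqP; rewrite -subr_eq0; apply/eqP.
  by transitivity (ent A 1 0 * d D - d A * ent D 1 0); [rewrite /d; ring|rewrite c3; ring].
- by have c1' := c1; rewrite [ent A 1 0 * _]mulrC [ent D 1 0 * _]mulrC c1'; ring.
Qed.

End DiagonalMatrices.

Section Traces.
Variable F : fieldType.

Lemma SL2_trace (A : SL2 F) : \tr (A : 'M[F]_2) = ent A 0 0 + ent A 1 1.
Proof.
rewrite /mxtrace big_ord_recl big_ord1.
by have -> : lift ord0 ord0 = 1 :> 'I_2 by exact/val_inj.
Qed.

Lemma SL2_trace_conj (A S : SL2 F) : \tr ((S^-1 * (A * S))%g : 'M[F]_2) = \tr (A : 'M[F]_2).
Proof.
have d := SL2_det S; rewrite -[RHS](_ : \tr ((A * S * S^-1)%g : 'M[F]_2) = _); last first.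
  by rewrite -mulgA mulgV mulg1.
exact: mxtrace_mulC.
Qed.

Lemma reciprocal_eq (x m : F) : x != 0 -> m != 0 -> x + x^-1 = m + m^-1 -> x = m \/ x = m^-1.
Proof.
move=> x0 m0 e; have : (x - m) * (x - m^-1) = 0.
  have -> : (x - m) * (x - m^-1) = x * (x + x^-1 - (m + m^-1)) by field; rewrite x0 m0.
  by rewrite e subrr mulr0.
by move/eqP; rewrite mulf_eq0 !subr_eq0 => /orP[/eqP ->|/eqP ->]; [left|right].
Qed.

(** Each of the first two traces leaves a choice between a number and its inverse; the
    trace of the product forces the two choices to agree. *)
Lemma trace_parameters (m l x y : F) : m != 0 -> l != 0 -> x != 0 -> y != 0 ->
  m != m^-1 -> x + x^-1 = m + m^-1 -> y + y^-1 = l + l^-1 ->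
  x * y + (x * y)^-1 = m * l + (m * l)^-1 ->
  (x = m /\ y = l) \/ (x = m^-1 /\ y = l^-1).
Proof.
move=> m0 l0 x0 y0 mm ex ey exy.
have main (m' l' : F) : m' != 0 -> l' != 0 -> m' != m'^-1 ->
    y + y^-1 = l' + l'^-1 -> m' * y + (m' * y)^-1 = m' * l' + (m' * l')^-1 -> y = l'.
  move=> m'0 l'0 mm' ey' exy'.
  case: (reciprocal_eq y0 l'0 ey') => // yl; move: exy'; rewrite yl => e.
  have : (m' - m'^-1) * (l' - l'^-1) = 0.
    have -> : (m' - m'^-1) * (l' - l'^-1) = m' * l' + (m' * l')^-1 - (m' / l' + (m' / l')^-1).
      by field; rewrite m'0 l'0.
    by rewrite e subrr.
  by move/eqP; rewrite mulf_eq0 !subr_eq0 (negbTE mm') /= => /eqP <-.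
case: (reciprocal_eq x0 m0 ex) => xm; [left|right]; split => //; move: exy; rewrite xm => exy.
  exact: main exy.
apply: (main m^-1 l^-1).
- by rewrite invr_eq0.
- by rewrite invr_eq0.
- by rewrite invrK eq_sym.
- by rewrite invrK ey addrC.
- by rewrite exy !invfM !invrK addrC.
Qed.

End Traces.

(** * Brackets with the meridian *)

(** An irreducible set is not covered by the zeros of h and the zeros of f unless one of
    these contains it. *)
Lemma irreducible_vanish (F : fieldType) (T I : Type) (x : I -> T -> F) (Z : set T) (h f : T -> F) u :
  zariski_irreducible x Z -> polyfun x h -> polyfun x f -> Z u -> h u != 0 ->
  (forall v, Z v -> h v * f v = 0) -> forall v, Z v -> f v = 0.
Proof.
move=> [_ irr] ph pf Zu hu hf v Zv.
have cl (g : T -> F) : polyfun x g -> zariski_closed x [set v | g v = 0].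
  move=> pg; exists [set g]; split => [_ -> //|].
  by apply/seteqP; split => w /= => [gw _ ->//|]; apply.
have [|Zh|Zf] := irr _ _ (cl h ph) (cl f pf).
- by move=> w /hf/eqP; rewrite mulf_eq0 => /orP[/eqP|/eqP]; [left|right].
- by move: hu; rewrite (Zh u Zu) eqxx.
- exact: Zf.
Qed.

Lemma derived_trivial (F : fieldType) (G : groupType) (rho : rep F G) z :
  (forall g h, rho g * rho h = rho h * rho g)%g -> in_derived z -> rho z = 1%g.
Proof.
move=> ab; elim => [|x y w _ IH]; first exact: hom1.
rewrite repM IH mulg1; suff -> : rho [~ x, y]%g = ([~ rho x, rho y])%g.
  by rewrite commgEl conjgE -?mulgA (ab x y) mulKg mulVg.
by rewrite !commgEl !conjgE !repM !homV.
Qed.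

Section Bracket.
Variables (F : fieldType) (G : groupType) (S : SL2 F) (mu : G).
Notation Rep := (rep F G).

Definition conj_rep (rho : Rep) (g : G) : SL2 F := (S^-1 * (rho g * S))%g.

Lemma conj_repM rho g h : conj_rep rho (g * h)%g = (conj_rep rho g * conj_rep rho h)%g.
Proof. by rewrite /conj_rep repM !mulgA mulgK. Qed.

Lemma conj_repV rho g : conj_rep rho g^-1%g = (conj_rep rho g)^-1%g.
Proof. by rewrite /conj_rep homV !invgM invgK !mulgA. Qed.

Lemma conj_rep1 rho : conj_rep rho 1%g = 1%g.
Proof. by rewrite /conj_rep hom1 mul1g mulVg. Qed.

Lemma conj_rep_commute (rho : Rep) g h : (conj_rep rho g * conj_rep rho h = conj_rep rho h * conj_rep rho g)%g ->
  (rho g * rho h = rho h * rho g)%g.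
Proof.
have E x y : (conj_rep rho x * conj_rep rho y = S^-1 * (rho x * rho y * S))%g.
  by rewrite /conj_rep !mulgA mulgK.
by rewrite !E => /mulgI/mulIg.
Qed.

(** An entry of [sigma g, sigma mu], as a polynomial function of the representation. *)
Definition bracket (g : G) (i j : 'I_2) (rho : Rep) : F :=
  ent (conj_rep rho g * conj_rep rho mu) i j - ent (conj_rep rho mu * conj_rep rho g) i j.

Lemma polyfun_conj_rep g i j : polyfun rep_coord (fun rho : Rep => ent (conj_rep rho g) i j).
Proof.
have pc c : polyfun rep_coord (fun _ : Rep => c) by exact: polyfun_cst.
have pg a b : polyfun rep_coord (fun rho : Rep => ent (rho g) a b).
  exact: (polyfun_coord rep_coord (g, a, b)).
have -> : (fun rho : Rep => ent (conj_rep rho g) i j) = (fun rho =>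
    ent S^-1 i 0 * (ent (rho g) 0 0 * ent S 0 j + ent (rho g) 0 1 * ent S 1 j)
    + ent S^-1 i 1 * (ent (rho g) 1 0 * ent S 0 j + ent (rho g) 1 1 * ent S 1 j)).
  by apply/funext => rho; rewrite /conj_rep !SL2_mulE.
by apply: polyfunD; apply: polyfunM => //; apply: polyfunD; apply: polyfunM.
Qed.

Lemma polyfun_bracket g i j : polyfun rep_coord (bracket g i j).
Proof.
have pE h a b := polyfun_conj_rep h a b.
have -> : bracket g i j = (fun rho =>
    (ent (conj_rep rho g) i 0 * ent (conj_rep rho mu) 0 j + ent (conj_rep rho g) i 1 * ent (conj_rep rho mu) 1 j)
    + (-1) * (ent (conj_rep rho mu) i 0 * ent (conj_rep rho g) 0 j + ent (conj_rep rho mu) i 1 * ent (conj_rep rho g) 1 j)).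
  by apply/funext => rho; rewrite /bracket !SL2_mulE mulN1r.
by do ?[apply: polyfunD|apply: polyfunM|exact: pE|exact: polyfun_cst].
Qed.

(** The Leibniz rule. A linear functional turns it into a cocycle identity. *)
Lemma bracketM g h i j rho : bracket (g * h)%g i j rho =
  (ent (conj_rep rho h) 0 j * bracket g i 0 rho + ent (conj_rep rho h) 1 j * bracket g i 1 rho)
  + (ent (conj_rep rho g) i 0 * bracket h 0 j rho + ent (conj_rep rho g) i 1 * bracket h 1 j rho).
Proof.
rewrite /bracket conj_repM; move: (conj_rep rho g) (conj_rep rho h) (conj_rep rho mu) => A B D.
by rewrite !SL2_mulE; ring.
Qed.

Lemma bracket1 i j rho : bracket 1%g i j rho = 0.
Proof. by rewrite /bracket conj_rep1 mul1g mulg1 subrr. Qed.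

(** In SL2 the inverse of A is (tr A) - A. *)
Lemma bracketV g i j rho : bracket g^-1%g i j rho = - bracket g i j rho.
Proof.
rewrite /bracket conj_repV; move: (conj_rep rho g) (conj_rep rho mu) => A B; rewrite !SL2_mulE.
by case: (ord2P i) => ->; case: (ord2P j) => ->; rewrite !SL2_invE; ring.
Qed.

Lemma bracket_eq0 g (rho : Rep) : (rho g * rho mu = rho mu * rho g)%g -> forall i j, bracket g i j rho = 0.
Proof.
move=> e i j; rewrite /bracket.
have E x y : (conj_rep rho x * conj_rep rho y = S^-1 * (rho x * rho y * S))%g.
  by rewrite /conj_rep !mulgA mulgK.
by rewrite !E e subrr.
Qed.

Lemma bracket_trace g rho : bracket g 1 1 rho = - bracket g 0 0 rho.
Proof.
by rewrite /bracket; move: (conj_rep rho g) (conj_rep rho mu) => A B; rewrite !SL2_mulE; ring.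
Qed.

(** tr ([A, B] B) = 0. Together with tr [A, B] = 0 it expresses the diagonal entries of the
    bracket through the others when the meridian is diagonal and not scalar. *)
Lemma bracket_trace_mul g rho :
  (ent (conj_rep rho mu) 0 0 - ent (conj_rep rho mu) 1 1) * bracket g 0 0 rho =
  - (ent (conj_rep rho mu) 1 0 * bracket g 0 1 rho + ent (conj_rep rho mu) 0 1 * bracket g 1 0 rho).
Proof.
by rewrite /bracket; move: (conj_rep rho g) (conj_rep rho mu) => A B; rewrite !SL2_mulE; ring.
Qed.

(** The Leibniz rule shows that the brackets of generators of the group suffice. *)
Lemma bracket_generated (s : seq G) (Z : set Rep) :
  (forall Q : G -> Prop, Q 1%g -> (forall g h, Q g -> Q h -> Q (g * h)%g) ->
    (forall g, Q g -> Q g^-1%g) -> (forall g, g \in s -> Q g) -> forall g, Q g) ->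
  exists s0, List.Forall (fun f => exists g i j, f = bracket g i j) s0 /\
    forall g i j, ideal (polyfun rep_coord) Z s0 (bracket g i j).
Proof.
move=> gen; pose A := @polyfun F Rep (G * 'I_2 * 'I_2) rep_coord.
have Ac c : A (fun=> c) by exact: polyfun_cst.
have AD f g : A f -> A g -> A (fun x => f x + g x) by exact: polyfunD.
have AM f g : A f -> A g -> A (fun x => f x * g x) by exact: polyfunM.
have [s0 [mem hs]] : exists s0, List.Forall (fun f => exists g i j, f = bracket g i j) s0 /\
    forall g i j, g \in s -> ideal A Z s0 (bracket g i j).
  elim: s {gen} => [|g s [s0 [mem hs]]]; first by exists [::]; split; [exact: List.Forall_nil|].
  exists [:: bracket g 0 0, bracket g 0 1, bracket g 1 0, bracket g 1 1 & s0]; split.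
    by do 4!(apply: List.Forall_cons; first by exists g; eexists; eexists).
  move=> h i j; rewrite in_cons => /orP[/eqP ->|hs']; last by do 4!apply: ideal_cons => //; exact: hs.
  case: (ord2P i) => ->; case: (ord2P j) => ->.
  - exact: ideal_head.
  - by do 1!apply: ideal_cons => //; exact: ideal_head.
  - by do 2!apply: ideal_cons => //; exact: ideal_head.
  - by do 3!apply: ideal_cons => //; exact: ideal_head.
exists s0; split => // g.
have ext f f' : (forall x, f x = f' x) -> ideal A Z s0 f -> ideal A Z s0 f'.
  by move=> e; apply: ideal_ext => x _.
apply: (gen (fun g => forall i j, ideal A Z s0 (bracket g i j))) => [i j|{}g h Qg Qh i j|{}g Qg i j|{}g gs i j].
- by apply: (ext (fun=> 0)) => [x|]; [rewrite bracket1|exact: ideal0].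
- apply: ext (fun x => esym (bracketM g h i j x)) _.
  apply: idealD => //; apply: idealD => //; apply: idealM => //; exact: polyfun_conj_rep.
- apply: (ext (fun x => (-1) * bracket g i j x)) => [x|]; first by rewrite bracketV mulN1r.
  exact: idealM.
- exact: hs.
Qed.

End Bracket.

(** * Representations diagonal on the peripheral subgroup *)

Section PeripheralDiagonal.
Variable R : realType.
Local Notation C := R[i].
Local Notation space := (R * R * R)%type.
Variable K : framed_knot R.
Local Notation Gamma := (pi1_exterior K).
Variables (P : space -> sphere3 R) (rho0 : rep C Gamma) (u0 : space).
Hypothesis hol : based_holonomy P rho0 u0.
Variables (T : R * R -> space) (c : int -> int -> Gamma).
Hypothesis hT : peripheral_lift P rho0 u0 T c.

Lemma peripheral0 : c 0 0 = 1%g.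
Proof. by apply: (mulgI (c 0 0)); rewrite -(peripheralM hol hT) addr0 mulg1. Qed.

Lemma peripheralN n m : c (- n) (- m) = (c n m)^-1%g.
Proof. by apply: (mulgI (c n m)); rewrite -(peripheralM hol hT) !addrN peripheral0 mulgV. Qed.

Lemma peripheral_commute n m n' m' : (c n m * c n' m' = c n' m' * c n m)%g.
Proof. by rewrite -!(peripheralM hol hT) addrC [m + _]addrC. Qed.

Definition diagonal_at (A : SL2 C) (x : C) := [/\ ent A 0 1 = 0, ent A 1 0 = 0 & ent A 0 0 = x].

Lemma diagonal_entry (A : SL2 C) x : diagonal_at A x -> x != 0 /\ ent A 1 1 = x^-1.
Proof.
move=> [A01 A10 A00]; have := SL2E A; rewrite A01 mul0r subr0 A00 => e.
have x0 : x != 0 by apply/eqP => x0; move/eqP: e; rewrite x0 mul0r eq_sym oner_eq0.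
by split => //; apply: (mulfI x0); rewrite e mulfV.
Qed.

Lemma diagonalM A B x y : diagonal_at A x -> diagonal_at B y -> diagonal_at (A * B)%g (x * y).
Proof.
by move=> [A01 A10 A00] [B01 B10 B00]; split; rewrite SL2_mulE ?A01 ?A10 ?A00 ?B01 ?B10 ?B00; ring.
Qed.

Lemma diagonalV A x : diagonal_at A x -> diagonal_at A^-1%g x^-1.
Proof.
by move=> dA; have [_ A11] := diagonal_entry dA; case: dA => A01 A10 _; split; rewrite !SL2_invE ?A01 ?A10 ?oppr0.
Qed.

Lemma peripheral_diagonal (rho : rep C Gamma) (S : SL2 C) x y :
  diagonal_at (conj_rep S rho (c 0 1)) x -> diagonal_at (conj_rep S rho (c 1 0)) y ->
  forall n m, diagonal_at (conj_rep S rho (c n m)) (y ^ n * x ^ m).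
Proof.
move=> dx dy; have [x0 _] := diagonal_entry dx; have [y0 _] := diagonal_entry dy.
pose Q n m := diagonal_at (conj_rep S rho (c n m)) (y ^ n * x ^ m).
have Q0 : Q 0 0 by rewrite /Q peripheral0 conj_rep1 mulr1; split; rewrite !mxE.
have QM n m n' m' : Q n m -> Q n' m' -> Q (n + n') (m + m').
  move=> h h'; rewrite /Q (peripheralM hol hT) conj_repM !expfzDr //.
  have -> : y ^ n * y ^ n' * (x ^ m * x ^ m') = (y ^ n * x ^ m) * (y ^ n' * x ^ m') by ring.
  exact: diagonalM.
have QN n m : Q n m -> Q (- n) (- m).
  move=> /diagonalV h; rewrite /Q peripheralN conj_repV -!invr_expz -invfM //.
have Qn (n : nat) : Q n 0.
  elim: n => [//|n IH]; have -> : n.+1%:Z = 1 + n%:Z by rewrite -PoszD.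
  by have := QM 1 0 n 0; rewrite addr0; apply => //; rewrite /Q expr1z expr0z mulr1.
have Qm (m : nat) : Q 0 m.
  elim: m => [//|m IH]; have -> : m.+1%:Z = 1 + m%:Z by rewrite -PoszD.
  by have := QM 0 1 0 m; rewrite addr0; apply => //; rewrite /Q expr1z expr0z mul1r.
have Qz n : Q n 0.
  by case: n => k; [exact: Qn|rewrite NegzE]; have := QN _ _ (Qn k.+1); rewrite oppr0.
have Qz' m : Q 0 m.
  by case: m => k; [exact: Qm|rewrite NegzE]; have := QN _ _ (Qm k.+1); rewrite oppr0.
by move=> n m; have := QM _ _ _ _ (Qz n) (Qz' m); rewrite addr0 add0r.
Qed.

Lemma peripheral_central (rho : rep C Gamma) (S : SL2 C) x y (p q : int) :
  diagonal_at (conj_rep S rho (c 0 1)) x -> diagonal_at (conj_rep S rho (c 1 0)) y ->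
  x ^ p * y ^ q = 1 \/ x ^ p * y ^ q = -1 ->
  forall A, (rho (c q p) * A = A * rho (c q p))%g.
Proof.
move=> dx dy xy; have := peripheral_diagonal dx dy q p; rewrite [y ^ q * _]mulrC.
set D := conj_rep _ _ _; move: (x ^ p * y ^ q) xy => e xy dD.
have [_ D11] := diagonal_entry dD; case: dD => D01 D10 D00.
have ee : e^-1 = e by case: xy => ->; rewrite ?invr1 // invrN1.
have central A : (D * A = A * D)%g.
  have [h1 h2 h3 h4] : [/\ ent D 0 1 = 0, ent D 1 0 = 0, ent D 0 0 = e & ent D 1 1 = e] by rewrite D11.
  move: D {D01 D10 D00 D11} h1 h2 h3 h4 => D h1 h2 h3 h4.
  by apply: SL2P; rewrite !SL2_mulE ?h1 ?h2 ?h3 ?h4; ring.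
have DE : rho (c q p) = D.
  apply: (mulIg S); rewrite central /D /conj_rep mulgA mulgV mul1g //.
by move=> A; rewrite DE central.
Qed.

Variables p q r s : int.
Hypothesis hcyc : cyclic_group (pi1_filling K p q r s).

Lemma triangular_trivial (rho : rep C Gamma) x : x ^ p = 1 \/ x ^ p = -1 -> x != x^-1 ->
  diagonal_at (rho (c 0 1)) x -> diagonal_at (rho (c 1 0)) 1 ->
  forall g, ent (rho g) 0 1 = 0 /\ ent (rho g) 1 0 = 0.
Proof.
move=> xp xx dx d1 g.
have c1 h : conj_rep 1%g rho h = rho h by rewrite /conj_rep invg1 mul1g mulg1.
have central A : (rho (c q p) * A = A * rho (c q p))%g.
  by apply: (@peripheral_central rho 1%g x 1); rewrite ?c1 // exp1rz mulr1.
have ab := cyclic_filling_abelian hol hT hcyc central.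
have [_ e11] := diagonal_entry dx; case: dx => e01 e10 e00.
by apply: (commute_diag (ab (c 0 1) g)) => //; rewrite e00 e11.
Qed.

(** A cocycle is the off-diagonal entry of a triangular representation. This one sends
    the slope to 1 or -1, so it is abelian when the filling is cyclic; then it commutes
    with its diagonal, non-scalar value at the meridian and is diagonal itself. *)
Lemma cocycle_trivial (a d k : Gamma -> C) x : (forall g, a g * d g = 1) ->
  (forall g h, a (g * h)%g = a g * a h) -> (forall g h, d (g * h)%g = d g * d h) ->
  (forall g h, k (g * h)%g = k g * d h + a g * k h) ->
  a (c 0 1) = x -> k (c 0 1) = 0 -> a (c 1 0) = 1 -> k (c 1 0) = 0 ->
  x ^ p = 1 \/ x ^ p = -1 -> x != x^-1 -> forall g, k g = 0.
Proof.
move=> ad aM dM kM ax kx a1 k1 xp xx g.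
have det h : a h * d h - k h * 0 = 1 by rewrite mulr0 subr0.
pose f h : SL2 C := SL2_of (det h).
have fM : {morph f : x y / (x * y)%g}.
  by move=> h h'; apply: SL2P; rewrite SL2_mulE /f !mx22E ?aM ?dM ?kM; ring.
pose rho : rep C Gamma := HB.pack f (isMultiplicative.Build _ _ f fM).
have d0 : diagonal_at (rho (c 0 1)) x by split; rewrite /= mx22E.
have d1 : diagonal_at (rho (c 1 0)) 1 by split; rewrite /= mx22E.
by have [] := triangular_trivial xp xx d0 d1 g; rewrite /= mx22E.
Qed.

End PeripheralDiagonal.

(** * Abelian points of the component *)

Section Main.
Variable R : realType.
Local Notation C := R[i].
Local Notation space := (R * R * R)%type.
Variable K : framed_knot R.
Local Notation Gamma := (pi1_exterior K).
Variables (P : space -> sphere3 R) (rho0 : rep C Gamma) (u0 : space).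
Hypothesis hol : based_holonomy P rho0 u0.
Variables (T : R * R -> space) (c : int -> int -> Gamma).
Hypothesis hT : peripheral_lift P rho0 u0 T c.

Lemma scalar_holonomy g : ent (rho0 g) 0 1 = 0 -> ent (rho0 g) 1 0 = 0 ->
  ent (rho0 g) 0 0 = ent (rho0 g) 1 1 -> g = 1%g.
Proof.
move=> A01 A10 Ad; have [_ _ hu0 _ _] := hol.
apply: (hact_free hol hu0); rewrite /hact poincare_triangular // A01 addr0 Ad.
have := SL2E (rho0 g); rewrite A01 mul0r subr0 Ad -expr2 => /eqP; rewrite sqrf_eq1 => e.
have s1 : sqmod (ent (rho0 g) 1 1) = 1.
  by case/orP: e => /eqP ->; rewrite /sqmod /= ?oppr0 ?sqrrN expr1n expr0n addr0.
have e1 : ent (rho0 g) 1 1 * zcoord u0 * conjc (ent (rho0 g) 1 1) = zcoord u0.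
  by rewrite mulrAC -sqmodE s1 mul1r.
by rewrite s1 e1 !divr1 -!surjective_pairing.
Qed.

(** Otherwise the whole holonomy would lie in the centralizer of a non-scalar matrix,
    which is commutative. *)
Lemma noncentral_holonomy g : g != 1%g -> exists h, (rho0 h * rho0 g)%g <> (rho0 g * rho0 h)%g.
Proof.
move=> g1; apply/existsNP => cg.
suff : forall x y : Gamma, (x * y = y * x)%g by exact: exterior_group_nonabelian hol.
have [_ _ hu0 _ _] := hol.
move=> x y; apply: (hact_inj hol hu0); rewrite /hact !repM; congr (poincare (SL2_mx _) _).
apply: (centralizer_commute (cg x) (cg y)).
have [A01|] := eqVneq (ent (rho0 g) 0 1) 0; last by constructor.
have [A10|] := eqVneq (ent (rho0 g) 1 0) 0; last by constructor.
have [Ad|] := eqVneq (ent (rho0 g) 0 0) (ent (rho0 g) 1 1); last by constructor.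
by move/eqP: g1; case; exact: scalar_holonomy.
Qed.

Variables p q r s : int.
Hypothesis hcyc : cyclic_group (pi1_filling K p q r s).
Hypothesis longitude_derived : in_derived (c 1 0).
Variable R0 : set (rep C Gamma).
Hypotheses (R0_irr : zariski_irreducible rep_coord R0) (R0_rho0 : R0 rho0).

(** The brackets [sigma g, sigma mu] vanish at rho but not identically on the irreducible
    R0, since rho0 mu is not central. Let theta be the functional that nakayama provides
    on the ideal of the brackets modulo its product with the maximal ideal of rho. As rho
    is diagonal, theta of the off-diagonal brackets are cocycles with values in the
    off-diagonal characters of rho; they vanish at mu, which commutes with itself, and at
    lambda, which commutes with mu, hence everywhere. The trace identities then give the
    vanishing of theta on the diagonal brackets, although theta is nonzero. *)
Lemma no_abelian_point (rho : rep C Gamma) (S : SL2 C) x : R0 rho ->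
  (forall g h, rho g * rho h = rho h * rho g)%g ->
  diagonal_at (conj_rep S rho (c 0 1)) x -> x != x^-1 -> x ^ p = 1 \/ x ^ p = -1 -> False.
Proof.
move=> Rrho ab dx xx xp; set mu := c 0 1 in dx.
have [_ x11] := diagonal_entry dx; have [x01 x10 x00] := dx.
have rhol : rho (c 1 0) = 1%g by exact: derived_trivial.
have diag g : ent (conj_rep S rho g) 0 1 = 0 /\ ent (conj_rep S rho g) 1 0 = 0.
  apply: (@commute_diag _ (conj_rep S rho mu)) => //; last by rewrite x00 x11.
  by rewrite -!conj_repM /conj_rep !repM ab.
have [sG gen] := pi1_exterior_finitely_generated hol.
have [s0 [mem hs0]] := bracket_generated S mu R0 gen.
pose fam f := exists g i j, f = @bracket C Gamma S mu g i j.
have Ac (e : C) : polyfun rep_coord (fun _ : rep C Gamma => e) by exact: polyfun_cst.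
have AD (f g : rep C Gamma -> C) : polyfun rep_coord f -> polyfun rep_coord g ->
  polyfun rep_coord (fun x => f x + g x) by exact: polyfunD.
have AM (f g : rep C Gamma -> C) : polyfun rep_coord f -> polyfun rep_coord g ->
  polyfun rep_coord (fun x => f x * g x) by exact: polyfunM.
have gens : (forall f, fam f -> local_ideal (polyfun rep_coord) R0 rho s0 f) /\ List.Forall fam s0.
  split => // f [g [i [j ->]]]; exists (fun=> 1) => //; split; first exact: oner_neq0.
  by apply: ideal_ext (hs0 g i j) => w _; rewrite mul1r.
have mu1 : mu != 1%g.
  apply/eqP => e; move/eqP: xx; apply; rewrite -x11 -[LHS]x00.
  by rewrite e conj_rep1 !mxE.
case: (nakayama Ac AD AM gens) => [zero|[k [s1 [famk ex uniq]]]].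
  have [h] := noncentral_holonomy mu1; apply; apply: (@conj_rep_commute _ _ S).
  have b0 i j : bracket S mu h i j rho0 = 0.
    have [f pf [f0 hf]] : local_ideal (polyfun rep_coord) R0 rho [::] (bracket S mu h i j).
      by apply: zero; exists h, i, j.
    exact: (irreducible_vanish R0_irr pf (polyfun_bracket S mu h i j) Rrho f0 hf).
  by apply: SL2P; apply/eqP; rewrite -subr_eq0; apply/eqP; exact: b0.
pose hc := head_coefficient (polyfun rep_coord) R0 rho k s1.
have [th hth] : {th : Gamma * 'I_2 * 'I_2 -> C & forall g, hc (bracket S mu g.1.1 g.1.2 g.2) (th g)}.
  apply: (choice (P := fun g t => hc (bracket S mu g.1.1 g.1.2 g.2) t)) => -[[g i] j].
  by apply: ex; exists g, i, j.
pose theta g i j := th (g, i, j).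
have thE g i j t : hc (bracket S mu g i j) t -> theta g i j = t.
  by move=> h; apply: (uniq (bracket S mu g i j)); [exists g, i, j|exact: (hth (g, i, j))|].
have thP g i j : hc (bracket S mu g i j) (theta g i j) by exact: (hth (g, i, j)).
pose e g i j := ent (conj_rep S rho g) i j.
have hcM h i j f t : hc f t -> hc (fun w => ent (conj_rep S w h) i j * f w) (e h i j * t).
  exact: (head_coefficientM AM (polyfun_conj_rep S h i j)).
have hcD f f' t t' : hc f t -> hc f' t' -> hc (fun w => f w + f' w) (t + t').
  exact: (head_coefficientD AD AM).
have hcN f t : hc f t -> hc (fun w => -1 * f w) (-1 * t).
  exact: (head_coefficientM AM (Ac (-1))).
have thM g h i j : theta (g * h)%g i j =
    (e h 0 j * theta g i 0 + e h 1 j * theta g i 1) + (e g i 0 * theta h 0 j + e g i 1 * theta h 1 j).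
  apply: thE; apply: (head_coefficient_ext (fun x _ => esym (bracketM S mu g h i j x))).
  by apply: (hcD); apply: (hcD); apply: (hcM).
have e01 g : e g 0 1 = 0 by case: (diag g).
have e10 g : e g 1 0 = 0 by case: (diag g).
have eM g h i : e (g * h)%g i i = e g i i * e h i i.
  have c01 := e01; have c10 := e10; rewrite /e in c01 c10 *; rewrite conj_repM SL2_mulE.
  by case: (ord2P i) => ->; rewrite ?c01 ?c10; ring.
have e_det g : e g 0 0 * e g 1 1 = 1.
  by have := SL2E (conj_rep S rho g); have := e01 g; rewrite /e => ->; rewrite mul0r subr0.
have e_mu : e mu 0 0 = x by [].
have th_mu g i j : (forall w : rep C Gamma, w g * w mu = w mu * w g)%g -> theta g i j = 0.
  move=> com; apply: thE; apply: (head_coefficient_ext (f := fun=> 0)); last exact: head_coefficient0.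
  by move=> w _; rewrite bracket_eq0.
have th_l i j : theta (c 1 0) i j = 0.
  by apply: th_mu => w; rewrite -!repM (peripheral_commute hol hT).
have e_l i : e (c 1 0) i i = 1 by rewrite /e /conj_rep rhol mul1g mulVg mxE eqxx.
(* The two off-diagonal entries use the two orderings of the diagonal of rho. *)
have th01 g : theta g 0 1 = 0.
  apply: (@cocycle_trivial R K P rho0 u0 hol T c hT p q r s hcyc (fun g => e g 0 0) (fun g => e g 1 1)
    (fun g => theta g 0 1) x) => //.
  - by move=> g' h; rewrite thM !e01; ring.
  - exact: th_mu.
have th10 g : theta g 1 0 = 0.
  apply: (@cocycle_trivial R K P rho0 u0 hol T c hT p q r s hcyc (fun g => e g 1 1) (fun g => e g 0 0)
    (fun g => theta g 1 0) x^-1) => //.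
  - by move=> h; rewrite mulrC.
  - by move=> g' h; rewrite thM !e10; ring.
  - exact: th_mu.
  - by case: xp => xp; [left|right]; rewrite exprz_inv -invr_expz xp ?invr1 ?invrN1.
  - by rewrite invrK eq_sym.
have th00 g : theta g 0 0 = 0.
  have h : hc (fun=> 0) ((e mu 0 0 * theta g 0 0 + -1 * (e mu 1 1 * theta g 0 0))
      + (e mu 1 0 * theta g 0 1 + e mu 0 1 * theta g 1 0)).
    apply: (head_coefficient_ext (f := fun w =>
      (ent (conj_rep S w mu) 0 0 * bracket S mu g 0 0 w + -1 * (ent (conj_rep S w mu) 1 1 * bracket S mu g 0 0 w))
      + (ent (conj_rep S w mu) 1 0 * bracket S mu g 0 1 w + ent (conj_rep S w mu) 0 1 * bracket S mu g 1 0 w))).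
      by move=> w _; rewrite mulN1r -mulrBl bracket_trace_mul addNr.
    by apply: (hcD); apply: (hcD); [apply: (hcM)|apply: (hcN); apply: (hcM)|apply: (hcM)|apply: (hcM)].
  have : theta mu 0 0 = (e mu 0 0 - e mu 1 1) * theta g 0 0.
    apply: thE; move: h; rewrite e01 e10 !mul0r !addr0 mulN1r -mulrBl.
    by apply: head_coefficient_ext => w _; rewrite bracket_eq0.
  rewrite th_mu // => /esym/eqP; rewrite mulf_eq0 subr_eq0 => /orP[/eqP xe|/eqP //].
  by move/eqP: xx; case; rewrite -x11 -[LHS]x00.
have th11 g : theta g 1 1 = 0.
  apply: thE; apply: (head_coefficient_ext (f := fun w => (-1) * bracket S mu g 0 0 w)).
    by move=> w _; rewrite bracket_trace mulN1r.
  by have := hcN _ _ (thP g 0 0); rewrite th00 mulr0.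
have [g [i [j kE]]] := famk.
have : theta g i j = 1 by apply: thE; rewrite -kE; exact: head_coefficient_head.
suff -> : theta g i j = 0 by move/eqP; rewrite eq_sym oner_eq0.
by case: (ord2P i) => ->; case: (ord2P j) => ->.
Qed.

End Main.

(** * Representations on the slope curve *)

Lemma tripleE (R : realType) (x y z x' y' z' : R[i]) : triple x y z = triple x' y' z' ->
  [/\ x = x', y = y' & z = z'].
Proof.
move=> /rowP e; split.
- by have := e 0; rewrite !mxE.
- by have := e 1; rewrite !mxE.
- by have := e 2%:R; rewrite !mxE.
Qed.

Section Surgery.
Variable R : realType.
Local Notation C := R[i].
Local Notation space := (R * R * R)%type.
Variable K : framed_knot R.
Local Notation Gamma := (pi1_exterior K).
Variables (P : space -> sphere3 R) (rho0 : rep C Gamma) (u0 : space).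
Hypothesis hol : based_holonomy P rho0 u0.
Variables (T : R * R -> space) (c : int -> int -> Gamma).
Hypothesis hT : peripheral_lift P rho0 u0 T c.

Lemma boundary_coordsE (rho : rep C Gamma) : boundary_coords (restriction (rep_char rho)) =
  triple (\tr (rho (c 0 1) : 'M[C]_2)) (\tr (rho (c 1 0) : 'M[C]_2))
    (\tr (rho (c 0 1 * c 1 0)%g : 'M[C]_2)).
Proof.
have inclM : pi1_incl K (meridian K * longitude K)%g = (c 0 1 * c 1 0)%g.
  by rewrite gmulfM (peripheral_meridian hol hT) (peripheral_longitude hol hT).
by rewrite -inclM -(peripheral_meridian hol hT) -(peripheral_longitude hol hT).
Qed.

(** Since m differs from its inverse, the common eigenvalues of the meridian are distinct,
    which excludes the family with double eigenvalues from commuting_normal_form. *)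
Lemma diagonalize_peripheral (rho : rep C Gamma) (m l : C) : m != 0 -> l != 0 -> m != m^-1 ->
  \tr (rho (c 0 1) : 'M[C]_2) = m + m^-1 ->
  \tr (rho (c 1 0) : 'M[C]_2) = l + l^-1 ->
  \tr (rho (c 0 1 * c 1 0)%g : 'M[C]_2) = m * l + (m * l)^-1 ->
  exists S x y, [/\ diagonal_at (conj_rep S rho (c 0 1)) x, diagonal_at (conj_rep S rho (c 1 0)) y &
    (x = m /\ y = l) \/ (x = m^-1 /\ y = l^-1)].
Proof.
move=> m0 l0 mm trm trl trml.
have [S [low alt]] := @commuting_normal_form _ (int * int) (fun u => rho (c u.1 u.2))
  (fun g h => etrans (esym (repM rho _ _)) (etrans (congr1 rho (peripheral_commute hol hT _ _ _ _)) (repM rho _ _))).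
have trE g : \tr (rho g : 'M[C]_2) = ent (conj_rep S rho g) 0 0 + ent (conj_rep S rho g) 1 1.
  by rewrite -SL2_trace SL2_trace_conj.
have up u : ent (conj_rep S rho (c u.1 u.2)) 0 1 = 0.
  case: alt => [|eqd]; first exact.
  have A10 : ent (conj_rep S rho (c 0 1)) 1 0 = 0 by exact: (low (0, 1)).
  have Ad : ent (conj_rep S rho (c 0 1)) 0 0 = ent (conj_rep S rho (c 0 1)) 1 1 by exact: (eqd (0, 1)).
  have tr := trE (c 0 1); rewrite trm in tr.
  move: (conj_rep S rho (c 0 1)) A10 Ad tr => A A10 Ad tr.
  have := SL2E A; rewrite A10 mulr0 subr0 Ad -expr2 => A1.
  rewrite Ad in tr; suff : m = m^-1 by move/eqP: mm.
  have mE : m = ent A 1 1.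
    apply/eqP; rewrite -subr_eq0 -sqrf_eq0; apply/eqP.
    have -> : (m - ent A 1 1) ^+ 2 = m * (m + m^-1 - (ent A 1 1 + ent A 1 1)) + (ent A 1 1 ^+ 2 - 1).
      by field.
    by rewrite tr A1 !subrr mulr0 addr0.
  by apply: (mulfI m0); rewrite mulfV // -expr2 mE.
have dx : diagonal_at (conj_rep S rho (c 0 1)) (ent (conj_rep S rho (c 0 1)) 0 0).
  by split => //; [exact: (up (0, 1))|exact: (low (0, 1))].
have dy : diagonal_at (conj_rep S rho (c 1 0)) (ent (conj_rep S rho (c 1 0)) 0 0).
  by split => //; [exact: (up (1, 0))|exact: (low (1, 0))].
move: (ent (conj_rep S rho (c 0 1)) 0 0) (ent (conj_rep S rho (c 1 0)) 0 0) dx dy => x y dx dy.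
have tr_diag g z : diagonal_at (conj_rep S rho g) z -> \tr (rho g : 'M[C]_2) = z + z^-1.
  by move=> dz; rewrite trE; have [_ ->] := diagonal_entry dz; case: dz => _ _ ->.
have dxy : diagonal_at (conj_rep S rho (c 0 1 * c 1 0)%g) (x * y).
  by rewrite conj_repM; exact: diagonalM.
exists S, x, y; split => //; apply: trace_parameters => //.
- by case: (diagonal_entry dx).
- by case: (diagonal_entry dy).
- by rewrite -trm (tr_diag _ _ dx).
- by rewrite -trl (tr_diag _ _ dy).
- by rewrite -trml (tr_diag _ _ dxy).
Qed.

End Surgery.

Theorem proposition3p13 (R : realType) (K : framed_knot R)
  (hframing : preferred_framing K)
  (P : R * R * R -> sphere3 R) (hP : hyperbolic_structure K P)
  (rho0 : rep R[i] (pi1_exterior K)) (hrho0 : discrete_faithful_rep P rho0)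
  (R0 : set (rep R[i] (pi1_exterior K)))
  (hR0 : irreducible_component rep_coord R0) (hR0rho0 : R0 rho0)
  (p q r s : int) (hpq : coprimez p q) (hrs : p * s - q * r = 1) :
  (0 < lambda_pq R0 p q)%E -> ~ cyclic_group (pi1_filling K p q r s).
Proof.
move=> lam hcyc.
have [v [[[m l] [/= m0 l0 ml] <-] [_ [rho Rrho <-] coords] v2 vN2]] : S_pq R0 p q !=set0.
  apply/set0P/eqP => S0; move: lam; rewrite /lambda_pq S0 esum_set0 ltxx //.
have [u0 hol] := discrete_faithful_based hP hrho0.
have [T [c hT]] := peripheral_lift_exists hol.
move: coords; rewrite (boundary_coordsE hol hT) => /tripleE[trm trl trml].
have v00 : tD m l 0 0 = m + m^-1 by rewrite /tD !mxE.
rewrite v00 in v2 vN2.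
have mm : m != m^-1.
  apply/eqP => e; have : m ^+ 2 == 1 by rewrite expr2 {2}e mulfV.
  rewrite sqrf_eq1 => /orP[/eqP m1|/eqP m1].
    by move/eqP: v2; apply; rewrite m1 invr1.
  by move/eqP: vN2; apply; rewrite m1 invrN1 -opprD.
rewrite -invfM in trml.
have [S [x [y [dx dy xy]]]] := diagonalize_peripheral hol hT m0 l0 mm trm trl trml.
have slope : x ^ p * y ^ q = 1 \/ x ^ p * y ^ q = -1.
  case: xy => -[-> ->] //; rewrite !exprz_inv -!invr_expz -invfM.
  by case: ml => ->; [left; rewrite invr1|right; rewrite invrN1].
have ab := cyclic_filling_abelian hol hT hcyc (peripheral_central hol hT dx dy slope).
have longitude_derived : in_derived (c 1 0) by rewrite -(peripheral_longitude hol hT).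
have y1 : y = 1.
  by case: dy => _ _ <-; rewrite /conj_rep (derived_trivial ab longitude_derived) mul1g mulVg mxE eqxx.
have [_ R0_irr _] := hR0.
apply: (no_abelian_point hol hT hcyc longitude_derived R0_irr hR0rho0 Rrho ab dx).
  by case: xy => -[-> _] //; rewrite invrK eq_sym.
by move: slope; rewrite y1 exp1rz mulr1.
Qed.
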